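(* Let $(X,\bar 0)\subset(\mathbb{C}^3,\bar 0)$ be a surface germ and let $\pi:\mathbb{C}^3\to\mathbb{C}^2$ be a linear projection such that $\pi|_{(X,\bar 0)}$ is finite. Then there exists an injective arc $\gamma:(\mathbb{C},0)\to(\mathbb{C}^2,\bar 0)$ such that the curve germ $(X\cap\pi^{-1}(\gamma(\mathbb{D})),\bar 0)$ has as many irreducible components as the degree of the cover $\pi|_X$.
   Context: A surface germ in $(\mathbb{C}^3,\bar 0)$ is a hypersurface germ given by a reduced equation $F(x_1,x_2,x_3)=0$. Finiteness of $\pi|_{(X,\bar 0)}$ means $\pi^{-1}(\bar 0)\cap X=\{\bar 0\}$ as germs. Let $\Delta\subset(\mathbb{C}^2,\bar 0)$ be the discriminant of $\pi|_X$ (after a linear change of coordinates $\pi$ is $(x_1,x_2,x_3)\mapsto(x_1,x_2)$, $F$ is taken to be a Weierstrass polynomial in $x_3$, and $\Delta$ is the zero set of its discriminant with respect to $x_3$). The restriction of $\pi$ to $X\setminus\pi^{-1}(\Delta)$ is an unramified covering; its degree $d$ (which equals the degree of the Weierstrass polynomial) is the degree of the cover $\pi|_X$. An arc is a holomorphic map germ $\gamma:(\mathbb{C},0)\to(\mathbb{C}^2,\bar 0)$, and $\gamma:\mathbb{D}\to\mathbb{C}^2$ denotes an injective representative on a sufficiently small closed disk $\mathbb{D}$ centered at $0$. *)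

(* Defs.v *)
From HB Require Import structures.
From mathcomp Require Import all_boot all_order all_algebra.
From mathcomp Require Import all_classical all_reals all_analysis.
From mathcomp Require Import complex.

Set Implicit Arguments.
Unset Strict Implicit.
Unset Printing Implicit Defensive.

Import Order.TTheory GRing.Theory Num.Theory.
Import numFieldNormedType.Exports.

Local Open Scope classical_set_scope.
Local Open Scope ring_scope.

(* The complex numbers.  Typing R[i] as a numClosedFieldType is what gives it
   (and the row vectors over it) the topology of MathComp-Analysis. *)
Definition C (R : realType) : numClosedFieldType := complex R.

Definition monomial (R : realType) (n : nat) (x : 'rV[C R]_n)
    (alpha : 'I_n -> nat) : C R :=
  \prod_(i < n) x ord0 i ^+ alpha i.

(* Partial sum, over the multi-indices in {0, ..., N-1}^n, of the power series
   \sum_alpha a_alpha x^alpha. *)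
Definition pseries_psum (R : realType) (n : nat) (a : ('I_n -> nat) -> C R)
    (x : 'rV[C R]_n) (N : nat) : C R :=
  \sum_(alpha : {ffun 'I_n -> 'I_N})
     a (fun i => alpha i : nat) * monomial x (fun i => alpha i : nat).

(* f is the sum of a power series that converges absolutely on the closed
   polydisk of radius r centered at 0.  Absolute convergence is bounded partial
   sums of |a_alpha| r^|alpha|; the order of summation is then irrelevant. *)
Definition pseries_on (R : realType) (n : nat) (r : C R)
    (f : 'rV[C R]_n -> C R) : Prop :=
  exists a : ('I_n -> nat) -> C R,
    (exists M : C R, forall N,
       pseries_psum (fun alpha => `|a alpha|) (const_mx r) N <= M) /\
    (forall x : 'rV[C R]_n, (forall i, `|x ord0 i| <= r) ->
       pseries_psum a x @ \oo --> f x).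

(* f represents an element of C{x_1, ..., x_n}, the ring of holomorphic function
   germs at 0; away from 0 the total function f is arbitrary. *)
Definition holomorphic_germ (R : realType) (n : nat)
    (f : 'rV[C R]_n -> C R) : Prop :=
  exists2 r : C R, 0 < r & pseries_on r f.

Definition fgerm_eq (R : realType) (n : nat) (f g : 'rV[C R]_n -> C R) : Prop :=
  \forall x \near (0 : 'rV[C R]_n), f x = g x.

Definition germ_sub (R : realType) (n : nat) (A B : set 'rV[C R]_n) : Prop :=
  \forall x \near (0 : 'rV[C R]_n), A x -> B x.

Definition germ_eq (R : realType) (n : nat) (A B : set 'rV[C R]_n) : Prop :=
  \forall x \near (0 : 'rV[C R]_n), A x <-> B x.

Definition zeros (R : realType) (n : nat) (f : 'rV[C R]_n -> C R) :
  set 'rV[C R]_n := [set x | f x = 0].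

(* F = 0 is a reduced equation of a hypersurface germ at 0: F is a nonzero
   nonunit, and C{x_1, ..., x_n} / (F) has no nonzero nilpotent. *)
Definition reduced_equation (R : realType) (n : nat)
    (F : 'rV[C R]_n -> C R) : Prop :=
  [/\ holomorphic_germ F,
      F 0 = 0,
      ~ fgerm_eq F (fun=> 0) &
      forall (g h : 'rV[C R]_n -> C R) (k : nat),
        holomorphic_germ g -> holomorphic_germ h ->
        fgerm_eq (fun x => g x ^+ k) (fun x => F x * h x) ->
        exists2 q, holomorphic_germ q & fgerm_eq g (fun x => F x * q x)].

Definition finite_on (R : realType) (n m : nat) (X : set 'rV[C R]_n)
    (pi : 'rV[C R]_n -> 'rV[C R]_m) : Prop :=
  germ_eq (X `&` pi @^-1` [set 0]) [set 0].

Definition proj12 (R : realType) (x : 'rV[C R]_3) : 'rV[C R]_2 :=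
  \row_(j < 2) x ord0 (widen_ord (leqnSn 2) j).

(* The polynomial 'X^m + a_(m-1)(y) 'X^(m-1) + ... + a_0(y). *)
Definition monic_at (R : realType) (m : nat)
    (a : 'I_m -> 'rV[C R]_2 -> C R) (y : 'rV[C R]_2) : {poly C R} :=
  'X^m + \sum_(i < m) a i y *: 'X^i.

(* In the linear coordinates x |-> x *m A on C^3, pi is
   (x_1, x_2, x_3) |-> (x_1, x_2) and F is, up to a unit, the Weierstrass
   polynomial in x_3 with coefficients a. *)
Definition weierstrass_form (R : realType) (F : 'rV[C R]_3 -> C R)
    (pi : 'rV[C R]_3 -> 'rV[C R]_2) (A : 'M[C R]_3) (m : nat)
    (a : 'I_m -> 'rV[C R]_2 -> C R) : Prop :=
  [/\ A \in unitmx,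
      forall x, pi (x *m A) = proj12 x,
      forall i, holomorphic_germ (a i) /\ a i 0 = 0 &
      exists u : 'rV[C R]_3 -> C R,
        [/\ holomorphic_germ u, u 0 != 0 &
            fgerm_eq (fun x => F (x *m A))
                     (fun x => u x * (monic_at a (proj12 x)).[x ord0 ord_max])]].

(* Delta is the zero set of the discriminant of a Weierstrass polynomial of F;
   as the polynomial is monic, its discriminant is, up to sign, its resultant
   with its derivative. *)
Definition is_discriminant (R : realType) (F : 'rV[C R]_3 -> C R)
    (pi : 'rV[C R]_3 -> 'rV[C R]_2) (Delta : set 'rV[C R]_2) : Prop :=
  exists (A : 'M[C R]_3) (m : nat) (a : 'I_m -> 'rV[C R]_2 -> C R),
    weierstrass_form F pi A a /\
    Delta = zeros (fun y => resultant (monic_at a y) (monic_at a y)^`()).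

(* d is the number of sheets of the covering that pi induces on
   X \ pi^-1(Delta): for all sufficiently small neighborhoods U of 0 in C^3, the
   fiber of X `&` U over each point outside Delta and close to 0 has d points. *)
Definition cover_degree (R : realType) (F : 'rV[C R]_3 -> C R)
    (pi : 'rV[C R]_3 -> 'rV[C R]_2) (d : nat) : Prop :=
  exists2 Delta : set 'rV[C R]_2, is_discriminant F pi Delta &
    exists2 U0 : set 'rV[C R]_3, nbhs (0 : 'rV[C R]_3) U0 &
      forall U : set 'rV[C R]_3, nbhs (0 : 'rV[C R]_3) U -> U `<=` U0 ->
        \forall y \near (0 : 'rV[C R]_2), ~ Delta y ->
          (zeros F `&` U `&` pi @^-1` [set y] #= `I_d)%card.

Definition analytic_germ (R : realType) (n : nat) (Y : set 'rV[C R]_n) : Prop :=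
  exists (k : nat) (f : 'I_k -> 'rV[C R]_n -> C R),
    (forall i, holomorphic_germ (f i)) /\
    germ_eq Y [set x | forall i, f i x = 0].

Definition irreducible_germ (R : realType) (n : nat)
    (Y : set 'rV[C R]_n) : Prop :=
  [/\ analytic_germ Y, Y 0 &
      forall A B : set 'rV[C R]_n, analytic_germ A -> analytic_germ B ->
        germ_eq Y (A `|` B) -> germ_eq Y A \/ germ_eq Y B].

(* The germ of Z at 0 has exactly d irreducible components: it is an irredundant
   union of d irreducible germs. *)
Definition num_irreducible_components (R : realType) (n : nat)
    (Z : set 'rV[C R]_n) (d : nat) : Prop :=
  exists Y : 'I_d -> set 'rV[C R]_n,
    [/\ forall i, irreducible_germ (Y i),
        forall i j, germ_sub (Y i) (Y j) -> i = j &
        germ_eq Z [set x | exists i, Y i x]].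

Definition disk (R : realType) (r : C R) : set (C R) := [set t | `|t| <= r].

(* gamma, restricted to the closed disk of radius r, is an injective
   representative of an arc (C, 0) -> (C^2, 0). *)
Definition injective_arc (R : realType) (r : C R)
    (gamma : C R -> 'rV[C R]_2) : Prop :=
  [/\ gamma 0 = 0,
      forall j, pseries_on r (fun t : 'rV[C R]_1 => gamma (t ord0 ord0) ord0 j) &
      forall s t, disk r s -> disk r t -> gamma s = gamma t -> s = t].

(* Main.v *)
(* Let P be the Weierstrass polynomial of F, of degree m = d.  As F is reduced, P
   is separable over a generic point: otherwise the endomorphism v |-> v P' of
   C{y}[z]_(<m) modulo P has a kernel, whose elements are nilpotent modulo F.  So
   P is separable over a generic complex line through 0, and there Puiseux's
   theorem gives m distinct roots that are convergent power series in t, after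
   y = t^N y0.  The arc gamma(t) = t^N y0 + t^(k N + 1) y1 is a perturbation of
   this line; for k large Newton's lemma moves each of the m roots to a root
   psi_i(t) of P over gamma(t), and the psi_i stay distinct.  Now gamma is
   injective, since N and k N + 1 are coprime.  Each root is a function of t
   itself, without further ramification, so it parametrizes an irreducible
   component of the preimage of gamma: a germ of an analytic set vanishes on it
   either identically or only at t = 0. *)

Require Import Defs.
From HB Require Import structures.
From mathcomp Require Import -(notations) mpoly.
From mathcomp Require Import all_boot all_order all_algebra.
From mathcomp Require Import all_classical all_reals all_analysis.
From mathcomp Require Import complex separable.
From mathcomp Require Import ring zify.

Set Implicit Arguments.
Unset Strict Implicit.
Unset Printing Implicit Defensive.

Import Order.TTheory GRing.Theory Num.Theory.
Import numFieldNormedType.Exports.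

Local Open Scope classical_set_scope.
Local Open Scope ring_scope.

(** * Formal power series *)

(** Two steps carry the weight. Persistence of the roots is quantitative: if [e] bounds the orders
    in t of the values of P' at the Puiseux roots, agreement of arc and line to order [2 e + 1] lets
    Newton's lemma apply, and the moved roots equal the old ones modulo t^(e+1), which is enough to
    keep them apart. Next, a parametrized branch must be exhibited as an analytic germ. With l0 =
    t^N and l1 = t^(k N + 1) the parameter is l1 / l0^k, and sorting the exponents of a root modulo
    N turns z = psi(t) into an equation in l0, l1, z, after multiplication by a power of l0. The
    locus l0 = 0 that this adds is cut down to the origin by F and the finiteness of the projection.
    Germs are represented by total functions, whose ring has zero divisors. Linear algebra over it
    therefore uses minors that do not vanish identically near 0, and divisibility by P is tested
    fiber by fiber, through bounds |v| <= M |P|. Convergence always means that weighted norms of the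
    truncations are uniformly bounded. *)

Record fps (K : Type) := Fps { fcoef :> nat -> K }.

HB.instance Definition _ (K : Type) := gen_eqMixin (fps K).
HB.instance Definition _ (K : Type) := gen_choiceMixin (fps K).

Lemma fpsP (K : Type) (x y : fps K) : x =1 y -> x = y.
Proof. by case: x y => [x] [y] /= e; congr Fps; apply/funext. Qed.

Section FpsRing.
Variable K : comNzRingType.
Implicit Types x y z : fps K.

Definition ftrunc (n : nat) x : {poly K} := \poly_(i < n) x i.

(** The record wrapper keeps this ring structure apart from the pointwise one on functions, which
    serves below for families of germs. *)
Definition fadd x y := Fps (fun n => x n + y n).
Definition fopp x := Fps (fun n => - x n).
Definition fmul x y := Fps (fun n => \sum_(i < n.+1) x i * y (n - i)%N).
Definition fpsC (c : K) := Fps (fun n => if n == 0 then c else 0).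

Fact faddA : associative fadd.
Proof. by move=> x y z; apply: fpsP => n; apply: addrA. Qed.
Fact faddC : commutative fadd.
Proof. by move=> x y; apply: fpsP => n; apply: addrC. Qed.
Fact fadd0 : left_id (fpsC 0) fadd.
Proof. by move=> x; apply: fpsP => n /=; rewrite if_same add0r. Qed.
Fact faddN : left_inverse (fpsC 0) fopp fadd.
Proof. by move=> x; apply: fpsP => n /=; rewrite if_same addNr. Qed.

HB.instance Definition _ := GRing.isZmodule.Build (fps K) faddA faddC fadd0 faddN.

Lemma coef_ftrunc N x n : (n < N)%N -> (ftrunc N x)`_n = x n.
Proof. by move=> nN; rewrite coef_poly nN. Qed.

Lemma coefM_congr (p q p' q' : {poly K}) n :
  (forall i, (i <= n)%N -> p`_i = p'`_i) ->
  (forall i, (i <= n)%N -> q`_i = q'`_i) -> (p * q)`_n = (p' * q')`_n.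
Proof.
move=> hp hq; rewrite !coefM; apply: eq_bigr => i _.
by rewrite hp ?hq ?leq_subr // -ltnS.
Qed.

(** A coefficient of a product involves finitely many others, so identities between series are
    imported from [{poly K}] through truncations. *)
Lemma coef_fmul N x y n : (n < N)%N -> fmul x y n = (ftrunc N x * ftrunc N y)`_n.
Proof.
move=> nN; rewrite coefM /=; apply: eq_bigr => i _.
by rewrite !coef_ftrunc // (leq_ltn_trans _ nN) ?leq_subr // -ltnS.
Qed.

Fact fmulA : associative fmul.
Proof.
move=> x y z; apply: fpsP => n.
rewrite (@coef_fmul n.+1) // (@coef_fmul n.+1 (fmul x y)) //.
transitivity (ftrunc n.+1 x * (ftrunc n.+1 y * ftrunc n.+1 z))`_n.
  by apply: coefM_congr => // i le_in; rewrite coef_ftrunc // (@coef_fmul n.+1).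
rewrite mulrA; apply: coefM_congr => // i le_in.
by rewrite coef_ftrunc // (@coef_fmul n.+1).
Qed.

Fact fmulC : commutative fmul.
Proof. by move=> x y; apply: fpsP => n; rewrite !(@coef_fmul n.+1) // mulrC. Qed.

Fact fmul1 : left_id (fpsC 1) fmul.
Proof.
move=> x; apply: fpsP => n /=.
rewrite big_ord_recl /= mul1r subn0 big1 ?addr0 // => i _.
by rewrite /bump /= mul0r.
Qed.

Fact fmulD : left_distributive fmul fadd.
Proof.
move=> x y z; apply: fpsP => n /=; rewrite -big_split /=.
by apply: eq_bigr => i _; rewrite mulrDl.
Qed.

Fact f1_neq0 : fpsC 1 != 0.
Proof. by apply/eqP => /(congr1 (fun x : fps K => x 0%N))/eqP; rewrite /= oner_eq0. Qed.

HB.instance Definition _ :=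
  GRing.Zmodule_isComNzRing.Build (fps K) fmulA fmulC fmul1 fmulD f1_neq0.

Lemma fcoefD x y n : (x + y) n = x n + y n. Proof. by []. Qed.
Lemma fcoefN x n : (- x) n = - x n. Proof. by []. Qed.
Lemma fcoef0 n : (0 : fps K) n = 0. Proof. by rewrite /= if_same. Qed.
Lemma fcoef1 n : (1 : fps K) n = (n == 0%N)%:R. Proof. by case: n. Qed.
Lemma fcoefM x y n : (x * y) n = \sum_(i < n.+1) x i * y (n - i)%N.
Proof. by []. Qed.
Lemma fcoefM_trunc N x y n :
  (n < N)%N -> (x * y) n = (ftrunc N x * ftrunc N y)`_n.
Proof. exact: coef_fmul. Qed.

Lemma fcoef_sum I (r : seq I) (P : pred I) (f : I -> fps K) n :
  (\sum_(i <- r | P i) f i) n = \sum_(i <- r | P i) f i n.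
Proof. by apply: (big_morph (fun x : fps K => x n)) => //; rewrite fcoef0. Qed.

Fact fpsC_zmod : zmod_morphism fpsC.
Proof. by move=> a b; apply: fpsP => -[|n] //=; rewrite subrr. Qed.
Fact fpsC_monoid : monoid_morphism fpsC.
Proof.
split=> // a b; apply: fpsP => n; rewrite fcoefM big_ord_recl /= subn0 big1.
  by case: n => [|n] /=; rewrite addr0 ?mulr0.
by move=> i _; rewrite /bump /= mul0r.
Qed.
HB.instance Definition _ := GRing.isZmodMorphism.Build K (fps K) fpsC fpsC_zmod.
HB.instance Definition _ := GRing.isMonoidMorphism.Build K (fps K) fpsC fpsC_monoid.

Lemma fcoefCM c x n : (fpsC c * x) n = c * x n.
Proof.
rewrite fcoefM big_ord_recl /= subn0 big1 ?addr0 // => i _.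
by rewrite /bump /= mul0r.
Qed.

Definition fpsX : fps K := Fps (fun n => (n == 1%N)%:R).

Lemma fcoefXM x n : (fpsX * x) n = if n is k.+1 then x k else 0.
Proof.
rewrite fcoefM; case: n => [|n]; first by rewrite big_ord1 /= mul0r.
rewrite big_ord_recl /= mul0r add0r big_ord_recl /= /bump /= mul1r subSS subn0.
by rewrite big1 ?addr0 // => i _; rewrite mul0r.
Qed.

Lemma fcoefXnM k x n : (fpsX ^+ k * x) n = if (n < k)%N then 0 else x (n - k)%N.
Proof.
elim: k n => [|k IH] n; first by rewrite expr0 mul1r subn0.
rewrite exprS -mulrA fcoefXM; case: n => [|n] //; rewrite IH ltnS subSS //.
Qed.

Lemma fcoefXn k n : (fpsX ^+ k : fps K) n = (n == k)%:R.
Proof.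
rewrite -[_ ^+ _]mulr1 fcoefXnM fcoef1 subn_eq0.
by case: ltngtP.
Qed.

Definition order_ge k x := forall n, (n < k)%N -> x n = 0.

Definition fshift k x := Fps (fun n => x (n + k)%N).

Lemma fshiftK k x : order_ge k x -> fpsX ^+ k * fshift k x = x.
Proof.
move=> kx; apply: fpsP => n; rewrite fcoefXnM; case: ltnP => [/kx//|kn] /=.
by rewrite subnK.
Qed.

Lemma order_geXnM k x : order_ge k (fpsX ^+ k * x).
Proof. by move=> n nk; rewrite fcoefXnM nk. Qed.

Lemma order_geP k x : order_ge k x <-> exists y, x = fpsX ^+ k * y.
Proof.
split=> [/fshiftK <-|[y ->]]; [by exists (fshift k x)|exact: order_geXnM].
Qed.

Lemma order_ge0 k : order_ge k 0. Proof. by move=> n _; rewrite fcoef0. Qed.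
Lemma order_geD k x y : order_ge k x -> order_ge k y -> order_ge k (x + y).
Proof. by move=> hx hy n nk; rewrite fcoefD hx ?hy ?addr0. Qed.
Lemma order_geN k x : order_ge k x -> order_ge k (- x).
Proof. by move=> hx n nk; rewrite fcoefN hx ?oppr0. Qed.
Lemma order_geB k x y : order_ge k x -> order_ge k y -> order_ge k (x - y).
Proof. by move=> hx hy; apply: order_geD => //; apply: order_geN. Qed.
Lemma order_geM k l x y :
  order_ge k x -> order_ge l y -> order_ge (k + l) (x * y).
Proof.
move=> /order_geP[x' ->] /order_geP[y' ->].
by rewrite mulrACA -exprD; apply: order_geXnM.
Qed.
Lemma order_geMl k x y : order_ge k x -> order_ge k (y * x).
Proof. by move=> kx; rewrite -(add0n k); apply: order_geM. Qed.
Lemma order_geMr k x y : order_ge k x -> order_ge k (x * y).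
Proof. by rewrite mulrC; apply: order_geMl. Qed.
Lemma order_ge_sum k I (r : seq I) (P : pred I) (f : I -> fps K) :
  (forall i, P i -> order_ge k (f i)) -> order_ge k (\sum_(i <- r | P i) f i).
Proof. by move=> h n nk; rewrite fcoef_sum big1 // => i /h; apply. Qed.
Lemma order_geW k l x : (k <= l)%N -> order_ge l x -> order_ge k x.
Proof. by move=> kl lx n nk; apply: lx; apply: leq_trans kl. Qed.
Lemma order_geXn k x : order_ge 1 x -> order_ge k (x ^+ k).
Proof.
move=> x1; elim: k => [|k IH] //; rewrite exprS -add1n; exact: order_geM.
Qed.

(** The substitution of t^q for t, for positive [q]; it turns Puiseux series into power series. *)
Definition fsub q x := Fps (fun n => if (q %| n)%N then x (n %/ q)%N else 0).

End FpsRing.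

Section FpsSub.
Variables (K : comNzRingType) (q : nat).
Hypothesis q_gt0 : (0 < q)%N.
Implicit Types x y : fps K.

Lemma fsubB x y : fsub q (x - y) = fsub q x - fsub q y.
Proof. by apply: fpsP => n /=; case: ifP => // _; rewrite subr0. Qed.

Lemma fsubC (c : K) : fsub q (fpsC c) = fpsC c.
Proof.
apply: fpsP => n /=; case: ifP => [/dvdnP[k ->]|]; last first.
  by case: n => //=; rewrite dvdn0.
by rewrite mulnK // muln_eq0 (gtn_eqF q_gt0) orbF.
Qed.

Lemma fsubM x y : fsub q (x * y) = fsub q x * fsub q y.
Proof.
apply: fpsP => n; set N := n.+1.
rewrite (@fcoefM_trunc _ N (fsub q x)) //=.
transitivity ((ftrunc N x * ftrunc N y) \Po 'X^q)`_n.
  rewrite coef_comp_poly_Xn //; case: ifP => // _.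
  by rewrite -fcoefM_trunc // ltnS leq_div.
rewrite comp_polyM; apply: coefM_congr => i le_in;
  rewrite coef_comp_poly_Xn // [in RHS]coef_ftrunc ?ltnS //=;
  case: ifP => // _; rewrite coef_ftrunc // ltnS;
  exact: leq_trans (leq_div _ _) le_in.
Qed.

Fact fsub_zmod : zmod_morphism (@fsub K q). Proof. exact: fsubB. Qed.
Fact fsub_monoid : monoid_morphism (@fsub K q).
Proof. by split; [exact: fsubC|exact: fsubM]. Qed.

Lemma fsubXn k : fsub q (fpsX K ^+ k) = fpsX K ^+ (k * q).
Proof.
apply: fpsP => n; rewrite fcoefXn /= fcoefXn.
case: ifP => [/dvdnP[j ->]|/negP h]; first by rewrite mulnK // eqn_pmul2r.
by case: eqP => // e; case: h; rewrite e dvdn_mull.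
Qed.

Lemma order_ge_fsub k x : order_ge k x -> order_ge (k * q) (fsub q x).
Proof.
move=> kx n nk /=; case: ifP => // _; apply: kx.
by rewrite ltn_divLR.
Qed.

End FpsSub.

(* The substitution t |-> t^(q+1): [fsub 0] is not a ring morphism. *)
Definition fsubm (K : comNzRingType) (q : nat) (x : fps K) := fsub q.+1 x.
HB.instance Definition _ (K : comNzRingType) (q : nat) :=
  GRing.isZmodMorphism.Build (fps K) (fps K) (@fsubm K q) (@fsub_zmod K q.+1).
HB.instance Definition _ (K : comNzRingType) (q : nat) :=
  GRing.isMonoidMorphism.Build (fps K) (fps K) (@fsubm K q)
    (@fsub_monoid K q.+1 (ltn0Sn q)).

Lemma fsubA (K : comNzRingType) (p q : nat) (x : fps K) :
  (0 < p)%N -> (0 < q)%N -> fsub q (fsub p x) = fsub (p * q) x.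
Proof.
move=> p0 q0; apply: fpsP => n /=.
have [/dvdnP[j ->]|h] := boolP (q %| n)%N.
  by rewrite mulnK // dvdn_pmul2r // divnMr.
by rewrite ifN //; apply: contra h => /(dvdn_trans _); apply; apply: dvdn_mull.
Qed.

Global Opaque fadd fopp fmul.

(** * Convergent power series *)

(** The order of the complex numbers is partial, but positive elements are real and hence
    comparable. *)
Lemma pos_min (K : numDomainType) (a b : K) :
  0 < a -> 0 < b -> exists2 c, 0 < c & c <= a /\ c <= b.
Proof.
move=> a0 b0; have /orP[ab|ba] := real_leVge (gtr0_real a0) (gtr0_real b0).
  by exists a.
by exists b.
Qed.

(** Serves to choose one radius for finitely many conditions, each inherited by smaller radii. *)
Lemma pos_min_fin (K : numDomainType) (I : finType) (P : I -> K -> Prop) :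
  (forall i a b, 0 < a -> a <= b -> P i b -> P i a) ->
  (forall i, exists2 a, 0 < a & P i a) -> exists2 a, 0 < a & forall i, P i a.
Proof.
move=> Pmono Pex.
suff [a a0 ha] : exists2 a, 0 < a & forall i, i \in enum I -> P i a.
  by exists a => // i; apply: ha; rewrite mem_enum.
elim: (enum I) => [|i s [a a0 ha]]; first by exists 1.
have [b b0 hb] := Pex i; have [c c0 [ca cb]] := pos_min a0 b0.
exists c => // j; rewrite inE => /orP[/eqP->|/ha].
  exact: Pmono hb.
exact: Pmono.
Qed.

Section FpsNorm.
Variable K : numFieldType.
Implicit Types (x y : fps K) (s : K).

Definition abs_trunc n x : {poly K} := \poly_(i < n) `|x i|.
(** A weighted l^1 norm of the first [n] terms. A bound uniform in [n] expresses absolute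
    convergence on the closed disk of radius [s], without any infinite sum. *)
Definition tnorm s n x : K := (abs_trunc n x).[s].

Lemma tnormE s n x : tnorm s n x = \sum_(i < n) `|x i| * s ^+ i.
Proof. by rewrite /tnorm horner_poly. Qed.

Lemma tnorm_ge0 s n x : 0 <= s -> 0 <= tnorm s n x.
Proof.
by move=> s0; rewrite tnormE sumr_ge0 // => i _; rewrite mulr_ge0 ?exprn_ge0.
Qed.

Lemma ler_tnorm s s' n m x : 0 <= s -> s <= s' -> (n <= m)%N ->
  tnorm s n x <= tnorm s' m x.
Proof.
move=> s0 ss' nm; have s'0 := le_trans s0 ss'.
rewrite !tnormE -!(big_mkord predT (fun i => `|x i| * _ ^+ i)).
rewrite [leRHS](big_cat_nat (n := n)) //= ler_wpDr //.
  by apply: sumr_ge0 => i _; rewrite mulr_ge0 ?exprn_ge0.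
by apply: ler_sum => i _; rewrite ler_wpM2l // lerXn2r ?nnegrE.
Qed.

Lemma tnormD s n x y : 0 <= s -> tnorm s n (x + y) <= tnorm s n x + tnorm s n y.
Proof.
move=> s0; rewrite !tnormE -big_split /=; apply: ler_sum => i _.
by rewrite -mulrDl ler_wpM2r ?exprn_ge0 // ler_normD.
Qed.

Lemma tnormN s n x : tnorm s n (- x) = tnorm s n x.
Proof. by rewrite !tnormE; apply: eq_bigr => i _; rewrite fcoefN normrN. Qed.

Lemma abs_trunc_ge0 n x i : 0 <= (abs_trunc n x)`_i.
Proof. by rewrite coef_poly; case: ifP. Qed.

Lemma abs_truncM_ge0 n m x y i : 0 <= (abs_trunc n x * abs_trunc m y)`_i.
Proof. by rewrite coefM sumr_ge0 // => j _; rewrite mulr_ge0 ?abs_trunc_ge0. Qed.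

Lemma norm_truncM n x y i :
  `|(ftrunc n x * ftrunc n y)`_i| <= (abs_trunc n x * abs_trunc n y)`_i.
Proof.
rewrite !coefM (le_trans (ler_norm_sum _ _ _)) // ler_sum // => j _.
by rewrite normrM !coef_poly; case: ifP; case: ifP; rewrite ?normr0.
Qed.

Lemma sum_coef_horner (p : {poly K}) s n : 0 <= s -> (forall i, 0 <= p`_i) ->
  \sum_(i < n) p`_i * s ^+ i <= p.[s].
Proof.
move=> s0 p0; rewrite (@horner_coef_wide _ (maxn n (size p))) ?leq_maxr //.
rewrite -!(big_mkord predT (fun i => p`_i * s ^+ i)).
rewrite [leRHS](big_cat_nat (n := n)) ?leq_maxl //= lerDl.
by apply: sumr_ge0 => i _; rewrite mulr_ge0 ?exprn_ge0.
Qed.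

Lemma tnormM s n x y : 0 <= s -> tnorm s n (x * y) <= tnorm s n x * tnorm s n y.
Proof.
move=> s0; rewrite /tnorm -hornerM.
apply: le_trans (sum_coef_horner n s0 (abs_truncM_ge0 n n x y)).
rewrite -/(tnorm s n _) tnormE; apply: ler_sum => i _.
by rewrite ler_wpM2r ?exprn_ge0 // (@fcoefM_trunc _ n) // norm_truncM.
Qed.

Lemma tnormC s n c : tnorm s n (fpsC c) <= `|c|.
Proof.
rewrite tnormE; case: n => [|n]; first by rewrite big_ord0.
by rewrite big_ord_recl /= mulr1 big1 ?addr0 // => i _; rewrite normr0 mul0r.
Qed.

Lemma tnormXM s n x : tnorm s n.+1 (fpsX K * x) = s * tnorm s n x.
Proof.
rewrite !tnormE big_ord_recl fcoefXM normr0 mul0r add0r big_distrr.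
by apply: eq_bigr => i _; rewrite lift0 fcoefXM exprS mulrCA.
Qed.

Definition conv_at s x := exists M, forall n, tnorm s n x <= M.

Lemma conv_at_le s s' x : 0 <= s -> s <= s' -> conv_at s' x -> conv_at s x.
Proof.
move=> s0 ss' [M hM]; exists M => n.
exact: le_trans (ler_tnorm x s0 ss' (leqnn n)) (hM n).
Qed.

Lemma conv_at_bound s x : 0 <= s -> conv_at s x ->
  exists2 M, 0 <= M & forall n, tnorm s n x <= M.
Proof.
move=> s0 [M hM]; exists M => //.
by rewrite (le_trans _ (hM 0%N)) // tnorm_ge0.
Qed.

Lemma conv_atD s x y : 0 <= s -> conv_at s x -> conv_at s y -> conv_at s (x + y).
Proof.
move=> s0 [M hM] [N hN]; exists (M + N) => n.
by rewrite (le_trans (tnormD _ _ _ s0)) // lerD.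
Qed.

Lemma conv_atN s x : conv_at s x -> conv_at s (- x).
Proof. by move=> [M hM]; exists M => n; rewrite tnormN. Qed.

Lemma conv_atM s x y : 0 <= s -> conv_at s x -> conv_at s y -> conv_at s (x * y).
Proof.
move=> s0 [M hM] [N hN]; exists (M * N) => n.
by rewrite (le_trans (tnormM _ _ _ s0)) // ler_pM ?tnorm_ge0.
Qed.

Lemma conv_atC s c : conv_at s (fpsC c).
Proof. by exists `|c| => n; exact: tnormC. Qed.

Lemma conv_atX s : 0 <= s -> conv_at s (fpsX K).
Proof.
move=> s0; exists s => n; apply: le_trans (ler_tnorm _ s0 (lexx s) (leqnSn n)) _.
rewrite -[fpsX K]mulr1 tnormXM -[leRHS]mulr1 ler_wpM2l //.
by rewrite (le_trans (tnormC s n 1)) ?normr1.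
Qed.

Definition conv : {pred fps K} := fun x => `[< exists2 s, 0 < s & conv_at s x >].

Lemma convP x : reflect (exists2 s, 0 < s & conv_at s x) (x \in conv).
Proof. exact: asboolP. Qed.

Lemma conv_common x y : x \in conv -> y \in conv ->
  exists2 s, 0 < s & conv_at s x /\ conv_at s y.
Proof.
move=> /convP[s s0 xs] /convP[s' s'0 ys]; have [c c0 [cs cs']] := pos_min s0 s'0.
by exists c => //; split; [move: xs|move: ys]; apply: conv_at_le => //; apply: ltW.
Qed.

Fact conv_subring : subring_closed conv.
Proof.
split; first by apply/convP; exists 1 => //; exact: conv_atC.
  move=> x y /conv_common/[apply] -[s s0 [xs ys]]; apply/convP; exists s => //.
  by apply: conv_atD; [exact: ltW| |exact: conv_atN].
move=> x y /conv_common/[apply] -[s s0 [xs ys]]; apply/convP; exists s => //.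
by apply: conv_atM => //; exact: ltW.
Qed.

HB.instance Definition _ := GRing.isSubringClosed.Build (fps K) conv conv_subring.

Lemma convC c : fpsC c \in conv.
Proof. by apply/convP; exists 1 => //; exact: conv_atC. Qed.

Lemma convX : fpsX K \in conv.
Proof. by apply/convP; exists 1 => //; exact: conv_atX. Qed.

Lemma conv_fshift k x : x \in conv -> fshift k x \in conv.
Proof.
move=> /convP[s s0 [M hM]]; apply/convP; exists s => //.
exists (M / s ^+ k) => n; rewrite ler_pdivlMr ?exprn_gt0 //.
apply: le_trans (hM (n + k)%N); rewrite !tnormE big_distrl /=.
rewrite -(big_mkord predT (fun i => `|x i| * s ^+ i)).
rewrite (big_cat_nat (n := k)) ?leq_addl //= ler_wpDl //.
  by apply: sumr_ge0 => i _; rewrite mulr_ge0 ?exprn_ge0 // ltW.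
rewrite -[X in \sum_(X <= _ < _) _]add0n big_addn addnK big_mkord.
by apply: ler_sum => i _; rewrite -mulrA -exprD.
Qed.

Lemma conv_order_geP k x : x \in conv -> order_ge k x ->
  exists2 y, y \in conv & x = fpsX K ^+ k * y.
Proof.
by move=> cx kx; exists (fshift k x); rewrite ?conv_fshift // fshiftK.
Qed.

Lemma conv_le s x : (forall i, `|x i| <= s ^+ i) -> 0 < s -> x \in conv.
Proof.
move=> xs s0; have h0 : 0 < s *+ 2 by rewrite pmulrn_lgt0.
(* At radius 1/(2s) the series is dominated by the geometric series of ratio 1/2, whose sum is 2. *)
apply/convP; exists ((s *+ 2)^-1); first by rewrite invr_gt0.
exists 2 => n; rewrite tnormE.
apply: (@le_trans _ _ (\sum_(i < n) 2^-1 ^+ i)).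
  apply: ler_sum => i _; rewrite [X in _ * X]exprVn ler_pdivrMr ?exprn_gt0 //.
  by rewrite -exprMn -[s *+ 2]mulr_natl mulrA mulVf ?pnatr_eq0 // mul1r.
have <- : 2 - 2 * 2^-1 ^+ n = \sum_(i < n) 2^-1 ^+ i :> K.
  elim: n => [|n IH]; first by rewrite big_ord0 expr0 mulr1 subrr.
  by rewrite big_ord_recr /= -IH exprS; field.
by rewrite gerBl mulr_ge0 // exprn_ge0 // invr_ge0.
Qed.

Lemma tnorm_coef s n x : 0 <= s -> `|x n| * s ^+ n <= tnorm s n.+1 x.
Proof.
move=> s0; rewrite tnormE big_ord_recr /= lerDr.
by apply: sumr_ge0 => i _; rewrite mulr_ge0 ?exprn_ge0.
Qed.

(* Grouping by residue classes: both a substitution and its inverse preserve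
   convergence, by comparison of the coefficients with a geometric series. *)
Lemma conv_coef_bound x : x \in conv ->
  exists s M, [/\ 0 < s, 0 <= M & forall i, `|x i| <= M * s ^+ i].
Proof.
move=> /convP[s s0 /(conv_at_bound (ltW s0))[M M0 hM]].
exists s^-1, M; rewrite invr_gt0; split=> // i.
rewrite exprVn ler_pdivlMr ?exprn_gt0 //.
exact: le_trans (tnorm_coef _ _ (ltW s0)) (hM _).
Qed.

Lemma conv_coefP x s (M : K) : 0 < s -> 0 <= M -> (forall i, `|x i| <= M * s ^+ i) ->
  x \in conv.
Proof.
move=> s0 M0 h.
have M1 : 0 < M + 1 by rewrite ltr_wpDl.
rewrite -[x](_ : fpsC (M + 1) * (fpsC (M + 1)^-1 * x) = _); last first.
  by rewrite mulrA -rmorphM mulfV ?rmorph1 ?mul1r // gt_eqF.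
apply: rpredM; first exact: convC.
apply: (@conv_le s) => // i; rewrite fcoefCM normrM normfV (gtr0_norm M1).
rewrite mulrC ler_pdivrMr // mulrC (le_trans (h i)) //.
by rewrite ler_wpM2r ?exprn_ge0 ?ltW // ltrDl.
Qed.

Lemma conv_fsub q x : (0 < q)%N -> x \in conv -> fsub q x \in conv.
Proof.
move=> q0 /conv_coef_bound[s [M [s0 M0 h]]].
(* A base above 1 is needed: s^j <= (1+s)^j <= (1+s)^(j q). *)
apply: (@conv_coefP _ (1 + s) M) => //; first by rewrite addr_gt0.
move=> i /=; case: ifP => [/dvdnP[j ->]|_]; last first.
  by rewrite normr0 mulr_ge0 // exprn_ge0 // addr_ge0 // ltW.
rewrite mulnK // (le_trans (h j)) // ler_wpM2l //.
apply: (@le_trans _ _ ((1 + s) ^+ j)).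
  by rewrite lerXn2r ?nnegrE ?addr_ge0 ?(ltW s0) ?lerDr.
by rewrite ler_weXn2l ?leq_pmulr // lerDl ltW.
Qed.

Definition fsection N b x : fps K := Fps (fun n => x (n * N + b)%N).

Lemma conv_fsection N b x : x \in conv -> fsection N b x \in conv.
Proof.
move=> /conv_coef_bound[s [M [s0 M0 h]]].
apply: (@conv_coefP _ (s ^+ N) (M * s ^+ b)); rewrite ?exprn_gt0 //.
  by rewrite mulr_ge0 // exprn_ge0 // ltW.
by move=> i /=; rewrite -exprM -mulrA -exprD addnC mulnC.
Qed.

(** Sorting exponents by their residue modulo [N] is what later eliminates the parameter from the
    equation of a branch. *)
Lemma fsection_decomp N x : (0 < N)%N ->
  x = \sum_(b < N) fpsX K ^+ b * fsub N (fsection N b x).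
Proof.
move=> N0; apply: fpsP => n; rewrite fcoef_sum.
rewrite (bigD1 (Ordinal (ltn_pmod n N0))) // big1 => [|b /eqP nb].
  apply: etrans (esym (addr0 _)); rewrite fcoefXnM /= ltnNge leq_mod /=.
  have e : (n - n %% N = n %/ N * N)%N by rewrite {1}(divn_eq n N) addnK.
  by rewrite e dvdn_mull // mulnK // -divn_eq.
rewrite fcoefXnM; case: ltnP => // bn /=; case: ifP => // /dvdnP[j e].
case: nb; apply: val_inj => /=.
by rewrite -(subnK bn) e modnMDl modn_small.
Qed.

End FpsNorm.

Arguments conv {K}.

Section Tame.
Variables (K : numFieldType) (m : nat).
Implicit Types (x y : 'I_m -> fps K) (Phi Psi : ('I_m -> fps K) -> fps K).

(* Operators built from convergent power series by ring operations: causal, and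
   bounded on bounded sets for the truncated norms of all small radii. *)
Definition tame Phi :=
  (forall n x y, (forall i k, (k < n)%N -> x i k = y i k) ->
     forall k, (k < n)%N -> Phi x k = Phi y k) /\
  exists2 s0 : K, 0 < s0 & forall rho : K, 0 <= rho -> exists2 M : K, 0 <= M &
    forall s n x, 0 < s -> s <= s0 -> (forall i, tnorm s n (x i) <= rho) ->
      tnorm s n (Phi x) <= M.

Lemma tame_cst c : c \in conv -> tame (fun=> c).
Proof.
move=> /convP[s s0 /(conv_at_bound (ltW s0))[M M0 hM]]; split=> //.
exists s => // rho _; exists M => // s' n _ s'0 s's _.
exact: le_trans (ler_tnorm c (ltW s'0) s's (leqnn n)) (hM n).
Qed.

Lemma tame_proj i : tame (fun x => x i).
Proof.
split=> [n x y h k kn|]; first exact: h.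
by exists 1 => // rho rho0; exists rho.
Qed.

Lemma tameD Phi Psi : tame Phi -> tame Psi -> tame (fun x => Phi x + Psi x).
Proof.
move=> [cP [s s0 bP]] [cQ [t t0 bQ]]; split=> [n x y h k kn|].
  by rewrite !fcoefD (cP n x y) ?(cQ n x y).
have [r r0 [rs rt]] := pos_min s0 t0; exists r => // rho rho0.
have [M M0 hM] := bP _ rho0; have [N N0 hN] := bQ _ rho0.
exists (M + N) => [|s' n x s'0 s'r hx]; first exact: addr_ge0.
rewrite (le_trans (tnormD _ _ _ (ltW s'0))) // lerD //.
  by apply: hM => //; apply: le_trans rs.
by apply: hN => //; apply: le_trans rt.
Qed.

Lemma tameM Phi Psi : tame Phi -> tame Psi -> tame (fun x => Phi x * Psi x).
Proof.
move=> [cP [s s0 bP]] [cQ [t t0 bQ]]; split=> [n x y h k kn|].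
  rewrite !fcoefM; apply: eq_bigr => i _.
  have ik : (i <= k)%N by rewrite -ltnS.
  by rewrite (cP n x y) ?(cQ n x y) ?(leq_ltn_trans _ kn) ?leq_subr.
have [r r0 [rs rt]] := pos_min s0 t0; exists r => // rho rho0.
have [M M0 hM] := bP _ rho0; have [N N0 hN] := bQ _ rho0.
exists (M * N) => [|s' n x s'0 s'r hx]; first exact: mulr_ge0.
rewrite (le_trans (tnormM _ _ _ (ltW s'0))) // ler_pM ?tnorm_ge0 ?(ltW s'0) //.
  by apply: hM => //; apply: le_trans rs.
by apply: hN => //; apply: le_trans rt.
Qed.

Lemma tame_ext Phi Psi : Phi =1 Psi -> tame Phi -> tame Psi.
Proof. by move=> /funext ->. Qed.

Lemma tame_sum (I : Type) (r : seq I) (F : I -> ('I_m -> fps K) -> fps K) :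
  (forall i, tame (F i)) -> tame (fun x => \sum_(i <- r) F i x).
Proof.
move=> tF; elim: r => [|i r IH].
  by apply: tame_ext (tame_cst (rpred0 _)) => x; rewrite big_nil.
by apply: tame_ext (tameD (tF i) IH) => x; rewrite big_cons.
Qed.

Lemma tameXn Phi k : tame Phi -> tame (fun x => Phi x ^+ k).
Proof.
move=> tP; elim: k => [|k IH]; first exact: tame_cst (rpred1 _).
by apply: tame_ext (tameM tP IH) => x; rewrite exprS.
Qed.

(* The solution is computed coefficient by coefficient; its truncated norms stay
   below [rho = |e| + 1] as soon as the radius times the bound of [Phi] on the
   ball of radius [rho] is at most 1. *)
Lemma fixed_point (e : 'I_m -> fps K) (Phi : 'I_m -> ('I_m -> fps K) -> fps K) :
  (forall i, e i \in conv) -> (forall i, tame (Phi i)) ->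
  exists2 x, forall i, x i \in conv & forall i, x i = e i + fpsX K * Phi i x.
Proof.
move=> ce tP; pose step x i := e i + fpsX K * Phi i x.
pose z n := iter n step (fun=> 0).
(* The factor [fpsX] and the causality of [Phi] fix one more coefficient at each iteration. *)
have zS n i k : (k < n)%N -> z n.+1 i k = z n i k.
  elim: n i k => // n IH i k kn.
  rewrite [LHS]fcoefD [RHS]fcoefD !fcoefXM; case: k kn => // k kn.
  have [cP _] := tP i; congr (_ + _).
  by apply: (cP n) => // j l; apply: IH.
pose x i := Fps (fun k => z k.+1 i k).
have xz n i k : (k < n)%N -> x i k = z n i k.
  by elim: n => // n IH; rewrite ltnS leq_eqVlt => /orP[/eqP->//|/[dup] h /IH ->]; rewrite zS.
have xE i : x i = e i + fpsX K * Phi i x.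
  apply: fpsP => k; rewrite [LHS]fcoefD [RHS]fcoefD !fcoefXM; case: k => // k.
  have [cP _] := tP i; congr (_ + _).
  by apply: (cP k.+1) => // j l lk; rewrite (xz k.+1).
exists x => // i.
have [s1 s10 hs1] : exists2 s, 0 < s & forall i, conv_at s (e i).
  apply: pos_min_fin => [j a b a0 ab|j]; last exact/convP.
  by apply: conv_at_le => //; apply: ltW.
have [Me Me0 hMe] : exists2 M, 0 <= M & forall i n, tnorm s1 n (e i) <= M.
  have /choice[M hM] j : exists M, 0 <= M /\ forall n, tnorm s1 n (e j) <= M.
    by have [M M0 hM] := conv_at_bound (ltW s10) (hs1 j); exists M.
  exists (\sum_j M j) => [|j n]; first by apply: sumr_ge0 => j _; case: (hM j).
  rewrite (bigD1 j) //= ler_wpDr ?(hM j).2 //.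
  by apply: sumr_ge0 => l _; case: (hM l).
have Me10 : 0 <= Me + 1 by rewrite addr_ge0.
have [s2 s20 hs2] : exists2 s, 0 < s & forall i, s <= s1 /\
    exists2 M : K, 0 <= M & s * M <= 1 /\
    forall s' n x, 0 < s' -> s' <= s -> (forall i, tnorm s' n (x i) <= Me + 1) ->
      tnorm s' n (Phi i x) <= M.
  apply: pos_min_fin => [j a b a0 ab [bs [M M0 [bM hM]]]|j].
    split; first exact: le_trans bs.
    exists M => //; split; first by rewrite (le_trans _ bM) // ler_wpM2r.
    by move=> s' n y s'0 s'a; apply: hM => //; apply: le_trans ab.
  have [_ [s0 s00 /(_ _ Me10)[M M0 hM]]] := tP j.
  have M10 : 0 < M + 1 by rewrite ltr_wpDl.
  have iM0 : 0 < (M + 1)^-1 by rewrite invr_gt0.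
  have [a a0 [as0 as1]] := pos_min s00 s10; have [b b0 [ba bM]] := pos_min a0 iM0.
  exists b => //; split; first exact: le_trans as1.
  exists M => //; split.
    rewrite (le_trans (ler_wpM2r M0 bM)) // mulrC ler_pdivrMr // mul1r.
    by rewrite lerDl.
  move=> s' n y s'0 s'b; apply: hM => //.
  exact: le_trans s'b (le_trans ba as0).
apply/convP; exists s2 => //.
(* The induction is on the length of the truncation: because of the factor [fpsX], the first [n.+1]
   terms of [x] are bounded through the first [n] terms of [Phi i x]. *)
have key n : forall i, tnorm s2 n (x i) <= Me + 1.
  elim: n => [|n IH] j.
    by rewrite tnormE big_ord0 addr_ge0.
  rewrite xE (le_trans (tnormD _ _ _ (ltW s20))) // tnormXM lerD //.
    have [le_s _] := hs2 j; apply: le_trans (hMe j n.+1).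
    exact: ler_tnorm (ltW s20) le_s _.
  have [_ [M M0 [hM h]]] := hs2 j; apply: le_trans hM; rewrite ler_wpM2l ?(ltW s20) //.
  exact: h.
by exists (Me + 1) => n; apply: key.
Qed.
End Tame.

(** * Newton's and Hensel's lemmas *)

Section Newton.
Variable K : numFieldType.

(* With b + X^(e+1) w substituted and X^(e1+e+1) divided out, the equation
   becomes h + u w + X (...) = 0, which is solved for w since u 0 != 0. *)
Lemma newton_root (f : {poly fps K}) (b h u : fps K) (e1 e : nat) :
  f \is a polyOver conv -> b \in conv -> h \in conv -> u \in conv ->
  (e1 <= e)%N -> u 0%N != 0 ->
  f.[b] = fpsX K ^+ (e1 + e).+1 * h -> f^`().[b] = fpsX K ^+ e1 * u ->
  exists2 psi, psi \in conv & f.[psi] = 0 /\ order_ge e.+1 (psi - b).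
Proof.
move=> cf cb ch cu le_e u0 fb f'b.
(* [G] is the Taylor remainder at [b] after the linear term, divided by the square of the
   increment. *)
pose N := size f; pose G (y : fps K) := \sum_(i < N) f^`N(i.+2).[b] * y ^+ i.
have taylor y : f.[b + y] = f.[b] + f^`().[b] * y + y ^+ 2 * G y.
  rewrite (@nderiv_taylor_wide _ N.+2 f b y (mulrC b y) (leqW (leqW (leqnn N)))).
  rewrite 2!big_ord_recl nderivn0 nderivn1 expr0 mulr1 expr1 addrA; congr (_ + _).
  rewrite big_distrr; apply: eq_bigr => i _.
  by rewrite [RHS]mulrCA -exprD.
have cu1 : fshift 1 u \in conv by exact: conv_fshift.
have uE : u = fpsC (u 0%N) + fpsX K * fshift 1 u.
  by apply: fpsP => -[|n]; rewrite fcoefD fcoefXM /= ?addr0 ?add0r ?addn1.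
pose c := fpsC (u 0%N)^-1 : fps K.
have cc : c \in conv by exact: convC.
(* Isolating the constant term of [u] and multiplying by its inverse [c] gives w = - c h + X Phi(w),
   the form to which [fixed_point] applies. *)
pose Phi (_ : 'I_1) (x : 'I_1 -> fps K) :=
  (- c) * (fshift 1 u * x ord0 +
     fpsX K ^+ (e - e1) * x ord0 ^+ 2 * G (fpsX K ^+ e.+1 * x ord0)).
have cX n : fpsX K ^+ n \in conv by rewrite rpredX ?convX.
have tP i : tame (Phi i).
  have tc d : d \in conv -> tame (fun _ : 'I_1 -> fps K => d) by exact: tame_cst.
  have t0 : tame (fun x : 'I_1 -> fps K => x ord0) by exact: tame_proj.
  apply: tameM; first by apply: tc; rewrite rpredN.
  apply: tameD; first by apply: tameM => //; apply: tc.
  apply: tameM; first by apply: tameM; [apply: tc|apply: tameXn].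
  apply: tame_sum => j; apply: tameM.
    by apply: tc; apply: rpred_horner => //; apply: polyOver_nderivn.
  by apply: tameXn; apply: tameM => //; apply: tc.
have ce (i : 'I_1) : - c * h \in conv by rewrite rpredM ?rpredN.
have [x cx xE] := fixed_point ce tP.
exists (b + fpsX K ^+ e.+1 * x ord0); first by rewrite rpredD ?rpredM.
split; last by rewrite addrC addKr; exact: order_geXnM.
set w := x ord0; have {}xE : w = - c * h + fpsX K * Phi ord0 x by exact: xE.
rewrite taylor fb f'b.
set Gw := G _ in xE *.
have Phiw : Phi ord0 x =
  (- c) * (fshift 1 u * w + fpsX K ^+ (e - e1) * w ^+ 2 * Gw) by [].
have c_inv : fpsC (u 0%N) * c = 1 by rewrite -rmorphM mulfV ?rmorph1.
have E : h + u * w + fpsX K * fpsX K ^+ (e - e1) * w ^+ 2 * Gw = 0.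
  rewrite {1}uE; move: Phiw xE; set P := Phi _ _; clearbody P w Gw => Phiw xE.
  transitivity (fpsC (u 0%N) * (w + c * h - fpsX K * P)); last first.
    by rewrite {1}xE mulNr; ring.
  rewrite Phiw; transitivity (h + fpsC (u 0%N) * w + fpsX K * (fshift 1 u * w +
     fpsX K ^+ (e - e1) * w ^+ 2 * Gw)); first by ring.
  rewrite -{1}[h]mul1r -c_inv -[X in _ + _ + _ * X]mul1r -c_inv; ring.
transitivity (fpsX K ^+ (e1 + e).+1 *
   (h + u * w + fpsX K * fpsX K ^+ (e - e1) * w ^+ 2 * Gw)); last by rewrite E mulr0.
(* The quadratic term carries X^(2e+2); as [e1 <= e], it is X^(e1+e+1) times X * X^(e-e1), so a
   factor X survives the division. *)
have -> : fpsX K ^+ (e1 + e).+1 = fpsX K ^+ e1 * fpsX K ^+ e.+1.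
  by rewrite -exprD addnS.
have eE : fpsX K ^+ e.+1 = fpsX K * fpsX K ^+ (e - e1) * fpsX K ^+ e1.
  by rewrite -exprS -exprD; congr (_ ^+ _); lia.
transitivity (fpsX K ^+ e1 * fpsX K ^+ e.+1 * (h + u * w) +
   fpsX K ^+ e.+1 * fpsX K ^+ e.+1 * w ^+ 2 * Gw); first by ring.
rewrite {3}eE; ring.
Qed.

End Newton.

Fact degree_bound (p a b m c : nat) : p = (a + b).-1 -> p = m.+1 ->
  a.-1.+1 = a -> b.-1.+1 = b -> (c < a)%N -> ((b + c).-1 <= m)%N.
Proof. lia. Qed.
Fact degree_bound_l (p a b m c : nat) : p = (a + b).-1 -> p = m.+1 ->
  a.-1.+1 = a -> b.-1.+1 = b -> ((a + c).-1 <= m)%N -> (c < b)%N.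
Proof. lia. Qed.
Fact degree_bound_lt (p a b m c d : nat) : p = (a + b).-1 -> p = m.+1 ->
  (c < a)%N -> (d < b)%N -> ((c + d).-1 <= m)%N.
Proof. lia. Qed.

Section Hensel.
Variable K : numFieldType.

(** The factors are sought as A0 + X al and B0 + X be, with al and be of smaller degree. Bezout
    writes each X^j as A0 b_j + B0 a_j. In these coordinates the factorization is a fixed-point
    equation for the coefficients [g], and convergence comes from [fixed_point]. *)
Lemma hensel (P : {poly fps K}) (A0 B0 : {poly K}) :
  P \is monic -> P \is a polyOver conv -> A0 \is monic -> B0 \is monic ->
  coprimep A0 B0 -> map_poly (fun x : fps K => x 0%N) P = A0 * B0 ->
  exists A B : {poly fps K},
    [/\ A \is monic /\ B \is monic, A \is a polyOver conv, B \is a polyOver conv,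
        size A = size A0 /\ size B = size B0 & P = A * B].
Proof.
move=> mP cP mA mB cop P0.
have A0n0 := monic_neq0 mA; have B0n0 := monic_neq0 mB.
have [[u v] /= uv] : exists uv, uv.1 * A0 + uv.2 * B0 = 1 :> {poly K}.
  have [[u v] /= /eqpP[[c d] /= /andP[c0 d0] e]] := Bezout_coprimepP _ _ cop.
  exists ((d^-1 * c) *: u, (d^-1 * c) *: v) => /=.
  rewrite -!scalerAl -scalerDr -scalerA e scalerA mulVf // scale1r //.
have sP : size P = (size A0 + size B0).-1.
  rewrite -size_mul // -P0 size_map_poly_id0 ?(eqP mP) //.
  by rewrite fcoef1 oner_eq0.
pose m := (size P).-1.
have sA : (size A0).-1.+1 = size A0 by rewrite prednK ?size_poly_gt0.
have sB : (size B0).-1.+1 = size B0 by rewrite prednK ?size_poly_gt0.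
have sPm : size P = m.+1 by rewrite /m prednK // size_poly_gt0 monic_neq0.
(* Reduction modulo [A0] bounds the degree of [a j]. The quotient is moved into [b j], whose degree
   bound then follows from the identity [abE]. *)
pose a (j : nat) := (v * 'X^j) %% A0.
pose b (j : nat) := u * 'X^j + ((v * 'X^j) %/ A0) * B0.
have abE j : A0 * b j + B0 * a j = 'X^j.
  rewrite /b; have := divp_eq (v * 'X^j) A0; rewrite -/(a j).
  set q := _ %/ _ => e.
  transitivity (u * A0 * 'X^j + B0 * (q * A0 + a j)); first by ring.
  by rewrite -e -[RHS]mul1r -uv; ring.
have size_a j : (size (a j) < size A0)%N by rewrite ltn_modp.
have size_b j : (j < m)%N -> (size (b j) < size B0)%N.
  move=> jm; have [->|bn0] := eqVneq (b j) 0.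
    by rewrite size_poly0 size_poly_gt0.
  have : (size (A0 * b j)%R <= m)%N.
    have -> : A0 * b j = 'X^j - B0 * a j by rewrite -abE addrK.
    rewrite (leq_trans (size_polyD _ _)) // geq_max size_polyXn size_polyN jm /=.
    rewrite (leq_trans (size_polyMleq _ _)) //.
    exact: degree_bound sP sPm sA sB (size_a j).
  by rewrite size_mul //; exact: degree_bound_l sP sPm sA sB.
pose al (g : 'I_m -> fps K) := \sum_(j < m) g j *: map_poly (@fpsC K) (a j).
pose be (g : 'I_m -> fps K) := \sum_(j < m) g j *: map_poly (@fpsC K) (b j).
pose E (i : 'I_m) := fshift 1 P`_i.
have coef_conv i : P`_i \in conv by exact/polyOverP.
have cE i : E i \in conv by exact: conv_fshift.
(* Since A B = A0 B0 + X (sum_j g_j X^j + X al be), comparing coefficients gives g_i = E_i - X (al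
   be)_i. *)
pose Phi (i : 'I_m) g := (- 1) * (al g * be g)`_i.
have tlin (c : nat -> {poly K}) i :
    tame (fun g : 'I_m -> fps K => (\sum_(j < m) g j *: map_poly (@fpsC K) (c j))`_i).
  apply: (@tame_ext _ _ (fun g => \sum_(j < m) g j * fpsC (c j)`_i)) => [g|].
    by rewrite coef_sum; apply: eq_bigr => j _; rewrite coefZ coef_map.
  apply: tame_sum => j; apply: tameM; first exact: tame_proj.
  by apply: tame_cst; exact: convC.
have tP i : tame (Phi i).
  apply: tameM; first by apply: tame_cst; rewrite rpredN rpred1.
  apply: (@tame_ext _ _ (fun g => \sum_(k < i.+1) (al g)`_k * (be g)`_(i - k))).
    by move=> g; rewrite coefM.
  by apply: tame_sum => k; apply: tameM; apply: tlin.
have [g cg gE] := fixed_point cE tP.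
have size_lin (c : nat -> {poly K}) k : (forall j, (j < m)%N -> (size (c j) < k)%N) ->
    (0 < k)%N -> (size (\sum_(j < m) g j *: map_poly (@fpsC K) (c j))%R < k)%N.
  move=> hc k0; rewrite (leq_ltn_trans (size_sum _ _ _)) //.
  rewrite -(prednK k0) ltnS; apply/bigmax_leqP => j _.
  rewrite (leq_trans (size_scale_leq _ _)) // (leq_trans (size_poly _ _)) //.
  by rewrite -ltnS prednK // hc.
have conv_lin (c : nat -> {poly K}) :
    \sum_(j < m) g j *: map_poly (@fpsC K) (c j) \is a polyOver conv.
  apply: rpred_sum => j _; rewrite polyOverZ //.
  by apply/polyOverP => i; rewrite coef_map; exact: convC.
have size_al : (size (al g) < size A0)%N.
  by apply: size_lin => *; rewrite ?size_a ?size_poly_gt0.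
have size_be : (size (be g) < size B0)%N.
  by apply: size_lin => *; rewrite ?size_b ?size_poly_gt0.
have size_mapC (p : {poly K}) : size (map_poly (@fpsC K) p) = size p.
  apply: size_map_inj_poly; last exact: rmorph0.
  by move=> c d /(congr1 (fun x : fps K => x 0%N)).
have cX := convX K.
have sXal : (size (fpsX K *: al g) < size A0)%N.
  exact: leq_ltn_trans (size_scale_leq _ _) size_al.
have sXbe : (size (fpsX K *: be g) < size B0)%N.
  exact: leq_ltn_trans (size_scale_leq _ _) size_be.
exists (map_poly (@fpsC K) A0 + fpsX K *: al g).
exists (map_poly (@fpsC K) B0 + fpsX K *: be g).
split.
- split; rewrite monicE lead_coefDl ?size_mapC // -monicE; exact: monic_map.
- by rewrite rpredD ?polyOverZ ?conv_lin //; apply/polyOverP => i; rewrite coef_map; exact: convC.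
- by rewrite rpredD ?polyOverZ ?conv_lin //; apply/polyOverP => i; rewrite coef_map; exact: convC.
- by split; rewrite size_polyDl ?size_mapC.
have ab : map_poly (@fpsC K) A0 * be g + map_poly (@fpsC K) B0 * al g =
          \sum_(j < m) g j *: 'X^j.
  rewrite !big_distrr -big_split; apply: eq_bigr => j _ /=.
  by rewrite -!scalerAr -scalerDr -!rmorphM -rmorphD abE /= map_polyXn.
transitivity (map_poly (@fpsC K) (A0 * B0) +
  fpsX K *: (\sum_(j < m) g j *: 'X^j + fpsX K *: (al g * be g))); last first.
  rewrite -ab rmorphM -!mul_polyC; ring.
have size_ab : (size (al g * be g)%R <= m)%N.
  rewrite (leq_trans (size_polyMleq _ _)) //.
  exact: degree_bound_lt sP sPm size_al size_be.
apply/polyP => i; rewrite coefD coef_map -P0 coef_map_id0; last exact: fcoef0.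
rewrite coefZ coefD coefZ.
have -> : (\sum_(j < m) g j *: 'X^j)`_i =
    if (i < m)%N =P true is ReflectT h then g (Ordinal h) else 0.
  rewrite coef_sum; case: eqP => [h|/negP h]; last first.
    apply: big1 => j _; rewrite coefZ coefXn; case: eqP => [e|]; rewrite ?mulr0 //.
    by move: h; rewrite e ltn_ord.
  rewrite (bigD1 (Ordinal h)) //= coefZ coefXn eqxx mulr1 big1 ?addr0 // => j.
  move=> nj; rewrite coefZ coefXn (_ : (i == j) = false) ?mulr0 //.
  by apply: contraNF nj => /eqP e; apply/eqP/val_inj.
have split0 (x : fps K) : x = fpsC (x 0%N) + fpsX K * fshift 1 x.
  by apply: fpsP => -[|n]; rewrite fcoefD fcoefXM /= ?addr0 ?add0r ?addn1.
rewrite {1}[P`_i]split0; congr (_ + _ * _).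
(* From degree [m] on both sides vanish: the leading coefficient of [P] is the constant 1, so its
   shift is 0, and al be has degree below [m]. *)
case: eqP => [h|/negP]; last first.
  rewrite -leqNgt => mi; rewrite [(al g * be g)`_i]nth_default ?(leq_trans size_ab) //.
  rewrite mulr0 addr0; apply: fpsP => n; rewrite fcoef0 /= addn1.
  move: mi; rewrite leq_eqVlt => /orP[/eqP<-|mi].
    by move/eqP: mP; rewrite lead_coefE sPm /= => ->; rewrite fcoef1.
  by rewrite nth_default ?sPm // fcoef0.
by rewrite gE /Phi mulN1r mulrN /= subrK.
Qed.
End Hensel.

(** * Puiseux's theorem *)

Section MonicTools.
Variable S : comNzRingType.
Implicit Types (P : {poly S}) (c l : S).

Lemma size_XaddC_exp c n : size (('X + c%:P) ^+ n) = n.+1.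
Proof. by rewrite -(opprK c%:P) -polyCN size_exp_XsubC. Qed.

Lemma coef_XaddC_exp c n : (('X + c%:P) ^+ n.+1)`_n = c *+ n.+1.
Proof.
have lead k : (('X + c%:P) ^+ k)`_k = 1.
  have : ('X + c%:P) ^+ k \is monic by rewrite rpredX ?monicXaddC.
  by rewrite monicE lead_coefE size_XaddC_exp => /eqP.
elim: n => [|n IH]; first by rewrite expr1 coefD coefX coefC add0r.
by rewrite exprS mulrDl coefD coefXM coefCM IH lead mulr1 addrC -mulrS.
Qed.

(** With c = - P_n / (n+1) this is the Tschirnhaus translation, which kills the subleading
    coefficient. *)
Lemma comp_XaddC_coef P c n : P \is monic -> size P = n.+2 ->
  (P \Po ('X + c%:P))`_n = P`_n + c *+ n.+1.
Proof.
move=> mP sP; rewrite coef_comp_poly sP big_ord_recr big_ord_recr /=.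
have -> : P`_n.+1 = 1 by move: mP; rewrite monicE lead_coefE sP => /eqP.
rewrite coef_XaddC_exp mul1r big1 ?add0r => [|i _].
  congr (_ + _); have : ('X + c%:P) ^+ n \is monic by rewrite rpredX ?monicXaddC.
  by rewrite monicE lead_coefE size_XaddC_exp => /eqP ->; rewrite mulr1.
by rewrite [X in _ * X]nth_default ?mulr0 // size_XaddC_exp.
Qed.

Lemma comp_XaddC_monic P c : P \is monic ->
  P \Po ('X + c%:P) \is monic /\ size (P \Po ('X + c%:P)) = size P.
Proof.
move=> mP; 
have s : size (P \Po ('X + c%:P)) = size P.
  have [n sP] : exists n, size P = n.+1.
    by exists (size P).-1; rewrite prednK // size_poly_gt0 monic_neq0.
  rewrite comp_polyE sP big_ord_recr /=.
  have -> : P`_n = 1 by move: mP; rewrite monicE lead_coefE sP => /eqP.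
  rewrite scale1r addrC size_polyDl size_XaddC_exp // ltnS.
  rewrite (leq_trans (size_sum _ _ _)) //; apply/bigmax_leqP => i _.
  by rewrite (leq_trans (size_scale_leq _ _)) // size_XaddC_exp.
split=> //.
have [n sP] : exists n, size P = n.+1.
  by exists (size P).-1; rewrite prednK // size_poly_gt0 monic_neq0.
rewrite monicE lead_coefE s sP /= coef_comp_poly sP big_ord_recr /=.
have -> : P`_n = 1 by move: mP; rewrite monicE lead_coefE sP => /eqP.
have : ('X + c%:P) ^+ n \is monic by rewrite rpredX ?monicXaddC.
rewrite monicE lead_coefE size_XaddC_exp => /eqP ->.
rewrite big1 ?add0r ?mulr1 // => i _.
by rewrite [X in _ * X]nth_default ?mulr0 // size_XaddC_exp.
Qed.

(** The homogeneity of coefficients under scaling of the roots, stated without division: [l] will be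
    a power of [fpsX], which is not invertible. *)
Lemma scaled_prod_XsubC (P : {poly S}) l (rs : seq S) :
  (size P <= (size rs).+1)%N ->
  (forall j, (j <= size rs)%N ->
     P`_j = l ^+ (size rs - j) * (\prod_(r <- rs) ('X - r%:P))`_j) ->
  P = \prod_(r <- rs) ('X - (l * r)%:P).
Proof.
elim: rs P => [|r rs IH] P sP hP.
  apply/polyP => -[|j]; first by rewrite hP // !big_nil mul1r.
  by rewrite big_nil nth_default ?(leq_trans sP) // coef1.
set Q := \prod_(r <- rs) ('X - r%:P).
have sQ : size Q = (size rs).+1 by rewrite size_prod_XsubC.
have := IH (\poly_(j < (size rs).+1) (l ^+ (size rs - j) * Q`_j)) (size_poly _ _).
have h j : (j <= size rs)%N ->
   (\poly_(j < (size rs).+1) (l ^+ (size rs - j) * Q`_j))`_j = l ^+ (size rs - j) * Q`_j.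
  by move=> hj; rewrite coef_poly ltnS hj.
move=> /(_ h) e; rewrite big_cons -e; apply/polyP => j.
have [js|sj] := leqP j (size rs).+1; last first.
  rewrite nth_default ?(leq_trans sP) // mulrBl coefB coefXM coefCM !coef_poly.
  case: j sj => // j; rewrite ltnS => sj /=.
  by rewrite !ltnS (leqNgt j) sj (ltnNge j) (ltnW sj) /= mulr0 subrr.
rewrite hP // big_cons -/Q mulrBl coefB coefXM coefCM mulrBl coefB coefXM coefCM /=.
rewrite !coef_poly; case: j js => [|j] js /=.
  rewrite !subn0 exprS; ring.
rewrite subSS; move: (js); rewrite !ltnS => ->; rewrite mulrBr; congr (_ - _).
move: js; rewrite ltnS leq_eqVlt => /orP[/eqP->|js].
  by rewrite ltnn nth_default ?sQ // !mulr0.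
rewrite js (_ : (size rs - j = (size rs - j.+1).+1)%N); last by rewrite subnSK.
by rewrite exprS; ring.
Qed.

End MonicTools.

Fact degree_split (a b m : nat) : (b + a).-1 = m.+2 -> (1 < b)%N -> (a <= m.+1)%N.
Proof. lia. Qed.

Section Puiseux.
Variable K : numClosedFieldType.
Implicit Types (P : {poly fps K}).

Lemma fps_order (x : fps K) : x != 0 -> exists2 n, x n != 0 & order_ge n x.
Proof.
move=> x0; have /ex_minnP[n xn hn] : exists n, x n != 0.
  apply: contrapT => h; case/eqP: x0; apply: fpsP => n; rewrite fcoef0.
  by apply: contrapT => /eqP xn; apply: h; exists n.
exists n => // k kn; apply/eqP; apply: contraTT kn => /hn; by rewrite -leqNgt.
Qed.

Lemma fsubm_conv q x : x \in conv -> @fsubm K q x \in conv.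
Proof. exact: conv_fsub. Qed.

Lemma map_fsubm_monic q P : P \is monic -> P \is a polyOver conv ->
  [/\ map_poly (@fsubm K q) P \is monic, map_poly (@fsubm K q) P \is a polyOver conv
    & size (map_poly (@fsubm K q) P) = size P].
Proof.
move=> mP cP; split; first exact: monic_map.
  by apply/polyOverP => i; rewrite coef_map fsubm_conv //; apply/polyOverP.
by rewrite size_map_poly_id0 // (eqP mP) rmorph1 oner_eq0.
Qed.

Lemma map_fsubmA p q P : map_poly (@fsubm K q) (map_poly (@fsubm K p) P) =
  map_poly (@fsubm K (p.+1 * q.+1).-1) P.
Proof.
apply/polyP => i; rewrite !coef_map /= /fsubm fsubA // prednK //.
Qed.

Lemma map_fsubm_prod q (rs : seq (fps K)) :
  map_poly (@fsubm K q) (\prod_(r <- rs) ('X - r%:P)) =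
  \prod_(r <- map (@fsubm K q) rs) ('X - r%:P).
Proof.
rewrite big_map rmorph_prod; apply: eq_bigr => r _.
by rewrite rmorphB /= map_polyX map_polyC.
Qed.

(** The natural number [q] stands for the ramification index [q.+1]. *)
Definition puiseux_split P := exists (q : nat) (rs : seq (fps K)),
  {subset rs <= conv} /\ map_poly (@fsubm K q) P = \prod_(r <- rs) ('X - r%:P).

(** The substitution that splits [P] is also applied to [Q], so the splitting of [Q] is required
    after every substitution. The two ramification indices multiply. *)
Lemma puiseux_splitM (P Q : {poly fps K}) : P \is monic -> Q \is monic ->
  P \is a polyOver conv -> Q \is a polyOver conv -> puiseux_split P ->
  (forall q, puiseux_split (map_poly (@fsubm K q) Q)) -> puiseux_split (P * Q).
Proof.
move=> mP mQ cP cQ [q [rs [crs e]]] /(_ q)[q' [rs' [crs' e']]].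
exists (q.+1 * q'.+1).-1, (map (@fsubm K q') rs ++ rs'); split.
  move=> r; rewrite mem_cat => /orP[/mapP[r' /crs cr' ->]|/crs' //].
  exact: fsubm_conv.
by rewrite -map_fsubmA rmorphM /= e rmorphM /= map_fsubm_prod e' big_cat.
Qed.

Lemma puiseux_split_comp P c : c \in conv ->
  puiseux_split (P \Po ('X + c%:P)) -> puiseux_split P.
Proof.
move=> cc [q [rs [crs e]]].
exists q, (map (fun r => fsubm q c + r) rs); split.
  by move=> _ /mapP[r /crs cr ->]; rewrite rpredD // fsubm_conv.
have -> : map_poly (@fsubm K q) P =
    map_poly (@fsubm K q) (P \Po ('X + c%:P)) \Po ('X - (fsubm q c)%:P).
  rewrite map_comp_poly rmorphD /= map_polyX map_polyC /= -comp_polyA.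
  by rewrite comp_polyD comp_polyX comp_polyC subrK comp_polyXr.
rewrite e big_map; elim: (rs) => [|r s IH]; first by rewrite !big_nil comp_polyC.
rewrite !big_cons comp_polyM IH; congr (_ * _).
by rewrite comp_polyB comp_polyX comp_polyC polyCD opprD addrA.
Qed.

(* The Newton slope p / (q + 1): after t |-> t^(q+1), X |-> t^p X, the
   polynomial reduces at t = 0 to a monic polynomial other than X^m. *)
Lemma newton_slope P m : P \is monic -> size P = m.+1 -> P != 'X^m ->
  exists p q, exists2 i, (i < m)%N &
    (forall j, (j <= m)%N -> order_ge (p * (m - j)) (fsubm q P`_j)) /\
    fsubm q P`_i (p * (m - i))%N != 0.
Proof.
move=> mP sP Pn.
have Pm : P`_m = 1 by move: mP; rewrite monicE lead_coefE sP => /eqP.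
have [i0 hi0] : exists i : 'I_m, P`_i != 0.
  apply: contrapT => h; case/eqP: Pn; apply/polyP => i; rewrite coefXn.
  case: (ltngtP i m) => [im|mi|->//]; last by rewrite nth_default // sP.
  by apply: contrapT => /eqP hi; apply: h; exists (Ordinal im).
have /choice[od hod] : forall i : 'I_m, exists n,
    P`_i != 0 -> P`_i n != 0 /\ order_ge n P`_i.
  move=> i; have [->|/fps_order[n]] := eqVneq P`_i 0; first by exists 0%N.
  by exists n.
pose ratio (i : 'I_m) : rat := (od i)%:R / (m - i)%:R.
have [i hi hmin] := @Order.TotalTheory.arg_minP _ rat 'I_m i0 (fun i : 'I_m => P`_i != 0) ratio hi0.
have mi (j : 'I_m) : (0 < m - j)%N by rewrite subn_gt0.
(* The minimal slope is kept as the fraction [od i / (m - i)], not in lowest terms; the predecessor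
   accounts for the shift in [fsubm]. *)
exists (od i), (m - i).-1, i => //.
rewrite /fsubm prednK //; split; last first.
  by rewrite /= dvdn_mull // mulnK //; case: (hod i hi).
move=> j; rewrite leq_eqVlt => /orP[/eqP->|jm].
  by rewrite subnn muln0.
have [->|Pj] := eqVneq P`_j 0.
  rewrite (_ : fsub _ 0 = 0) ?(fsubC (mi i) 0) //; exact: order_ge0.
have [_ oj] := hod (Ordinal jm) Pj.
apply: order_geW (order_ge_fsub (mi i) oj).
have := hmin (Ordinal jm) Pj; rewrite /ratio ler_pdivrMr ?ltr0n // mulrAC.
by rewrite ler_pdivlMr ?ltr0n ?(mi (Ordinal jm)) // -!natrM ler_nat.
Qed.

(** Induction on the degree. After a Tschirnhaus translation and a rescaling along the Newton slope,
    the reduction at t = 0 has two coprime factors of positive degree; Hensel's lemma lifts them,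
    and both have smaller degree. *)
Theorem puiseux P : P \is monic -> P \is a polyOver conv -> puiseux_split P.
Proof.
have [n] := ubnP (size P); elim: n P => // n IH P; rewrite ltnS => sPn mP cP.
have [m sP] : exists m, size P = m.+1.
  by exists (size P).-1; rewrite prednK // size_poly_gt0 monic_neq0.
have {sPn IH} IH (Q : {poly fps K}) : (size Q <= m)%N -> Q \is monic -> Q \is a polyOver conv ->
    puiseux_split Q.
  by move=> sQ; apply: IH; rewrite (leq_trans _ sPn) // sP ltnS.
case: m sP IH => [|m] sP IH.
  exists 0%N, [::]; split=> //; rewrite big_nil.
  have -> : P = 1.
    rewrite [P]size1_polyC ?sP //.
    by move: mP; rewrite monicE lead_coefE sP => /eqP ->.
  by rewrite rmorph1.
have m0 : m.+1%:R != 0 :> K by rewrite pnatr_eq0.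
(* Characteristic 0 enters here, through the inverse of the degree. *)
pose c := - (fpsC m.+1%:R^-1 * P`_m).
have cc : c \in conv.
  by rewrite rpredN rpredM ?convC //; apply/polyOverP.
apply: (puiseux_split_comp cc).
have [mQ sQ] := comp_XaddC_monic c mP.
have cQ : P \Po ('X + c%:P) \is a polyOver conv.
  by rewrite polyOver_comp // rpredD ?polyOverX ?polyOverC.
have Qm : (P \Po ('X + c%:P))`_m = 0.
  rewrite (comp_XaddC_coef _ mP sP) /c mulNrn -mulrnAl -[_ *+ m.+1]mulr_natr.
  by rewrite -(rmorph_nat (@fpsC K)) -rmorphM mulVf ?rmorph1 ?mul1r ?subrr.
rewrite sP in sQ.
move: (P \Po _) mQ sQ cQ Qm => Q mQ sQ cQ Qm {c cc P mP cP sP}.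
have [->|Qn] := eqVneq Q ('X^(m.+1))%R.
  exists 0%N, (nseq m.+1 0); split.
    by move=> r; rewrite mem_nseq => /andP[_ /eqP->]; rewrite rpred0.
  by rewrite big_nseq subr0 map_polyXn iter_mulr_1.
have [p [q [i im [ord_ge ord_eq]]]] := newton_slope mQ sQ Qn.
have [mQq cQq sQq] := map_fsubm_monic q mQ cQ.
(* [T] is t^(- p (m+1)) Q(t^(q+1), t^p X); the orders from the Newton slope make every coefficient a
   power series. *)
pose T := \poly_(j < m.+2) fshift (p * (m.+1 - j)) (fsubm q Q`_j).
have Tj j : (j < m.+2)%N -> T`_j = fshift (p * (m.+1 - j)) (fsubm q Q`_j).
  by move=> h; rewrite coef_poly h.
have Qlead : Q`_m.+1 = 1 by move: mQ; rewrite monicE lead_coefE sQ => /eqP.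
have Tm : T`_m.+1 = 1.
  rewrite Tj // Qlead rmorph1 subnn muln0; apply: fpsP => k /=; by rewrite addn0.
have sT : size T = m.+2.
  apply/eqP; rewrite eqn_leq size_poly ltnNge; apply/negP => /leq_sizeP/(_ m.+1 (leqnn _)).
  by rewrite Tm => /eqP; rewrite oner_eq0.
have mT : T \is monic by rewrite monicE lead_coefE sT Tm.
have cT : T \is a polyOver conv.
  apply/polyOverP => j; rewrite coef_poly; case: ifP => _; last exact: rpred0.
  by rewrite conv_fshift // fsubm_conv //; apply/polyOverP.
pose f0 := map_poly (fun x : fps K => x 0%N) T.
have f0j j : f0`_j = T`_j 0%N by rewrite coef_map_id0 // fcoef0.
have sf0 : size f0 = m.+2.
  by rewrite size_map_poly_id0 // lead_coefE sT Tm fcoef1 oner_eq0.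
have mf0 : f0 \is monic by rewrite monicE lead_coefE sf0 f0j Tm fcoef1.
have /closed_rootP[r rr] : size f0 != 1%N by rewrite sf0.
have [k [B0 + f0E]] := multiplicity_XsubC f0 r.
rewrite monic_neq0 //= => rB0.
have mX : ('X - r%:P) ^+ k \is monic by rewrite rpredX ?monicXsubC.
have mB0 : B0 \is monic by move: mf0; rewrite f0E monicMr.
(* Otherwise the reduction is (X - r)^(m+1). Its subleading coefficient vanishes, so r = 0, which
   contradicts the nonzero coefficient of index [i]. *)
have B0n : B0 != 1.
  apply/eqP => B01; rewrite B01 mul1r in f0E.
  have km : k = m.+1.
    by move: sf0; rewrite f0E size_exp_XsubC => -[].
  have : f0`_m = 0 by rewrite f0j Tj // Qm rmorph0; exact: fcoef0.
  rewrite f0E km -polyCN coef_XaddC_exp -mulr_natr => /eqP.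
  rewrite mulf_eq0 (negPf m0) orbF oppr_eq0 => /eqP r0.
  have fi : f0`_i = fsubm q Q`_i (p * (m.+1 - i))%N.
    by rewrite f0j (Tj i (ltnW im)) [LHS]/= add0n.
  move: ord_eq; rewrite -fi f0E r0 subr0 coefXn km.
  by rewrite (ltn_eqF im) eqxx.
have k0 : (0 < k)%N.
  by case: k f0E {mX} => // f0E; move: rr; rewrite f0E expr0 mulr1 (negPf rB0).
have cop : coprimep (('X - r%:P) ^+ k) B0.
  by rewrite coprimep_expl // coprimep_sym coprimep_XsubC.
have [A [B [[mA mB] cA cB [sA sB] TE]]] : exists A B : {poly fps K},
    [/\ A \is monic /\ B \is monic, A \is a polyOver conv, B \is a polyOver conv,
        size A = size (('X - r%:P) ^+ k) /\ size B = size B0 & T = A * B].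
  by apply: hensel => //; rewrite -/f0 f0E mulrC.
have sAB : (size B + size A).-1 = m.+2.
  by rewrite sA sB -sf0 f0E size_Mmonic ?monic_neq0.
have B1 : (1 < size B)%N.
  rewrite sB ltnNge; apply/negP => h; case/eqP: B0n.
  have s1 : size B0 = 1%N.
    by apply/eqP; rewrite eqn_leq h size_poly_gt0 monic_neq0.
  rewrite [B0]size1_polyC //; move: mB0; rewrite monicE lead_coefE s1.
  by move=> /eqP ->.
have A1 : (1 < size A)%N by rewrite sA size_exp_XsubC.
have {TE} [N [rs [crs TE]]] : puiseux_split T.
  rewrite TE; apply: puiseux_splitM => // [|l].
    by apply: IH => //; exact: degree_split sAB B1.
  have [mB' cB' sB'] := map_fsubm_monic l mB cB.
  by apply: IH => //; rewrite sB'; rewrite addnC in sAB; exact: degree_split sAB A1.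
have srs : size rs = m.+1.
  have [_ _] := map_fsubm_monic N mT cT.
  by rewrite TE size_prod_XsubC sT => -[].
(* Roots of [T] are scaled back by t^p, which has become t^(p (N+1)) after the second
   substitution. *)
exists (q.+1 * N.+1).-1, [seq fpsX K ^+ (p * N.+1) * r | r <- rs]; split.
  by move=> _ /mapP[r' /crs cr' ->]; rewrite rpredM // rpredX ?convX.
rewrite -map_fsubmA big_map.
apply: scaled_prod_XsubC => [|j]; rewrite srs.
  have [_ _ ->] := map_fsubm_monic N mQq cQq; by rewrite sQq sQ.
move=> jm; rewrite -TE !coef_map /= Tj // -exprM.
rewrite -{1}[fsubm q Q`_j](fshiftK (ord_ge j jm)) rmorphM /=; congr (_ * _).
by rewrite /fsubm fsubXn // mulnAC.
Qed.

End Puiseux.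

(** * Sums of convergent power series *)

Section Limits.
Variable R : realType.
Local Notation K := (C R).
Implicit Types (u v : nat -> K) (l a b : K).

Lemma C_posP (e : K) : 0 < e -> exists2 x : R, 0 < x & e = (x%:C)%C.
Proof. by case: e => x y; rewrite ltcE /= => /andP[/eqP -> x0]; exists x. Qed.

Lemma C_nnegP (e : K) : 0 <= e -> exists2 x : R, 0 <= x & e = (x%:C)%C.
Proof. by case: e => x y; rewrite lecE /= => /andP[/eqP -> x0]; exists x. Qed.

Lemma C_halves (M e : K) : 0 <= M -> 0 < e ->
  exists N, forall n, (N <= n)%N -> 2^-1 ^+ n * M <= e.
Proof.
move=> M0 e0; have Me0 : 0 <= M / e by rewrite divr_ge0 // ltW.
have [x x0 xE] := C_nnegP Me0.
exists (Num.bound x) => n bn.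
have xn : M / e <= n%:R.
  rewrite xE -(rmorph_nat (real_complex R)) lecR ltW //.
  by rewrite (lt_le_trans (archi_boundP x0)) // ler_nat.
rewrite exprVn mulrC ler_pdivrMr ?exprn_gt0 // mulrC -ler_pdivrMr //.
by rewrite (le_trans xn) // -natrX ler_nat ltnW // ltn_expl.
Qed.

Definition tends u l :=
  forall e : K, 0 < e -> exists N, forall n, (N <= n)%N -> `|u n - l| <= e.

Lemma cvg_tends u l : (u n @[n --> \oo] --> l) <-> tends u l.
Proof.
split=> [/cvgrPdist_le h e /h [N _ hN]|h].
  by exists N => n Nn; rewrite distrC; exact: hN.
by apply/cvgrPdist_le => e /h[N hN]; exists N => // n /hN; rewrite distrC.
Qed.

Lemma tends_unique u l l' : tends u l -> tends u l' -> l = l'.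
Proof.
move=> /cvg_tends hl /cvg_tends hl'.
exact: (cvg_unique (@norm_hausdorff _ _) hl hl').
Qed.

Lemma tends_cst l : tends (fun=> l) l.
Proof. by move=> e e0; exists 0%N => n _; rewrite subrr normr0 ltW. Qed.

Lemma tendsD u v a b : tends u a -> tends v b -> tends (fun n => u n + v n) (a + b).
Proof.
move=> /cvg_tends ha /cvg_tends hb; apply/cvg_tends.
by have := cvgD ha hb; apply.
Qed.

Lemma tendsM u v a b : tends u a -> tends v b -> tends (fun n => u n * v n) (a * b).
Proof.
move=> /cvg_tends ha /cvg_tends hb; apply/cvg_tends.
by have := cvgM ha hb; apply.
Qed.

Lemma tends_le_norm u l (M : K) : tends u l -> (forall n, `|u n| <= M) -> `|l| <= M.
Proof.
move=> ul uM; have Mr : M \is Num.real.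
  by rewrite ger0_real // (le_trans _ (uM 0%N)).
rewrite real_leNgt ?normr_real //; apply/negP => Ml.
pose d := (`|l| - M) / 2; have d0 : 0 < d by rewrite divr_gt0 ?ltr0n ?subr_gt0.
have [N hN] := ul d d0.
have : `|l| <= M + d.
  rewrite -[l in leLHS](subKr (u N)) (le_trans (ler_normB _ _)) // lerD //.
  exact: hN.
have {1}-> : `|l| = M + (d + d) by rewrite -splitr addrC subrK.
by rewrite lerD2l gerDl lt_geF.
Qed.

(** The common pattern for comparing two truncations of one series: on half of the radius their
    difference decays like 2^-n. *)
Lemma tends_halves u v l (M : K) : tends u l ->
  (forall n, `|v n - u n| <= 2^-1 ^+ n * M) -> tends v l.
Proof.
move=> ul h e e0; have e20 : 0 < e / 2 by rewrite divr_gt0 // ltr0n.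
have M0 : 0 <= M.
  by rewrite -[M]mul1r -(expr0 2^-1) (le_trans _ (h 0%N)).
have [N1 h1] := ul _ e20; have [N2 h2] := C_halves M0 e20.
exists (maxn N1 N2) => n; rewrite geq_max => /andP[n1 n2].
rewrite -(subrKA (u n)) (le_trans (ler_normD _ _)) // [leRHS]splitr lerD ?h1 //.
exact: le_trans (h n) (h2 n n2).
Qed.

Lemma tends_sub u l (f : nat -> nat) : (forall n, (n <= f n)%N) ->
  tends u l -> tends (u \o f) l.
Proof.
move=> hf ul e /ul[N hN]; exists N => n Nn; apply: hN.
exact: leq_trans (hf n).
Qed.

(** Completeness is taken from the reals: the real and imaginary parts are absolutely convergent,
    being dominated by the modulus. *)
Lemma abs_series_tends u (M : K) : (forall n, \sum_(i < n) `|u i| <= M) ->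
  exists l, tends (fun n => \sum_(i < n) u i) l.
Proof.
move=> hM.
have M0 : 0 <= M by have := hM 0%N; rewrite big_ord0.
have [m m0 mE] := C_nnegP M0.
have real_series (f : K -> R) : {morph f : x y / x + y} -> f 0 = 0 ->
    (forall z : K, ((`|f z|)%:C)%C <= `|z|) ->
    exists l' : R, (fun n => f (\sum_(i < n) u i)) @ \oo --> l'.
  move=> fD f0 fle.
  pose a i := f (u i).
  have ha : (fun n => f (\sum_(i < n) u i)) = series a.
    apply/funext => n; rewrite (big_morph f fD f0) /series /=.
    by rewrite big_mkord.
  rewrite ha; have : cvgn (series a).
    apply: normed_cvg; apply: nondecreasing_is_cvgn.
      by apply: nondecreasing_series => i _ _; apply: normr_ge0.
    exists m => _ [n _ <-]; change (\sum_(0 <= i < n) `|a i| <= m).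
    rewrite big_mkord -lecR -mE.
    rewrite rmorph_sum (le_trans _ (hM n)) // ler_sum // => i _; exact: fle.
  by move=> /cvg_ex[l hl]; exists l.
have ReD : {morph @complex.Re R : x y / x + y} by case=> [? ?] [? ?].
have ImD : {morph @complex.Im R : x y / x + y} by case=> [? ?] [? ?].
have Im_le (z : K) : ((`|complex.Im z|)%:C)%C <= `|z|.
  case: z => x y; rewrite normc_def lecR /= -sqrtr_sqr ler_wsqrtr // lerDr.
  exact: sqr_ge0.
have [a ha] := real_series _ ReD erefl (@normc_ge_Re R).
have [b hb] := real_series _ ImD erefl Im_le.
exists (a +i* b)%C => e /C_posP[x x0 ->].
have x20 : 0 < x / 2 by rewrite divr_gt0 // ltr0n.
move: ha => /cvgrPdist_le/(_ _ x20)[N1 _ h1].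
move: hb => /cvgrPdist_le/(_ _ x20)[N2 _ h2].
exists (maxn N1 N2) => n; rewrite geq_max => /andP[n1 n2].
have := h1 n n1; have := h2 n n2 => /=.
rewrite [`|a - _|]distrC [`|b - _|]distrC.
case: (\sum_(i < n) u i) => c d /= hd hc.
have -> : (c +i* d)%C - (a +i* b)%C = ((c - a)%:C)%C + 'i%C * ((d - b)%:C)%C :> K.
  by simpc.
rewrite (le_trans (ler_normD _ _)) // normrM.
have normR (z : R) : `|(z%:C)%C| = ((`|z|)%:C)%C :> K.
  by rewrite normc_def /= expr0n /= addr0 sqrtr_sqr.
have -> : `|'i%C| = 1 :> K by rewrite normc_def /= expr0n /= add0r expr1n sqrtr1.
rewrite mul1r !normR -rmorphD lecR [x]splitr lerD //.
Qed.

End Limits.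

Section Evaluation.
Variable R : realType.
Local Notation K := (C R).
Implicit Types (x y : fps K) (s t : K).

Definition psum x n t : K := (ftrunc n x).[t].

Lemma psumE x n t : psum x n t = \sum_(i < n) x i * t ^+ i.
Proof. exact: horner_poly. Qed.

(* The sum of the series, with value 0 where the series does not converge. *)
Definition ev x t : K := xget 0 [set l | tends (fun n => psum x n t) l].

Lemma evE x t l : tends (fun n => psum x n t) l -> ev x t = l.
Proof.
by move=> hl; rewrite /ev; case: xgetP => [l' _ h|/(_ l)//]; apply: tends_unique h hl.
Qed.

Lemma ev_tends s x t : conv_at s x -> `|t| <= s ->
  tends (fun n => psum x n t) (ev x t).
Proof.
move=> [M hM] ts.
have [l hl] : exists l, tends (fun n => psum x n t) l.
  have [|l hl] := @abs_series_tends R (fun i => x i * t ^+ i) M.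
    move=> n; apply: le_trans (hM n); rewrite tnormE; apply: ler_sum => i _.
    rewrite normrM normrX ler_wpM2l // lerXn2r ?nnegrE //.
    exact: le_trans ts.
  by exists l; under [fun n => psum _ _ _]eq_fun do rewrite psumE.
by rewrite (evE hl).
Qed.

Lemma ev_le s x t (M : K) : (forall n, tnorm s n x <= M) -> `|t| <= s -> `|ev x t| <= M.
Proof.
move=> hM ts; have cx : conv_at s x by exists M.
apply: tends_le_norm (ev_tends cx ts) _ => n; rewrite psumE.
apply: le_trans (hM n); rewrite tnormE (le_trans (ler_norm_sum _ _ _)) //.
apply: ler_sum => i _; rewrite normrM normrX ler_wpM2l // lerXn2r ?nnegrE //.
exact: le_trans ts.
Qed.

Lemma evD s x y t : conv_at s x -> conv_at s y -> `|t| <= s ->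
  ev (x + y) t = ev x t + ev y t.
Proof.
move=> cx cy ts; apply: evE.
have := tendsD (ev_tends cx ts) (ev_tends cy ts).
congr tends; apply/funext => n; rewrite !psumE -big_split /=.
by apply: eq_bigr => i _; rewrite -mulrDl.
Qed.

Lemma evC c t : ev (fpsC c) t = c.
Proof.
apply: evE => e e0; exists 1%N => -[//|n] _; rewrite psumE big_ord_recl /= mulr1.
by rewrite big1 ?addr0 ?subrr ?normr0 ?ltW // => i _; rewrite mul0r.
Qed.

Lemma ev_at0 x : ev x 0 = x 0%N.
Proof.
apply: evE => e e0; exists 1%N => -[//|n] _; rewrite psumE big_ord_recl /= mulr1.
by rewrite big1 ?addr0 ?subrr ?normr0 ?ltW // => i _; rewrite expr0n mulr0.
Qed.

Lemma ev0 t : ev 0 t = 0. Proof. exact: (evC 0). Qed.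

(** Each of the surviving terms has degree at least [n], and halving the radius multiplies it by at
    most 2^-n. This is why radii are halved throughout. *)
Lemma horner_halves (p q : {poly K}) s t n : 0 <= s -> `|t| <= s / 2 ->
  (forall i, (i < n)%N -> p`_i = 0) -> (forall i, `|p`_i| <= q`_i) ->
  `|p.[t]| <= 2^-1 ^+ n * q.[s].
Proof.
move=> s0 ts pn pq; have q0 i : 0 <= q`_i by apply: le_trans (pq i).
rewrite horner_coef (le_trans (ler_norm_sum _ _ _)) //.
apply: (@le_trans _ _ (2^-1 ^+ n * (\sum_(i < size p) q`_i * s ^+ i))); last first.
  by rewrite ler_wpM2l ?exprn_ge0 ?invr_ge0 ?ler0n // sum_coef_horner.
rewrite big_distrr; apply: ler_sum => i _ /=; rewrite normrM normrX.
case: (ltnP i n) => [/pn ->|ni].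
  by rewrite normr0 mul0r !mulr_ge0 ?exprn_ge0 ?invr_ge0 ?ler0n.
rewrite mulrCA ler_pM ?exprn_ge0 //.
apply: (@le_trans _ _ ((s / 2) ^+ i)).
  by rewrite lerXn2r ?nnegrE //; apply: le_trans ts.
rewrite exprMn mulrC ler_wpM2r ?exprn_ge0 //.
by rewrite ler_wiXn2l ?invr_ge0 ?ler0n // invf_le1 ?ltr0n // ler1n.
Qed.

Lemma evM s x y t : conv_at s x -> conv_at s y -> 0 <= s -> `|t| <= s / 2 ->
  ev (x * y) t = ev x t * ev y t.
Proof.
move=> cx cy s0 ts2; have ts : `|t| <= s.
  rewrite (le_trans ts2) // ler_pdivrMr ?ltr0n // ler_peMr // ler1n //.
have [M M0 hM] := conv_at_bound s0 cx; have [N N0 hN] := conv_at_bound s0 cy.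
(* The product of the truncations and the truncation of the product agree below degree [n]. *)
apply: evE; apply: (@tends_halves _ _ _ _ (M * N) (tendsM (ev_tends cx ts) (ev_tends cy ts))).
move=> n; rewrite /psum -hornerM distrC -hornerN -hornerD.
apply: (le_trans (@horner_halves _ (abs_trunc n x * abs_trunc n y) s t n s0 ts2 _ _)).
- by move=> i ni; rewrite coefB coef_ftrunc // (@fcoefM_trunc _ n) // subrr.
- move=> i; rewrite coefB [(ftrunc _ (x * y))`_i]coef_poly; case: ltnP => ni.
    by rewrite (@fcoefM_trunc _ n) // subrr normr0 abs_truncM_ge0.
  by rewrite subr0 norm_truncM.
rewrite ler_wpM2l ?exprn_ge0 ?invr_ge0 ?ler0n // hornerM.
by rewrite ler_pM ?hM ?hN // tnorm_ge0.
Qed.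

Lemma evX t : ev (fpsX K) t = t.
Proof.
apply: evE => e e0; exists 2%N => -[//|[//|n]] _; rewrite psumE !big_ord_recl /=.
rewrite mul0r add0r mul1r big1 ?addr0 ?subrr ?normr0 ?ltW // => i _.
by rewrite mul0r.
Qed.

Lemma le_half s t : 0 <= s -> `|t| <= s / 2 -> `|t| <= s.
Proof.
move=> s0 /le_trans; apply; rewrite ler_pdivrMr ?ltr0n // ler_peMr // ler1n //.
Qed.

Lemma ev_sum s t (I : Type) (r : seq I) (f : I -> fps K) :
  0 <= s -> `|t| <= s -> (forall i, conv_at s (f i)) ->
  ev (\sum_(i <- r) f i) t = \sum_(i <- r) ev (f i) t.
Proof.
move=> s0 ts cf; suff [] : ev (\sum_(i <- r) f i) t = \sum_(i <- r) ev (f i) t /\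
  conv_at s (\sum_(i <- r) f i) by [].
elim: r => [|i r [IH1 IH2]]; first by rewrite !big_nil ev0; split=> //; exact: conv_atC.
by rewrite !big_cons (evD (cf i) IH2 ts) IH1; split; [|exact: conv_atD].
Qed.

Lemma conv_atXn s x n : 0 <= s -> conv_at s x -> conv_at s (x ^+ n).
Proof.
move=> s0 cx; elim: n => [|n IH]; first exact: conv_atC.
by rewrite exprS; exact: conv_atM.
Qed.

Lemma evXn s x t n : conv_at s x -> 0 <= s -> `|t| <= s / 2 ->
  ev (x ^+ n) t = ev x t ^+ n.
Proof.
move=> cx s0 ts; elim: n => [|n IH]; first exact: evC.
by rewrite !exprS (evM cx (conv_atXn n s0 cx)) // IH.
Qed.

Lemma ev_horner s (p : {poly fps K}) x t : (forall i, conv_at s p`_i) ->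
  conv_at s x -> 0 <= s -> `|t| <= s / 2 ->
  ev p.[x] t = (map_poly (ev^~ t) p).[ev x t].
Proof.
move=> cp cx s0 ts; rewrite horner_coef (ev_sum _ s0 (le_half s0 ts)); last first.
  by move=> i; exact: conv_atM s0 (cp i) (conv_atXn i s0 cx).
rewrite (@horner_coef_wide _ (size p)) ?size_poly //; apply: eq_bigr => i _.
rewrite (evM (cp i) (conv_atXn i s0 cx)) // (evXn _ cx) // coef_map_id0 //.
exact: ev0.
Qed.

Lemma conv_poly_common (ps : seq {poly fps K}) :
  all (fun p => p \is a polyOver conv) ps ->
  exists2 s : K, 0 < s & forall p i, p \in ps -> conv_at s p`_i.
Proof.
elim: ps => [|p ps IH] /=; first by exists 1.
move=> /andP[cp /IH[s s0 hs]].
have [s' s'0 hs'] : exists2 s' : K, 0 < s' & forall i : 'I_(size p), conv_at s' p`_i.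
  apply: pos_min_fin => [i a b a0 ab|i]; last by apply/convP/polyOverP.
  by apply: conv_at_le => //; apply: ltW.
have [a a0 [as_ as']] := pos_min s0 s'0; exists a => // q i.
rewrite inE => /orP[/eqP->|qps]; last exact: conv_at_le (ltW a0) as_ (hs _ _ qps).
have [ip|pi] := ltnP i (size p).
  exact: conv_at_le (ltW a0) as' (hs' (Ordinal ip)).
by rewrite nth_default //; exact: conv_atC.
Qed.

Lemma ev_lipschitz x : x \in conv -> exists s M,
  [/\ 0 < s, 0 <= M & forall t, `|t| <= s -> `|ev x t - x 0%N| <= M * `|t|].
Proof.
move=> cx; have cy : fshift 1 x \in conv by exact: conv_fshift.
have /convP[s s0 ys] := cy; have [M M0 hM] := conv_at_bound (ltW s0) ys.
have xE : x = fpsC (x 0%N) + fpsX K * fshift 1 x.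
  by apply: fpsP => -[|n]; rewrite fcoefD fcoefXM /= ?addr0 ?add0r ?addn1.
exists (s / 2), M; split=> // [|t ts]; first by rewrite divr_gt0 // ltr0n.
have s0' := ltW s0; have cX := conv_atX s0'.
rewrite {1}xE (evD (conv_atC s _) (conv_atM s0' cX ys) (le_half s0' ts)).
rewrite (evM cX ys) // evC evX addrC addKr normrM mulrC ler_wpM2r //.
exact: ev_le hM (le_half s0' ts).
Qed.

Lemma ev_neq0 x : x \in conv -> x != 0 ->
  exists2 s, 0 < s & forall t, t != 0 -> `|t| <= s -> ev x t != 0.
Proof.
move=> cx /fps_order[n xn ox].
have [y cy xE] := conv_order_geP cx ox.
have y0 : y 0%N != 0 by move: xn; rewrite xE fcoefXnM ltnn subnn.
have [s1 [M [s10 M0 hy]]] := ev_lipschitz cy.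
have /convP[s2 s20 ys] := cy.
(* Writing x = X^n y with y(0) nonzero, this radius makes |y(t) - y(0)| at most |y(0)|/2. *)
pose s3 := `|y 0%N| / (M + 1) / 2.
have s30 : 0 < s3 by rewrite !divr_gt0 ?ltr0n ?normr_gt0 // ltr_wpDl.
have [a a0 [a1 a2]] := pos_min s10 (divr_gt0 s20 (ltr0Sn _ 1)).
have [b b0 [ba b3]] := pos_min a0 s30.
exists b => // t t0 tb; have ts2 := le_trans tb (le_trans ba a2).
have s20' := ltW s20.
rewrite xE (evM (conv_atXn n s20' (conv_atX s20')) ys) // (evXn _ (conv_atX s20')) //.
rewrite evX mulf_neq0 ?expf_neq0 //; apply/eqP => e0.
have := hy t (le_trans tb (le_trans ba a1)); rewrite e0 sub0r normrN.
have y0' : 0 < `|y 0%N| by rewrite normr_gt0.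
have : M * `|t| <= `|y 0%N| / 2.
  apply: (@le_trans _ _ ((M + 1) * s3)); last first.
    rewrite /s3 mulrA mulrCA mulfV ?mulr1 // gt_eqF // ltr_wpDl //.
  by rewrite ler_pM // ?lerDl // (le_trans tb).
move=> h /le_trans/(_ h); rewrite -subr_ge0 -[X in _ - X]mul1r.
rewrite (_ : _ - _ = - (`|y 0%N| / 2)); last by field.
by rewrite oppr_ge0 lt_geF // divr_gt0 // ltr0n.
Qed.
End Evaluation.

Section EvalSub.
Variable R : realType.
Local Notation K := (C R).
Implicit Types (x y : fps K) (s t : K).

Lemma ev_fsub q x : (0 < q)%N -> x \in conv -> exists2 s, 0 < s &
  forall t, `|t| <= s -> ev (fsub q x) t = ev x (t ^+ q).
Proof.
move=> q0 cx; have cqx := conv_fsub q0 cx.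
have [s1 s10 [xs qxs]] := conv_common cx cqx.
exists s1 => // t ts; symmetry; apply: evE.
(* Along the subsequence [n * q] the partial sums are those of [x], taken at t^q. *)
have h : tends (fun n => psum (fsub q x) (n * q)%N t) (ev (fsub q x) t).
  apply: (@tends_sub _ (fun n => psum (fsub q x) n t) _ (fun n => n * q)%N).
    by move=> n; apply: leq_pmulr.
  exact: ev_tends qxs ts.
move: h; congr tends; apply/funext => n; rewrite /psum.
have -> : ftrunc (n * q) (fsub q x) = ftrunc n x \Po 'X^q.
  apply/polyP => i; rewrite coef_comp_poly_Xn // !coef_poly /=.
  case: ifP => [|] iq; case: ifP => //; case/dvdnP => j ij; move: iq; rewrite ij.
    by rewrite ltn_mul2r q0 /= mulnK // => ->.
  by rewrite ltn_mul2r q0 /= mulnK // => ->.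
by rewrite horner_comp hornerXn.
Qed.

End EvalSub.

(** * Holomorphic germs *)

Section MpolyNorm.
Variables (K : numFieldType) (n : nat).
Implicit Types (p q : mpoly n K) (r : K) (m : multinom n).

Definition mnorm r p : K := \sum_(m <- msupp p) `|mcoeff m p| * r ^+ mdeg m.

Lemma mnorm_ge0 r p : 0 <= r -> 0 <= mnorm r p.
Proof. by move=> r0; apply: sumr_ge0 => m _; rewrite mulr_ge0 ?exprn_ge0. Qed.

Lemma mnorm_wide r p (s : seq (multinom n)) : uniq s -> {subset msupp p <= s} ->
  mnorm r p = \sum_(m <- s) `|mcoeff m p| * r ^+ mdeg m.
Proof.
move=> us ps; rewrite [RHS](bigID (mem (msupp p))) /= [X in _ + X]big1 ?addr0.
  rewrite -big_filter; apply: perm_big; apply: uniq_perm.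
  - exact: msupp_uniq.
  - exact: filter_uniq.
  - by move=> m; rewrite mem_filter; case: (boolP (m \in msupp p)) => // /ps ->.
by move=> m; rewrite mcoeff_msupp negbK => /eqP ->; rewrite normr0 mul0r.
Qed.

Lemma mnormD r p q : 0 <= r -> mnorm r (p + q) <= mnorm r p + mnorm r q.
Proof.
move=> r0; pose s := undup (msupp p ++ msupp q).
have us : uniq s by exact: undup_uniq.
rewrite (@mnorm_wide r (p + q) s) //; last first.
  by move=> m /msuppD_le; rewrite mem_undup.
rewrite (@mnorm_wide r p s) //; last first.
  by move=> m mp; rewrite mem_undup mem_cat mp.
rewrite (@mnorm_wide r q s) //; last first.
  by move=> m mq; rewrite mem_undup mem_cat mq orbT.
rewrite -big_split; apply: ler_sum => m _ /=.
by rewrite -mulrDl ler_wpM2r ?exprn_ge0 // mcoeffD ler_normD.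
Qed.

Lemma mnormN r p : mnorm r (- p) = mnorm r p.
Proof.
rewrite /mnorm (perm_big _ (msuppN p)); apply: eq_bigr => m _.
by rewrite mcoeffN normrN.
Qed.

Lemma mnormB r p q : 0 <= r -> mnorm r (p - q) <= mnorm r p + mnorm r q.
Proof. by move=> r0; rewrite -(mnormN r q) mnormD. Qed.

Lemma mnorm_sum r (I : Type) (s : seq I) (P : pred I) (F : I -> mpoly n K) :
  0 <= r -> mnorm r (\sum_(i <- s | P i) F i) <= \sum_(i <- s | P i) mnorm r (F i).
Proof.
move=> r0; elim/big_rec2: _ => [|i a b _ h].
  by rewrite /mnorm big1_seq // => m _; rewrite mcoeff0 normr0 mul0r.
by rewrite (le_trans (mnormD _ _ r0)) // lerD2l.
Qed.

Lemma mnormZX r c m : mnorm r (c *: mpolyX K m) <= `|c| * r ^+ mdeg m.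
Proof.
rewrite (@mnorm_wide r _ [:: m]) //.
  by rewrite big_seq1 mcoeffZ mcoeffX eqxx mulr1.
by move=> k /msuppZ_le; rewrite msuppX.
Qed.

Lemma mnormM r p q : 0 <= r -> mnorm r (p * q) <= mnorm r p * mnorm r q.
Proof.
move=> r0; rewrite {1}(mpolyE p) {1}(mpolyE q) big_distrlr /=.
rewrite (le_trans (mnorm_sum _ _ _ r0)) // /mnorm [leRHS]big_distrlr.
apply: ler_sum => k _; rewrite (le_trans (mnorm_sum _ _ _ r0)) //.
apply: ler_sum => l _; rewrite -scalerAl -scalerAr scalerA -mpolyXD.
rewrite (le_trans (mnormZX _ _ _)) // normrM mdegD exprD.
by rewrite mulrACA.
Qed.

Lemma mnormC r c : 0 <= r -> mnorm r (mpolyC n c) <= `|c|.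
Proof.
move=> r0; rewrite -[mpolyC n c]mulr1 mul_mpolyC -(mpolyX0 n K).
by rewrite (le_trans (mnormZX _ _ _)) // mdeg0 mulr1.
Qed.

Lemma mnorm_le r r' p : 0 <= r -> r <= r' -> mnorm r p <= mnorm r' p.
Proof.
move=> r0 rr'; apply: ler_sum => m _; rewrite ler_wpM2l // lerXn2r ?nnegrE //.
exact: le_trans rr'.
Qed.

(** One estimate for both kinds of substitution used below, of polynomials and of power series. *)
Lemma seminorm_mmap (T : comNzRingType) (N : T -> K) (f : K -> T) (h : 'I_n -> T) r p :
  0 <= r -> N 0 <= 0 -> N 1 <= 1 -> (forall x, 0 <= N x) ->
  (forall x y, N (x + y) <= N x + N y) -> (forall x y, N (x * y) <= N x * N y) ->
  (forall c, N (f c) <= `|c|) -> (forall i, N (h i) <= r) ->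
  N (mmap f h p) <= mnorm r p.
Proof.
move=> r0 N0 N1 Nge ND NM Nf Nh; rewrite /mmap /mnorm.
have Nexp i k : N (h i ^+ k) <= r ^+ k.
  elim: k => [|k IH]; first exact: N1.
  by rewrite !exprS (le_trans (NM _ _)) // ler_pM.
apply: (big_ind2 (fun x y => N x <= y)) => //.
  by move=> x a y b xa yb; rewrite (le_trans (ND _ _)) // lerD.
move=> m _; rewrite (le_trans (NM _ _)) // ler_pM // /mmap1 mdegE.
rewrite (_ : r ^+ _ = \prod_i r ^+ m i); last by rewrite prodrXr.
apply: (big_ind2 (fun x y => N x <= y)) => // x a y b xa yb.
by rewrite (le_trans (NM _ _)) // ler_pM.
Qed.

Definition low d p := forall m, (mdeg m < d)%N -> mcoeff m p = 0.

Lemma low0 d : low d 0. Proof. by move=> m _; rewrite mcoeff0. Qed.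
Lemma lowD d p q : low d p -> low d q -> low d (p + q).
Proof. by move=> hp hq m md; rewrite mcoeffD hp ?hq ?addr0. Qed.
Lemma lowM d e p q : low d p -> low e q -> low (d + e) (p * q).
Proof.
move=> hp hq m md; rewrite mcoeffM big1 // => -[k l] /= /eqP mE.
have [kd|dk] := ltnP (mdeg k) d; first by rewrite hp ?mul0r.
have := congr1 (@mdeg n) mE; rewrite mdegD => mdE.
have h : (mdeg k + mdeg l < d + e)%N by rewrite -mdE.
by rewrite hq ?mulr0 // -(ltn_add2l d) (leq_ltn_trans _ h) // leq_add2r.
Qed.
Lemma lowMl d p q : low d p -> low d (q * p).
Proof. by move=> hp; rewrite -(add0n d); apply: lowM. Qed.
Lemma lowMr d p q : low d p -> low d (p * q).
Proof. by move=> hp; rewrite -(addn0 d); apply: lowM. Qed.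
Lemma lowXn d k p : low d p -> low (d * k) (p ^+ k).
Proof.
move=> hp; elim: k => [|k IH]; first by rewrite muln0.
by rewrite exprS mulnS; apply: lowM.
Qed.
Lemma lowW d e p : (d <= e)%N -> low e p -> low d p.
Proof. by move=> de hp m md; apply: hp; apply: leq_trans de. Qed.
Lemma low_sum d (I : Type) (s : seq I) (P : pred I) (F : I -> mpoly n K) :
  (forall i, P i -> low d (F i)) -> low d (\sum_(i <- s | P i) F i).
Proof.
move=> h; elim/big_ind: _ => //; [exact: low0|by move=> x y; exact: lowD].
Qed.
Lemma lowX d m : (d <= mdeg m)%N -> low d (mpolyX K m).
Proof.
move=> dm k kd; rewrite mcoeffX; case: eqP => // mk.
by move: kd; rewrite -mk ltnNge dm.
Qed.

(** Shrinking the polydisk by a factor [a] gains [a] for every degree: the analogue of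
    [horner_halves] in several variables. *)
Lemma meval_low d p (v : 'I_n -> K) (r a : K) : 0 <= r -> 0 <= a -> a <= 1 ->
  low d p -> (forall i, `|v i| <= a * r) -> `|meval v p| <= a ^+ d * mnorm r p.
Proof.
move=> r0 a0 a1 pd vr; rewrite mevalE (le_trans (ler_norm_sum _ _ _)) //.
rewrite /mnorm big_distrr /= !big_seq; apply: ler_sum => m mp.
have dm : (d <= mdeg m)%N.
  by rewrite leqNgt; apply/negP => /pd /eqP; rewrite mcoeff_eq0 mp.
rewrite normrM mulrCA ler_wpM2l // normr_prod.
apply: (@le_trans _ _ ((a * r) ^+ mdeg m)).
  rewrite mdegE -prodrXr; apply: ler_prod => i _.
  by rewrite normr_ge0 normrX lerXn2r ?nnegrE // mulr_ge0.
by rewrite exprMn ler_wpM2r ?exprn_ge0 // ler_wiXn2l.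
Qed.

Lemma meval_le p (v : 'I_n -> K) r : 0 <= r -> (forall i, `|v i| <= r) ->
  `|meval v p| <= mnorm r p.
Proof.
move=> r0 vr; rewrite -[mnorm r p]mul1r -(expr0 1).
by apply: meval_low => // i; rewrite mul1r.
Qed.

Lemma order_ge_mmap d p (f : K -> fps K) (h : 'I_n -> fps K) : f 0 = 0 ->
  low d p -> (forall i, order_ge 1 (h i)) -> order_ge d (mmap f h p).
Proof.
move=> f0 pd h1; rewrite /mmap; apply: order_ge_sum => m _.
have [md|dm] := ltnP (mdeg m) d; first by rewrite pd // f0 mul0r; exact: order_ge0.
apply: order_geMl; apply: order_geW dm _; rewrite mdegE /mmap1.
elim/big_rec2: _ => [|i k x _ hk]; first by [].
by apply: order_geM => //; apply: order_geXn.
Qed.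

End MpolyNorm.

Section MpolyComp.
Variables (K : numFieldType) (n k : nat).

Lemma mnorm_comp r s (p : mpoly n K) (L : n.-tuple (mpoly k K)) : 0 <= r -> 0 <= s ->
  (forall i, mnorm s (tnth L i) <= r) -> mnorm s (comp_mpoly L p) <= mnorm r p.
Proof.
move=> r0 s0 hL; rewrite /comp_mpoly.
apply: (@seminorm_mmap K n (mpoly k K) (mnorm s)) => //.
- by rewrite /mnorm big1_seq // => m _; rewrite mcoeff0 normr0 mul0r.
- by rewrite -[leRHS](normr1 K); exact: mnormC.
- by move=> x; exact: mnorm_ge0.
- by move=> x y; exact: mnormD.
- by move=> x y; exact: mnormM.
- by move=> c; exact: mnormC.
Qed.

Lemma low_comp d (p : mpoly n K) (L : n.-tuple (mpoly k K)) : low d p ->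
  (forall i, low 1 (tnth L i)) -> low d (comp_mpoly L p).
Proof.
move=> pd hL; rewrite comp_mpolyE; apply: low_sum => m _.
have [md|dm] := ltnP (mdeg m) d; first by rewrite pd // scale0r; exact: low0.
rewrite -mul_mpolyC; apply: lowMl; apply: lowW dm _; rewrite mdegE.
elim/big_rec2: _ => [|i j x _ hj]; first by [].
by apply: lowM => //; rewrite -[X in low X]mul1n; apply: lowXn.
Qed.

Lemma tnorm_mmap r s N (p : mpoly n K) (h : 'I_n -> fps K) : 0 <= r -> 0 <= s ->
  (forall i, tnorm s N (h i) <= r) -> tnorm s N (mmap (@fpsC K) h p) <= mnorm r p.
Proof.
move=> r0 s0 hh; apply: (@seminorm_mmap K n (fps K) (tnorm s N)) => //.
- by rewrite tnormE big1 // => i _; rewrite fcoef0 normr0 mul0r.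
- by rewrite -[leRHS](normr1 K); exact: tnormC.
- by move=> x; exact: tnorm_ge0.
- by move=> x y; exact: tnormD.
- by move=> x y; exact: tnormM.
- by move=> c; exact: tnormC.
Qed.

End MpolyComp.

Lemma nbhs_rV0 (K : numFieldType) n (P : 'rV[K]_n -> Prop) :
  (\forall x \near (0 : 'rV[K]_n), P x) <->
  exists2 e : K, 0 < e & forall x : 'rV[K]_n, (forall i, `|x ord0 i| <= e) -> P x.
Proof.
split=> [/nbhs_ballP[e /= e0 he]|[e e0 he]].
  exists (e / 2) => [|x hx]; first by rewrite divr_gt0 // ltr0n.
  apply: he; split=> // i j; rewrite !mxE /ball /= sub0r normrN (ord1 i).
  by rewrite (le_lt_trans (hx j)) // ltr_pdivrMr ?ltr0n // ltr_pMr // ltr1n.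
apply/nbhs_ballP; exists e => // x hx; apply: he => i.
by have [_ /(_ ord0 i)] := hx; rewrite !mxE /ball /= sub0r normrN => /ltW.
Qed.

Section Holo.
Variable R : realType.
Local Notation K := (C R).

(* A power series is given by polynomial truncations: g N.+1 - g N has no terms of
   degree < N, so the coefficients stabilize. *)
Definition hrep n (r M : K) (g : nat -> mpoly n K) (f : 'rV[K]_n -> K) : Prop :=
  [/\ forall N, mnorm r (g N) <= M,
      forall N, low N (g N.+1 - g N) &
      forall x : 'rV[K]_n, (forall i, `|x ord0 i| <= r) ->
        tends (fun N => meval (x ord0) (g N)) (f x)].

Definition holo n (f : 'rV[K]_n -> K) := exists (r M : K) g, 0 < r /\ hrep r M g f.

Lemma hrep_stable n (r M : K) (g : nat -> mpoly n K) f : hrep r M g f ->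
  forall N N', (N <= N')%N -> low N (g N' - g N).
Proof.
move=> [_ gS _] N N' /subnK <-; elim: (N' - N)%N => [|k IH].
  by rewrite add0n subrr; exact: low0.
rewrite -(subrKA (g (k + N)%N)); apply: lowD IH.
by apply: lowW (gS _); apply: leq_addl.
Qed.

Lemma hrep_ge0 n (r M : K) (g : nat -> mpoly n K) f : 0 <= r -> hrep r M g f -> 0 <= M.
Proof. by move=> r0 [h _ _]; apply: le_trans (h 0%N); apply: mnorm_ge0. Qed.

Lemma hrep_le n (r r' M : K) (g : nat -> mpoly n K) f : 0 <= r -> r <= r' ->
  hrep r' M g f -> hrep r M g f.
Proof.
move=> r0 rr' [h1 h2 h3]; split; [move=> N|exact: h2|move=> x hx].
  exact: le_trans (mnorm_le _ r0 rr') (h1 N).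
by apply: h3 => i; apply: le_trans rr'.
Qed.

Lemma holo_common n (f f' : 'rV[K]_n -> K) : holo f -> holo f' ->
  exists (r M : K) g (M' : K) g', [/\ 0 < r, hrep r M g f & hrep r M' g' f'].
Proof.
move=> [r [M [g [r0 h]]]] [r' [M' [g' [r'0 h']]]].
have [s s0 [sr sr']] := pos_min r0 r'0.
exists s, M, g, M', g'; split=> //; first exact: hrep_le (ltW s0) sr h.
exact: hrep_le (ltW s0) sr' h'.
Qed.

Lemma holo_cst n c : holo (fun _ : 'rV[K]_n => c).
Proof.
exists 1, `|c|, (fun=> mpolyC n c); split=> //; split=> [N|N|x _].
- exact: mnormC.
- by rewrite subrr; exact: low0.
- by under eq_fun do rewrite mevalC; exact: tends_cst.
Qed.

Lemma holoD n (f f' : 'rV[K]_n -> K) : holo f -> holo f' -> holo (fun x => f x + f' x).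
Proof.
move=> /holo_common/[apply] -[r [M [g [M' [g' [r0 [h1 h2 h3] [h1' h2' h3']]]]]]].
exists r, (M + M'), (fun N => g N + g' N); split=> //; split=> [N|N|x hx].
- by rewrite (le_trans (mnormD _ _ (ltW r0))) // lerD.
- by rewrite opprD addrACA; apply: lowD.
- under eq_fun do rewrite mevalD; exact: tendsD (h3 x hx) (h3' x hx).
Qed.

Lemma holoM n (f f' : 'rV[K]_n -> K) : holo f -> holo f' -> holo (fun x => f x * f' x).
Proof.
move=> /holo_common/[apply] -[r [M [g [M' [g' [r0 [h1 h2 h3] [h1' h2' h3']]]]]]].
exists r, (M * M'), (fun N => g N * g' N); split=> //; split=> [N|N|x hx].
- by rewrite (le_trans (mnormM _ _ (ltW r0))) // ler_pM ?mnorm_ge0 ?(ltW r0).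
- rewrite -(subrKA (g N * g' N.+1)) -mulrBl -mulrBr.
  by apply: lowD; [apply: lowMr|apply: lowMl].
- under eq_fun do rewrite mevalM; exact: tendsM (h3 x hx) (h3' x hx).
Qed.

Lemma holoN n (f : 'rV[K]_n -> K) : holo f -> holo (fun x => - f x).
Proof.
move=> hf; rewrite (_ : (fun x => _) = fun x => (- 1) * f x).
  exact: holoM (holo_cst _ _) hf.
by apply/funext => x; rewrite mulN1r.
Qed.

Lemma holo_coord n (i : 'I_n) : holo (fun x : 'rV[K]_n => x ord0 i).
Proof.
exists 1, (mnorm 1 (mpolyX K (mnm1 i))), (fun=> mpolyX K (mnm1 i)).
split=> //; split=> // [N|x _]; first by rewrite subrr; exact: low0.
by under eq_fun do rewrite mevalXU; exact: tends_cst.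
Qed.

Lemma holo_linear n k (f : 'rV[K]_n -> K) (A : 'M[K]_(k, n)) : holo f ->
  holo (fun x : 'rV[K]_k => f (x *m A)).
Proof.
move=> [r [M [g [r0 [h1 h2 h3]]]]].
pose L := [tuple \sum_(j < k) A j i *: mpolyX K (mnm1 j) | i < n].
have LE i : tnth L i = \sum_(j < k) A j i *: mpolyX K (mnm1 j).
  by rewrite tnth_mktuple.
(* On the polydisk of radius r / B the linear map stays in the polydisk of radius r; the summand 1
   makes [B] positive. *)
pose B := 1 + \sum_(i < n) \sum_(j < k) `|A j i|.
have B0 : 0 < B by rewrite ltr_pwDl // !sumr_ge0 // => i _; apply: sumr_ge0.
have AB i : \sum_(j < k) `|A j i| <= B.
  rewrite /B (bigD1 i) //= addrCA lerDl addr_ge0 // sumr_ge0 // => j _.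
  exact: sumr_ge0.
have rB0 : 0 <= r / B by rewrite divr_ge0 ?ltW.
exists (r / B), M, (fun N => comp_mpoly L (g N)).
split; first by rewrite divr_gt0.
split=> [N|N|x hx].
- apply: le_trans (h1 N); apply: mnorm_comp; rewrite ?(ltW r0) // => i.
  rewrite LE (le_trans (mnorm_sum _ _ _ rB0)) //.
  apply: (@le_trans _ _ (\sum_(j < k) `|A j i| * (r / B))).
    by apply: ler_sum => j _; rewrite (le_trans (mnormZX _ _ _)) // mdeg1 expr1.
  by rewrite -big_distrl /= mulrA ler_pdivrMr // mulrC ler_wpM2l ?(ltW r0).
- have -> : comp_mpoly L (g N.+1) - comp_mpoly L (g N) = comp_mpoly L (g N.+1 - g N).
    by rewrite raddfB.
  apply: low_comp => // i; rewrite LE; apply: low_sum => j _.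
  by rewrite -mul_mpolyC; apply: lowMl; apply: lowX; rewrite mdeg1.
have hL (N : nat) : meval (x ord0) (comp_mpoly L (g N)) = meval ((x *m A) ord0) (g N).
  rewrite comp_mpoly_meval; congr (meval _ _); apply/funext => i.
  rewrite LE mxE raddf_sum; apply: eq_bigr => j _ /=.
  by rewrite mevalZ mevalXU mulrC.
under eq_fun do rewrite hL.
apply: h3 => i; rewrite mxE (le_trans (ler_norm_sum _ _ _)) //.
apply: (@le_trans _ _ (\sum_(j < k) `|A j i| * (r / B))).
  by apply: ler_sum => j _; rewrite normrM mulrC ler_wpM2l.
by rewrite -big_distrl /= mulrA ler_pdivrMr // mulrC ler_wpM2l ?(ltW r0).
Qed.

Lemma hrep_le_norm n (r M : K) (g : nat -> mpoly n K) f (x : 'rV[K]_n) : 0 <= r -> hrep r M g f ->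
  (forall i, `|x ord0 i| <= r) -> `|f x| <= M.
Proof.
move=> r0 [h1 h2 h3] hx; apply: tends_le_norm (h3 x hx) _ => N.
exact: le_trans (meval_le _ r0 hx) (h1 N).
Qed.

Lemma holo_bounded n (f : 'rV[K]_n -> K) : holo f ->
  exists r M : K, [/\ 0 < r, 0 <= M &
    forall x : 'rV[K]_n, (forall i, `|x ord0 i| <= r) -> `|f x| <= M].
Proof.
move=> [r [M [g [r0 h]]]]; exists r, M; split=> // [|x hx].
  exact: hrep_ge0 (ltW r0) h.
exact: hrep_le_norm (ltW r0) h hx.
Qed.

Lemma holo_continuous0 n (f : 'rV[K]_n -> K) (e : K) : holo f -> 0 < e ->
  exists2 r : K, 0 < r & forall x : 'rV[K]_n, (forall i, `|x ord0 i| <= r) -> `|f x - f 0| <= e.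
Proof.
move=> [r [M [g [r0 hg]]]] e0; have M0 := hrep_ge0 (ltW r0) hg.
have M10 : 0 < M + M + 1 by rewrite ltr_wpDl // addr_ge0.
(* A truncation minus its constant term has norm at most 2M and no term of degree 0, so on radius
   [a * r] it is at most 2 M a, hence at most [e]. *)
have [a a0 [ae a1]] := pos_min (divr_gt0 e0 M10) ltr01.
have ar0 : 0 < a * r by rewrite mulr_gt0.
have ar : a * r <= r by exact: ler_piMl (ltW r0) a1.
exists (a * r) => // x hx; have [h1 h2 h3] := hg.
have hx' i : `|x ord0 i| <= r by apply: le_trans ar.
have h0 : forall i, `|(0 : 'rV[K]_n) ord0 i| <= r.
  by move=> i; rewrite mxE normr0 ltW.
have := tendsD (h3 x hx') (tendsM (tends_cst (- 1)) (h3 0 h0)).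
rewrite mulN1r => /tends_le_norm; apply => N; rewrite mulN1r.
have -> : meval ((0 : 'rV[K]_n) ord0) (g N) = mcoeff (@mnm0 n) (g N).
  have hl : low 1 (g N - mpolyC n (mcoeff (@mnm0 n) (g N))).
    move=> m; rewrite ltnS leqn0 mdeg_eq0 => /eqP ->.
    by rewrite mcoeffB mcoeffC eqxx mulr1 subrr.
  have hz : forall i, `|(0 : 'rV[K]_n) ord0 i| <= 0 * r.
    by move=> i; rewrite mxE normr0 mul0r.
  have := meval_low (ltW r0) (lexx 0) ler01 hl hz.
  by rewrite expr1 mul0r normr_le0 mevalB mevalC subr_eq0 => /eqP.
rewrite -[X in _ - X](mevalC (x ord0)) -mevalB.
have hl : low 1 (g N - mpolyC n (mcoeff (@mnm0 n) (g N))).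
  move=> m; rewrite ltnS leqn0 mdeg_eq0 => /eqP ->.
  by rewrite mcoeffB mcoeffC eqxx mulr1 subrr.
rewrite (le_trans (meval_low (ltW r0) (ltW a0) a1 hl hx)) // expr1.
have hM : mnorm r (g N - mpolyC n (mcoeff (@mnm0 n) (g N))) <= M + M.
  rewrite (le_trans (mnormB _ _ (ltW r0))) // lerD //.
  rewrite (le_trans (mnormC _ _ (ltW r0))) // (le_trans _ (h1 N)) //.
  have [z|z] := boolP (@mnm0 n \in msupp (g N)); last first.
    by rewrite memN_msupp_eq0 // normr0 mnorm_ge0 // ltW.
  rewrite /mnorm (big_rem _ z) /= mdeg0 expr0 mulr1 lerDl.
  by apply: sumr_ge0 => m _; rewrite mulr_ge0 ?exprn_ge0 // ltW.
apply: (@le_trans _ _ (a * (M + M))); first by rewrite ler_wpM2l // ltW.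
move: ae; rewrite ler_pdivlMr //; apply: le_trans.
by rewrite ler_wpM2l ?(ltW a0) // lerDl.
Qed.

End Holo.

Section PowerSeries.
Variable R : realType.
Local Notation K := (C R).
Variable n : nat.
Implicit Types (a : ('I_n -> nat) -> K) (x : 'rV[K]_n) (f : 'rV[K]_n -> K).

Definition to_multinom (alpha : 'I_n -> nat) : multinom n :=
  Multinom [tuple alpha i | i < n].

Lemma to_multinomE alpha i : to_multinom alpha i = alpha i.
Proof. exact: mnmE. Qed.

Lemma mdeg_to_multinom alpha : mdeg (to_multinom alpha) = (\sum_i alpha i)%N.
Proof. by rewrite mdegE; apply: eq_bigr => i _; rewrite to_multinomE. Qed.

Definition psum_poly a N : mpoly n K :=
  \sum_(alpha : {ffun 'I_n -> 'I_N})
    a (fun i => alpha i : nat) *: mpolyX K (to_multinom (fun i => alpha i : nat)).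

Lemma meval_psum_poly a N x : meval (x ord0) (psum_poly a N) = pseries_psum a x N.
Proof.
rewrite raddf_sum; apply: eq_bigr => alpha _ /=; rewrite mevalZ mevalX.
by congr (_ * _); apply: eq_bigr => i _; rewrite to_multinomE.
Qed.

Lemma pseries_psum_const a (r : K) N :
  pseries_psum a (const_mx r) N =
  \sum_(alpha : {ffun 'I_n -> 'I_N}) a (fun i => alpha i : nat) *
     r ^+ mdeg (to_multinom (fun i => alpha i : nat)).
Proof.
apply: eq_bigr => alpha _; congr (_ * _); rewrite mdeg_to_multinom -prodrXr.
by apply: eq_bigr => i _; rewrite mxE.
Qed.

Lemma mnorm_psum_poly a (r : K) N : 0 <= r ->
  mnorm r (psum_poly a N) <= pseries_psum (fun alpha => `|a alpha|) (const_mx r) N.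
Proof.
move=> r0; rewrite pseries_psum_const (le_trans (mnorm_sum _ _ _ r0)) //.
by apply: ler_sum => alpha _; exact: mnormZX.
Qed.

Lemma mcoeff_psum_poly a N (m : multinom n) : (forall i, (m i < N)%N) ->
  mcoeff m (psum_poly a N) = a (fun i => m i).
Proof.
move=> mN; pose al : {ffun 'I_n -> 'I_N} := [ffun i => Ordinal (mN i)].
have alE : (fun i => al i : nat) = (fun i => m i).
  by apply/funext => i; rewrite ffunE.
rewrite raddf_sum (bigD1 al) //= big1 ?addr0 => [|be nbe].
  rewrite mcoeffZ mcoeffX alE (_ : _ == m) ?mulr1 //.
  by apply/eqP/mnmP => i; rewrite to_multinomE.
rewrite mcoeffZ mcoeffX (_ : _ == m = false) ?mulr0 //.
apply: contraNF nbe => /eqP e; apply/eqP/ffunP => i; apply: val_inj.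
by rewrite ffunE /= -e to_multinomE.
Qed.

Lemma mdeg_coord (m : multinom n) N : (mdeg m < N)%N -> forall i, (m i < N)%N.
Proof.
move=> mN i; apply: leq_ltn_trans mN; rewrite mdegE (bigD1 i) //=.
exact: leq_addr.
Qed.

Lemma pseries_holo (r : K) f : 0 < r -> pseries_on r f -> holo f.
Proof.
move=> r0 [a [[M hM] ha]]; exists r, M, (psum_poly a); split=> //; split.
- by move=> N; apply: le_trans (mnorm_psum_poly _ _ (ltW r0)) (hM N).
- move=> N m mN; rewrite mcoeffB !mcoeff_psum_poly ?subrr //; apply: mdeg_coord => //.
  exact: ltnW.
- move=> x hx; have /cvg_tends := ha x hx; congr tends.
  by apply/funext => N; rewrite meval_psum_poly.
Qed.

Lemma germ_holo f : holomorphic_germ f -> holo f.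
Proof. by move=> [r r0]; exact: pseries_holo. Qed.

Lemma mnorm_sub_le (r : K) (p : mpoly n K) (s : seq (multinom n)) : 0 <= r ->
  uniq s -> \sum_(m <- s) `|mcoeff m p| * r ^+ mdeg m <= mnorm r p.
Proof.
move=> r0 us; rewrite (@mnorm_wide _ _ r p (s ++ [seq m <- msupp p | m \notin s])).
- rewrite big_cat /= lerDl; apply: sumr_ge0 => m _.
  by rewrite mulr_ge0 ?exprn_ge0.
- rewrite cat_uniq us filter_uniq ?msupp_uniq // andbT.
  by apply/hasPn => m; rewrite mem_filter => /andP[].
- move=> m mp; rewrite mem_cat mem_filter mp andbT.
  by case: (m \in s).
Qed.

(** The truncations in [hrep] need not be the box-shaped ones of [pseries_psum]. Both agree below
    degree [N], so on half of the radius they have the same limit. *)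
Lemma hrep_pseries (r M : K) g f : 0 <= r -> hrep r M g f -> pseries_on (r / 2) f.
Proof.
move=> r0 hg; have [h1 h2 h3] := hg; have stab := hrep_stable hg.
(* From the index one above its degree on, a coefficient no longer changes. *)
pose a (al : 'I_n -> nat) := mcoeff (to_multinom al) (g (mdeg (to_multinom al)).+1).
have aE (m : multinom n) N : (mdeg m < N)%N -> a (fun i => m i) = mcoeff m (g N).
  move=> mN; rewrite /a (_ : to_multinom _ = m); last first.
    by apply/mnmP => i; rewrite to_multinomE.
  have := stab _ _ mN m (ltnSn _); rewrite mcoeffB => /eqP.
  by rewrite subr_eq0 => /eqP ->.
have aM N : pseries_psum (fun al => `|a al|) (const_mx r) N <= M.
  rewrite pseries_psum_const; pose mn (al : {ffun 'I_n -> 'I_N}) :=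
    to_multinom (fun i => al i : nat).
  (* All exponents in the box have degree at most n N, so a single truncation contains the whole
     box. *)
  have mnN al : (mdeg (mn al) < (n * N).+1)%N.
    rewrite ltnS mdeg_to_multinom -[n in (n * _)%N]card_ord -sum_nat_const.
    by apply: leq_sum => i _; apply: ltnW.
  have us : uniq (map mn (enum {: {ffun 'I_n -> 'I_N}})).
    rewrite map_inj_uniq ?enum_uniq // => al be e.
    apply/ffunP => i; apply: val_inj.
    by rewrite /= -(to_multinomE (fun i => al i : nat)) -/(mn al) e to_multinomE.
  apply: le_trans (h1 (n * N).+1); apply: le_trans (mnorm_sub_le _ r0 us).
  rewrite big_map big_enum /=; apply: ler_sum => al _.
  rewrite -/(mn al) ler_wpM2r ?exprn_ge0 //.
  rewrite -(aE _ _ (mnN al)) (_ : (fun i => mn al i) = (fun i => al i : nat)) //.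
  by apply/funext => i; rewrite to_multinomE.
have r20 : 0 <= r / 2 by rewrite divr_ge0 ?ler0n.
have r2r : r / 2 <= r.
  by rewrite ler_pdivrMr ?ltr0n // ler_peMr // ler1n.
exists a; split.
  exists M => N; apply: le_trans (aM N); rewrite !pseries_psum_const.
  by apply: ler_sum => al _; rewrite ler_wpM2l // lerXn2r ?nnegrE.
move=> x hx; have hx' i : `|x ord0 i| <= r by apply: le_trans r2r.
apply/cvg_tends; apply: (@tends_halves _ _ _ _ (M + M) (h3 x hx')) => N.
rewrite -/(pseries_psum a x N) -meval_psum_poly -mevalB.
have lo : low N (psum_poly a N - g N).
  move=> m mN; rewrite mcoeffB mcoeff_psum_poly; last exact: mdeg_coord.
  by rewrite (aE m N mN) subrr.
have i2 : 0 <= 2^-1 :> K by rewrite invr_ge0 ler0n.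
have i21 : 2^-1 <= 1 :> K by rewrite invf_le1 ?ltr0n // ler1n.
have hx2 i : `|x ord0 i| <= 2^-1 * r by rewrite mulrC.
rewrite (le_trans (meval_low r0 i2 i21 lo hx2)) // ler_wpM2l ?exprn_ge0 //.
rewrite (le_trans (mnormB _ _ r0)) // lerD //.
exact: le_trans (mnorm_psum_poly _ _ r0) (aM N).
Qed.

Lemma holo_germ f : holo f -> holomorphic_germ f.
Proof.
move=> [r [M [g [r0 h]]]]; exists (r / 2); first by rewrite divr_gt0 ?ltr0n.
exact: hrep_pseries (ltW r0) h.
Qed.

(** All small radii are provided because [injective_arc] asks for one radius for both
    coordinates. *)
Lemma pseries_on_small f : holo f -> exists2 r : K, 0 < r &
  forall s : K, 0 < s -> s <= r -> pseries_on s f.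
Proof.
move=> [r [M [g [r0 h]]]]; exists (r / 2) => [|s s0 sr].
  by rewrite divr_gt0 ?ltr0n.
rewrite -[s](mulfK (x := 2)) ?pnatr_eq0 //; apply: (@hrep_pseries _ M g).
  by rewrite mulr_ge0 ?ler0n ?(ltW s0).
apply: hrep_le h; first by rewrite mulr_ge0 ?ler0n ?(ltW s0).
by rewrite -ler_pdivlMr ?ltr0n.
Qed.

End PowerSeries.

(** * Substitution of power series into holomorphic germs *)

Section Substitution.
Variable R : realType.
Local Notation K := (C R).

Lemma ev_order_halves s (x : fps K) (t M : K) N : 0 <= s -> `|t| <= s / 2 ->
  order_ge N x -> (forall n, tnorm s n x <= M) -> `|ev x t| <= 2^-1 ^+ N * M.
Proof.
move=> s0 ts Nx hM; have cx : conv_at s x by exists M.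
apply: tends_le_norm (ev_tends cx (le_half s0 ts)) _ => n.
apply: (le_trans (@horner_halves _ (ftrunc n x) (abs_trunc n x) s t N s0 ts _ _)).
- by move=> i iN; rewrite coef_poly; case: ifP => // _; exact: Nx.
- by move=> i; rewrite !coef_poly; case: ifP; rewrite ?normr0.
- by rewrite ler_wpM2l ?exprn_ge0 ?invr_ge0 ?ler0n //; exact: hM.
Qed.

Lemma ev_prod s (t : K) (I : Type) (r : seq I) (f : I -> fps K) :
  0 <= s -> `|t| <= s / 2 -> (forall i, conv_at s (f i)) ->
  ev (\prod_(i <- r) f i) t = \prod_(i <- r) ev (f i) t /\
  conv_at s (\prod_(i <- r) f i).
Proof.
move=> s0 ts cf.
elim: r => [|i r [IH1 IH2]]; first by rewrite !big_nil evC; split=> //; exact: conv_atC.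
by rewrite !big_cons (evM (cf i) IH2 s0 ts) IH1; split; [|exact: conv_atM].
Qed.

Lemma ev_mmap n s (t : K) (p : mpoly n K) (sg : 'I_n -> fps K) :
  0 <= s -> `|t| <= s / 2 -> (forall i, conv_at s (sg i)) ->
  ev (mmap (@fpsC K) sg p) t = meval (fun i => ev (sg i) t) p.
Proof.
move=> s0 ts csg.
have h m : ev (mmap1 sg m) t = \prod_i ev (sg i) t ^+ m i /\ conv_at s (mmap1 sg m).
  have [h1 h2] := @ev_prod s t _ (index_enum _) (fun i : 'I_n => sg i ^+ m i) s0 ts
    (fun i => conv_atXn (m i) s0 (csg i)).
  split=> //; rewrite /mmap1 h1; apply: eq_bigr => i _.
  by rewrite (evXn _ (csg i)).
rewrite mevalE /mmap (ev_sum _ s0 (le_half s0 ts)) => [|m].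
  apply: eq_bigr => m _; have [h1 h2] := h m.
  by rewrite (evM (conv_atC s _) h2) // evC h1.
by apply: conv_atM => //; [exact: conv_atC|case: (h m)].
Qed.

Lemma order_geM_congr k (x y x' y' : fps K) :
  order_ge k (x - x') -> order_ge k (y - y') -> order_ge k (x * y - x' * y').
Proof.
move=> hx hy; rewrite -(subrKA (x' * y)) -mulrBl -mulrBr.
by apply: order_geD; [exact: order_geMr|exact: order_geMl].
Qed.

Lemma order_ge_mmap_congr n k (p : mpoly n K) (sg sg' : 'I_n -> fps K) :
  (forall i, order_ge k (sg i - sg' i)) ->
  order_ge k (mmap (@fpsC K) sg p - mmap (@fpsC K) sg' p).
Proof.
move=> h; rewrite /mmap -sumrB; apply: order_ge_sum => m _; rewrite -mulrBr.
apply: order_geMl; rewrite /mmap1.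
apply: (big_ind2 (fun x y : fps K => order_ge k (x - y))) => [|x x' y y' hx hy|i _].
- by rewrite subrr; exact: order_ge0.
- exact: order_geM_congr.
elim: (m i) => [|j IH]; first by rewrite !expr0 subrr; exact: order_ge0.
by rewrite !exprS; exact: order_geM_congr.
Qed.

Lemma tnorm_small (x : fps K) (r : K) : x \in conv -> order_ge 1 x -> 0 < r ->
  exists2 s, 0 < s & forall n, tnorm s n x <= r.
Proof.
move=> cx ox r0; have [y cy ->] := conv_order_geP cx ox; rewrite expr1.
have /convP[s1 s10 ys] := cy; have [M M0 hM] := conv_at_bound (ltW s10) ys.
have M10 : 0 < M + 1 by rewrite ltr_wpDl.
have [s s0 [ss1 sM]] := pos_min s10 (divr_gt0 r0 M10).
exists s => // n; apply: le_trans (ler_tnorm _ (ltW s0) (lexx s) (leqnSn n)) _.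
rewrite tnormXM; apply: (@le_trans _ _ (s * (M + 1))).
  rewrite ler_wpM2l ?(ltW s0) // (le_trans (ler_tnorm _ (ltW s0) ss1 (leqnn n))) //.
  by rewrite (le_trans (hM n)) // lerDl.
by rewrite -ler_pdivlMr.
Qed.

(** [Phi] does not depend on [sg]: the same operator is applied to the line and to the arc, and the
    last clause compares the results modulo a power of X. As [sg] has no constant term, coefficient
    k of the composite is read off from the truncation [g k.+1]. *)
Lemma holo_subst_at n (f : 'rV[K]_n -> K) : holo f ->
  exists (r : K) (Phi : ('I_n -> fps K) -> fps K),
  [/\ 0 < r,
      forall sg s, 0 < s -> (forall i, order_ge 1 (sg i)) ->
        (forall i N, tnorm s N (sg i) <= r) ->
        conv_at s (Phi sg) /\
        forall t, `|t| <= s / 2 -> ev (Phi sg) t = f (\row_i ev (sg i) t)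
    & forall k sg sg', (forall i, order_ge k (sg i - sg' i)) ->
        order_ge k (Phi sg - Phi sg')].
Proof.
move=> [r [M [g [r0 hg]]]]; have [h1 h2 h3] := hg; have stab := hrep_stable hg.
have [Phi PhiE] : exists Phi : ('I_n -> fps K) -> fps K,
    forall sg k, Phi sg k = mmap (@fpsC K) sg (g k.+1) k.
  by exists (fun sg => Fps (fun k => mmap (@fpsC K) sg (g k.+1) k)).
have PhiN sg N : (forall i, order_ge 1 (sg i)) ->
    order_ge N (Phi sg - mmap (@fpsC K) sg (g N)).
  move=> osg k kN; rewrite fcoefD fcoefN PhiE.
  have : order_ge k.+1 (mmap (@fpsC K) sg (g N - g k.+1)).
    by apply: order_ge_mmap => //; exact: stab.
  move=> /(_ k (ltnSn k)); rewrite raddfB fcoefD fcoefN => h.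
  by apply/eqP; rewrite subr_eq0 eq_sym -subr_eq0; apply/eqP; exact: h.
exists r, Phi; split=> // [sg s s0 osg hs|k sg sg' h j jk]; last first.
  rewrite fcoefD fcoefN !PhiE.
  have := order_ge_mmap_congr (g j.+1) h jk; by rewrite fcoefD fcoefN.
have s0' := ltW s0.
have hP N : tnorm s N (Phi sg) <= M.
  apply: le_trans (h1 N).
  apply: le_trans (tnorm_mmap (g N) (ltW r0) s0' (fun i => hs i N)).
  rewrite !tnormE; apply: ler_sum => k _; apply: ler_wpM2r.
    by rewrite exprn_ge0.
  have /eqP := PhiN sg N osg k (ltn_ord k); rewrite fcoefD fcoefN subr_eq0.
  by move/eqP => ->.
have cP : conv_at s (Phi sg) by exists M.
split=> // t ts.
have cs i : conv_at s (sg i) by exists r; exact: hs.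
have x_le i : `|(\row_i ev (sg i) t) ord0 i| <= r.
  rewrite mxE; exact: ev_le (hs i) (le_half s0' ts).
apply: (tends_unique (tends_cst _)).
apply: (@tends_halves _ _ _ _ (M + M) (h3 _ x_le)) => N.
have -> : (\row_i ev (sg i) t) ord0 = (fun i => ev (sg i) t).
  by apply/funext => i; rewrite mxE.
rewrite -(ev_mmap _ s0' ts cs).
have cm : conv_at s (mmap (@fpsC K) sg (g N)).
  exists M => k; apply: le_trans (h1 N).
  exact: tnorm_mmap (ltW r0) s0' (fun i => hs i k).
have e : ev (Phi sg) t = ev (Phi sg - mmap (@fpsC K) sg (g N)) t +
    ev (mmap (@fpsC K) sg (g N)) t.
  by rewrite -(evD (conv_atD s0' cP (conv_atN cm)) cm (le_half s0' ts)) subrK.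
rewrite e addrK; apply: (ev_order_halves s0' ts (PhiN sg N osg)) => k.
rewrite (le_trans (tnormD _ _ _ s0')) // tnormN lerD //.
apply: le_trans (h1 N); exact: tnorm_mmap (ltW r0) s0' (fun i => hs i k).
Qed.

Lemma tnorm_small_fin n (sg : 'I_n -> fps K) (r : K) : (forall i, sg i \in conv) ->
  (forall i, order_ge 1 (sg i)) -> 0 < r ->
  exists2 s, 0 < s & forall i N, tnorm s N (sg i) <= r.
Proof.
move=> csg osg r0.
apply: pos_min_fin => [i b c b0 bc h N|i]; last exact: tnorm_small.
exact: le_trans (ler_tnorm _ (ltW b0) bc (leqnn N)) (h N).
Qed.

Lemma holo_subst n (f : 'rV[K]_n -> K) (sg : 'I_n -> fps K) : holo f ->
  (forall i, sg i \in conv) -> (forall i, order_ge 1 (sg i)) ->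
  exists2 x, x \in conv & exists2 s, 0 < s & forall t, `|t| <= s ->
    ev x t = f (\row_i ev (sg i) t).
Proof.
move=> /holo_subst_at[r [Phi [r0 hP _]]] csg osg.
have [s s0 hs] := tnorm_small_fin csg osg r0.
have [cP eP] := hP sg s s0 osg hs.
exists (Phi sg); first by apply/convP; exists s.
by exists (s / 2) => //; rewrite divr_gt0 ?ltr0n.
Qed.

Lemma holo_ev (x : fps K) : x \in conv ->
  holo (fun y : 'rV[K]_1 => ev x (y ord0 ord0)).
Proof.
move=> /convP[s s0 xs]; have [M M0 hM] := conv_at_bound (ltW s0) xs.
pose U := @mnm1 1 ord0.
exists s, M, (fun N => \sum_(i < N) x i *: mpolyX K (mnm_muln U i)).
have dU i : mdeg (mnm_muln U i) = i by rewrite mdegMn mdeg1 mul1n.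
split=> //; split=> [N|N|y hy].
- rewrite (le_trans (mnorm_sum _ _ _ (ltW s0))) //; apply: le_trans (hM N).
  rewrite tnormE; apply: ler_sum => i _.
  by rewrite (le_trans (mnormZX _ _ _)) // dU.
- rewrite big_ord_recr /= addrAC subrr add0r -mul_mpolyC; apply: lowMl; apply: lowX.
  by rewrite dU.
- have := ev_tends xs (hy ord0); congr tends; apply/funext => N.
  rewrite psumE raddf_sum; apply: eq_bigr => i _ /=.
  by rewrite mevalZ -mpolyXn rmorphXn /= mevalXU.
Qed.

End Substitution.

Fact division_degrees (d p : nat) : (0 < d)%N -> (d <= p)%N ->
  [/\ (p - d <= p.-1)%N, (p.-1 - (p - d))%N = d.-1 &
      forall j, (p.-1 < j)%N -> (d <= j - (p - d))%N].
Proof. by move=> d0 dp; split; [lia|lia|move=> j; lia]. Qed.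

Lemma monic_division (T : comNzRingType) (S : subringClosed T) (D p : {poly T}) :
  D \is monic -> D \is a polyOver S -> p \is a polyOver S ->
  exists q r, [/\ q \is a polyOver S, r \is a polyOver S, p = q * D + r &
                  (size r < size D)%N].
Proof.
move=> mD DS; have [n] := ubnP (size p); elim: n p => // n IH p; rewrite ltnS => pn pS.
have [pD|Dp] := ltnP (size p) (size D).
  by exists 0, p; rewrite mul0r add0r rpred0.
have D0 : (0 < size D)%N by rewrite size_poly_gt0 monic_neq0.
pose c := lead_coef p; pose k := (size p - size D)%N.
pose p' := p - c *: 'X^k * D.
have cS : c \in S by rewrite /c lead_coefE; apply/polyOverP.
have tS : c *: 'X^k \is a polyOver S by rewrite polyOverZ ?polyOverXn.
have sp : (0 < size p)%N by apply: leq_trans Dp.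
have p'n : (size p' < n)%N.
  apply: leq_trans pn; rewrite -(prednK sp) ltnS; apply/leq_sizeP => j pj.
  have [kp kD kj] := division_degrees D0 Dp.
  rewrite coefB -scalerAl coefZ coefXnM ltnNge (leq_trans kp pj) /=.
  move: pj; rewrite leq_eqVlt => /orP[/eqP <-|pj].
    by rewrite kD -!lead_coefE (eqP mD) mulr1 /c subrr.
  rewrite nth_default; last by rewrite -(prednK sp).
  by rewrite nth_default ?mulr0 ?subrr // kj.
have [|q [r [qS rS e sr]]] := IH p' p'n; first by rewrite rpredB ?rpredM.
exists (q + c *: 'X^k), r; split=> //; first by rewrite rpredD.
by rewrite mulrDl addrAC -e /p' subrK.
Qed.

(** * Linear algebra over the ring of holomorphic functions *)

Section HolRing.
Variable R : realType.
Local Notation K := (C R).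

Definition hol n : {pred ('rV[K]_n -> K)} := fun f => `[< holo f >].
Arguments hol {n}.

Lemma holP n (f : 'rV[K]_n -> K) : reflect (holo f) (f \in hol).
Proof. exact: asboolP. Qed.

Fact hol_subring n : subring_closed (@hol n).
Proof.
split=> [|f g /holP hf /holP hg|f g /holP hf /holP hg]; apply/holP.
- exact: holo_cst.
- exact: holoD hf (holoN hg).
- exact: holoM.
Qed.
HB.instance Definition _ n :=
  GRing.isSubringClosed.Build ('rV[K]_n -> K) (@hol n) (@hol_subring n).

Definition at_pt n (x : 'rV[K]_n) (f : 'rV[K]_n -> K) : K := f x.
Fact at_pt_zmod n x : zmod_morphism (@at_pt n x). Proof. by []. Qed.
Fact at_pt_monoid n x : monoid_morphism (@at_pt n x). Proof. by []. Qed.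
HB.instance Definition _ n x :=
  GRing.isZmodMorphism.Build ('rV[K]_n -> K) K (@at_pt n x) (@at_pt_zmod n x).
HB.instance Definition _ n x :=
  GRing.isMonoidMorphism.Build ('rV[K]_n -> K) K (@at_pt n x) (@at_pt_monoid n x).

(** Being nonzero as a germ: a total function may be nonzero far from 0 and still represent the zero
    germ. *)
Definition nzgerm n (f : 'rV[K]_n -> K) : Prop :=
  forall e : K, 0 < e -> exists2 x : 'rV[K]_n, (forall i, `|x ord0 i| <= e) & f x != 0.

Lemma nnzgerm n (f : 'rV[K]_n -> K) : ~ nzgerm f ->
  exists2 e : K, 0 < e & forall x : 'rV[K]_n, (forall i, `|x ord0 i| <= e) -> f x = 0.
Proof.
move=> h; apply: contrapT => h'; apply: h => e e0; apply: contrapT => h; apply: h'.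
exists e => // x xe; apply: contrapT => /eqP fx; apply: h; by exists x.
Qed.

Lemma det_hol n m (M : 'M['rV[K]_n -> K]_m) :
  (forall i j, M i j \in hol) -> \det M \in hol.
Proof.
by move=> hM; apply: rpred_sum => s _; rewrite rpredMsign; apply: rpred_prod.
Qed.

Lemma det_mxsub_rank (F : fieldType) m r (f g : 'I_r -> 'I_m) (N : 'M[F]_m) :
  \det (mxsub f g N) != 0 -> (r <= \rank N)%N.
Proof.
rewrite -unitfE -unitmxE -row_full_unit => /eqP h.
apply: (@leq_trans (\rank (mxsub f g N))); first by rewrite h.
have -> : mxsub f g N = rowsub f 1%:M *m N *m colsub g 1%:M.
  by rewrite -rowsubE mulmx_colsub mulmx1; apply/matrixP => i j; rewrite !mxE.
exact: leq_trans (mxrankM_maxl _ _) (mxrankM_maxr _ _).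
Qed.

(* Bordering a maximal minor that is not identically zero: the cofactors along
   the additional row form a kernel vector, since the bordered minors vanish. *)
Lemma singular_kernel n m (M : 'M['rV[K]_n -> K]_m) :
  (forall i j, M i j \in hol) -> ~ nzgerm (\det M) ->
  exists w : 'I_m -> 'rV[K]_n -> K,
    [/\ forall j, w j \in hol, exists j, nzgerm (w j) &
        exists2 e : K, 0 < e & forall x : 'rV[K]_n, (forall i, `|x ord0 i| <= e) ->
          forall i, \sum_j M i j x * w j x = 0].
Proof.
move=> hM /nnzgerm[e e0 he].
pose minor_nz r := `[< exists f g : 'I_r -> 'I_m, nzgerm (\det (mxsub f g M)) >].
have ex0 : exists r, minor_nz r.
  exists 0%N; apply/asboolP.
  have f0 : 'I_0 -> 'I_m by case.
  exists f0, f0 => d d0; exists 0 => [i|]; first by rewrite mxE normr0 ltW.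
  by rewrite det_mx00 oner_eq0.
(* At a point of the polydisk where the minor is nonzero while the determinant vanishes, r <= rank <
   m. *)
have le_m r : minor_nz r -> (r <= m.-1)%N /\ (r < m)%N.
  move=> /asboolP[f [g /(_ e e0)[x xe]]].
  rewrite -[\det _ x]/(at_pt x _) -det_map_mx map_mxsub => /det_mxsub_rank rk.
  have : (\rank (map_mx (at_pt x) M) < m)%N.
    rewrite ltn_neqAle rank_leq_row andbT; apply/negP => /eqP full.
    have : row_full (map_mx (at_pt x) M) by apply/eqP.
    by rewrite row_full_unit unitmxE unitfE det_map_mx /= /at_pt he ?eqxx.
  move=> lt_m; have rm := leq_ltn_trans rk lt_m; split=> //.
  by rewrite -ltnS prednK // (leq_ltn_trans _ rm).
have [r /asboolP[f [g nzfg]] rmax] := ex_maxnP ex0 (fun r h => (le_m r h).1).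
have [_ rm] : (r <= m.-1)%N /\ (r < m)%N by apply: le_m; apply/asboolP; exists f, g.
have [j0 hj0] : exists j0, forall k, g k != j0.
  apply: contrapT => h.
  have sub : forall j, j \in codom g.
    move=> j; apply: contrapT => /negP jg; apply: h; exists j => k.
    by apply: contraNneq jg => <-; exact: codom_f.
  have : (m <= r)%N.
    have : (#|'I_m| <= #|codom g|)%N.
      by apply: subset_leq_card; apply/fintype.subsetP => j _; exact: sub.
    by move=> /leq_trans/(_ (card_size _)); rewrite size_codom !card_ord.
  by rewrite leqNgt rm.
pose ext (h : 'I_r -> 'I_m) i0 (k : 'I_r.+1) := oapp h i0 (unlift ord0 k).
have ext0 h i0 : ext h i0 ord0 = i0 by rewrite /ext unlift_none.
have extS h i0 k : ext h i0 (lift ord0 k) = h k by rewrite /ext liftK.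
pose g' := ext g j0.
pose c (k : 'I_r.+1) : 'rV[K]_n -> K :=
  (-1) ^+ k * \det (mxsub f (g' \o lift k) M).
have hc k : c k \in hol.
  by rewrite rpredMsign; apply: det_hol => i j; rewrite mxE.
(* Cofactors are summed over each fiber of [g'], which is not known to be injective. The fiber of
   [j0] is [ord0] alone, so [w j0] is the chosen minor. *)
pose w j : 'rV[K]_n -> K := \sum_(k | g' k == j) c k.
have border i : \det (mxsub (ext f i) g' M) = \sum_k M i (g' k) * c k.
  rewrite (expand_det_row _ ord0); apply: eq_bigr => k _.
  rewrite mxE ext0 /cofactor add0n /c.
  have -> : row' ord0 (col' k (mxsub (ext f i) g' M)) = mxsub f (g' \o lift k) M.
    by apply/matrixP => a b; rewrite !mxE extS.
  by [].
exists w; split.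
- by move=> j; apply: rpred_sum.
- exists j0 => d d0; have [x xd fx] := nzfg d d0; exists x => //.
  have -> : w j0 = \det (mxsub f g M).
    rewrite /w (big_pred1 ord0) /= => [|k].
      rewrite /c expr0 mul1r; congr (\det _); apply/matrixP => a b.
      by rewrite !mxE /= /g' extS.
    rewrite /g'; case: (unliftP ord0 k) => [k' ->|->].
      by rewrite extS (negPf (hj0 k')).
    by rewrite ext0 /= !eqxx.
  exact: fx.
(* By the maximality of [r] every bordered minor vanishes near 0, also when row [i] already occurs
   in [f]. *)
have /choice[d hd] : forall i, exists d : K, 0 < d /\
    forall x : 'rV[K]_n, (forall i, `|x ord0 i| <= d) ->
      \det (mxsub (ext f i) g' M) x = 0.
  move=> i; have [|d d0 hd] := @nnzgerm _ (\det (mxsub (ext f i) g' M)); last by exists d.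
  move=> nz; have /rmax : minor_nz r.+1 by apply/asboolP; exists (ext f i), g'.
  by rewrite ltnn.
have [e' e'0 he'] : exists2 e' : K, 0 < e' & forall i, e' <= d i.
  apply: pos_min_fin => [i a b a0 ab|i]; first exact: le_trans.
  by exists (d i) => //; case: (hd i).
exists e' => // x xe i; have [_ /(_ x)] := hd i.
move=> /(_ (fun k => le_trans (xe k) (he' i))); rewrite border fct_sumE => h.
apply: etrans h.
transitivity (\sum_j \sum_(k | g' k == j) M i j x * c k x).
  by apply: eq_bigr => j _; rewrite /w fct_sumE big_distrr.
rewrite (exchange_big_dep xpredT) //=; apply: eq_bigr => k _.
by rewrite (big_pred1 (g' k)) // => j; rewrite eq_sym.
Qed.

End HolRing.
Arguments hol {R n}.

(** * Weierstrass polynomials *)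

Section Wpoly.
Variables (T : comNzRingType) (m : nat).
Implicit Types b : 'I_m -> T.

(** [monic_at] over any ring; the coefficients will be functions of y, power series in t, or
    numbers. *)
Definition wpoly b : {poly T} := 'X^m + \sum_(i < m) b i *: 'X^i.

Lemma size_wpoly_low b : (size (\sum_(i < m) b i *: 'X^i)%R <= m)%N.
Proof.
rewrite (leq_trans (size_sum _ _ _)) //; apply/bigmax_leqP => i _.
by rewrite (leq_trans (size_scale_leq _ _)) // size_polyXn.
Qed.

Lemma size_wpoly b : size (wpoly b) = m.+1.
Proof. by rewrite size_polyDl ?size_polyXn // ltnS size_wpoly_low. Qed.

Lemma coef_wpoly b (i : 'I_m) : (wpoly b)`_i = b i.
Proof.
rewrite coefD coefXn (ltn_eqF (ltn_ord i)) add0r coef_sum (bigD1 i) //=.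
rewrite coefZ coefXn eqxx mulr1 big1 ?addr0 // => j ji.
rewrite coefZ coefXn (_ : (i == j :> nat) = false) ?mulr0 //.
by apply: contraNF ji => /eqP e; apply/eqP/val_inj.
Qed.

Lemma wpoly_monic b : wpoly b \is monic.
Proof.
rewrite monicE lead_coefE size_wpoly /= coefD coefXn eqxx nth_default ?addr0 //.
exact: size_wpoly_low.
Qed.

Lemma wpoly_over (S : subringClosed T) b : (forall i, b i \in S) ->
  wpoly b \is a polyOver S.
Proof.
move=> bS; rewrite rpredD ?polyOverXn // rpred_sum // => i _.
by rewrite polyOverZ ?polyOverXn.
Qed.

Lemma wpolyE (p : {poly T}) : p \is monic -> size p = m.+1 ->
  p = wpoly (fun i => p`_i).
Proof.
move=> mp sp; apply/polyP => i; have [im|mi] := ltnP i m.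
  by have := coef_wpoly (fun i => p`_i) (Ordinal im) => /= ->.
move: mi; rewrite leq_eqVlt => /orP[/eqP <-|mi].
  move: mp (wpoly_monic (fun i => p`_i)).
  by rewrite !monicE !lead_coefE sp size_wpoly => /eqP -> /eqP ->.
by rewrite !nth_default ?sp ?size_wpoly.
Qed.

End Wpoly.

Lemma map_wpoly (T U : comNzRingType) (f : {rmorphism T -> U}) m (b : 'I_m -> T) :
  map_poly f (wpoly b) = wpoly (fun i => f (b i)).
Proof.
rewrite rmorphD /= map_polyXn rmorph_sum; congr (_ + _); apply: eq_bigr => i _.
by rewrite /= map_polyZ map_polyXn.
Qed.

(** * Divisibility of complex polynomials from bounds and derivatives *)

Section PolyBounds.
Variable K : numClosedFieldType.
Implicit Types (p q : {poly K}) (z : K).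

Lemma root_factors (p : {poly K}) : p \is monic ->
  exists rs : seq K, p = \prod_(r <- rs) ('X - r%:P).
Proof.
move=> mp; have [rs e] := closed_field_poly_normal p.
by exists rs; rewrite {1}e (eqP mp) scale1r.
Qed.

Lemma poly_le_sum (p : {poly K}) (z d : K) : 0 <= d -> `|z| <= d ->
  `|p.[z]| <= \sum_(i < size p) `|p`_i| * d ^+ i.
Proof.
move=> d0 zd; rewrite horner_coef (le_trans (ler_norm_sum _ _ _)) //.
apply: ler_sum => i _; rewrite normrM normrX ler_wpM2l // lerXn2r ?nnegrE //.
Qed.

Lemma wpoly_roots_small m (d : K) : 0 < d -> exists2 e : K, 0 < e &
  forall b : 'I_m -> K, (forall i, `|b i| <= e) ->
    forall z, root (wpoly b) z -> `|z| < d.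
Proof.
move=> d0; have [c c0 [cd c1]] := pos_min d0 ltr01.
(* If c <= |z| with c <= 1, then c^m |z|^i <= |z|^m, and a root z would give 1 <= m/(m+1). *)
pose e := c ^+ m / (m.+1)%:R.
have e0 : 0 < e by rewrite divr_gt0 ?exprn_gt0 ?ltr0n.
exists e => // b be z rz; apply: lt_le_trans cd.
rewrite real_ltNge ?normr_real ?gtr0_real //; apply/negP => cz.
have z0 : 0 < `|z| by apply: lt_le_trans cz.
have bound : `|z| ^+ m <= \sum_(i < m) e * `|z| ^+ i.
  move: rz; rewrite /root /wpoly hornerD hornerXn horner_sum addr_eq0 => /eqP zE.
  rewrite -normrX zE normrN (le_trans (ler_norm_sum _ _ _)) // ler_sum // => i _.
  by rewrite hornerZ hornerXn normrM normrX ler_wpM2r ?exprn_ge0.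
have : c ^+ m * `|z| ^+ m <= \sum_(i < m) e * `|z| ^+ m.
  apply: (@le_trans _ _ (c ^+ m * \sum_(i < m) e * `|z| ^+ i)).
    by rewrite ler_wpM2l ?exprn_ge0 ?(ltW c0).
  rewrite big_distrr; apply: ler_sum => i _ /=; rewrite mulrCA ler_wpM2l ?(ltW e0) //.
  have im := ltnW (ltn_ord i); rewrite -[in `|z| ^+ m](subnK im) exprD ler_wpM2r ?exprn_ge0 //.
  apply: (@le_trans _ _ (c ^+ (m - i))).
    by rewrite ler_wiXn2l ?(ltW c0) ?leq_subr.
  by rewrite lerXn2r ?nnegrE ?(ltW c0).
rewrite sumr_const card_ord -[_ *+ m]mulr_natl mulrA.
rewrite ler_pM2r ?exprn_gt0 // /e mulrCA.
rewrite -[X in X <= _]mulr1 ler_pM2l ?exprn_gt0 //.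
by rewrite ler_pdivlMr ?ltr0n // mul1r ler_nat ltnn.
Qed.

(** If V(r) were nonzero, the bound at points z near r would give |V(r)| <= c |z - r|, and z can
    approach r outside the finite set [B]. *)
Lemma root_of_le (V P : {poly K}) (M d r : K) (B : seq K) : 0 <= M -> `|r| < d ->
  root P r -> (forall z, `|z| <= d -> z \notin B -> `|V.[z]| <= M * `|P.[z]|) ->
  root V r.
Proof.
move=> M0 rd /factor_theorem[P1 PE] h; apply: contrapT => /negP Vr.
have d0 : 0 < d by apply: le_lt_trans rd.
have : root (V - (V.[r])%:P) r by rewrite /root !hornerE subrr.
move=> /factor_theorem[V1 VE].
pose N (p : {poly K}) := \sum_(i < size p) `|p`_i| * d ^+ i.
have N0 p : 0 <= N p by apply: sumr_ge0 => i _; rewrite mulr_ge0 ?exprn_ge0 ?(ltW d0).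
pose c := M * N P1 + N V1 + 1.
have c0 : 0 < c by rewrite ltr_wpDl // addr_ge0 // mulr_ge0.
have Vr0 : 0 < `|V.[r]| by rewrite normr_gt0.
have dr0 : 0 < d - `|r| by rewrite subr_gt0.
have [eta eta0 [eta1 eta2]] := pos_min dr0 (divr_gt0 Vr0 c0).
(* One point more than [B] has entries, all within [eta] of r: at least one lies outside [B]. *)
pose zs := [seq r + eta / k.+2%:R | k <- iota 0 (size B).+1].
have uzs : uniq zs.
  rewrite map_inj_uniq ?iota_uniq // => k l /addrI /(mulfI (lt0r_neq0 eta0)) /invr_inj /eqP.
  by rewrite eqr_nat => /eqP [].
have [z zzs zB] : exists2 z, z \in zs & z \notin B.
  apply: contrapT => hz; have : {subset zs <= B}.
    by move=> z zz; apply: contrapT => /negP zB; apply: hz; exists z.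
  by move=> /(uniq_leq_size uzs); rewrite size_map size_iota ltnn.
have [k _ zE] := mapP zzs.
have k2 : 0 < k.+2%:R :> K by rewrite ltr0n.
have zr : `|z - r| = eta / k.+2%:R.
  by rewrite zE addrC addKr ger0_norm // divr_ge0 // ?(ltW eta0) ?(ltW k2).
have zr_lt : `|z - r| < eta by rewrite zr ltr_pdivrMr // ltr_pMr // ltr1n.
have zd : `|z| <= d.
  rewrite -[z](subrK r) (le_trans (ler_normD _ _)) // -lerBrDr.
  exact: le_trans (ltW zr_lt) eta1.
have hz := h z zd zB.
have : `|V.[r]| <= c * `|z - r|.
  have -> : V.[r] = V.[z] - V1.[z] * (z - r).
    have -> : V.[z] = (V - (V.[r])%:P).[z] + V.[r] by rewrite hornerD hornerN hornerC subrK.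
    by rewrite VE hornerM hornerXsubC addrC addKr.
  rewrite (le_trans (ler_normB _ _)) // /c !mulrDl mul1r ler_wpDr // lerD //.
    rewrite (le_trans hz) // PE hornerM hornerXsubC normrM mulrA.
    by rewrite ler_wpM2r // ler_wpM2l // poly_le_sum // ltW.
  by rewrite normrM ler_wpM2r // poly_le_sum // ltW.
move=> hc; have : `|V.[r]| < `|V.[r]|.
  apply: le_lt_trans hc _; rewrite mulrC -ltr_pdivlMr //.
  exact: lt_le_trans zr_lt eta2.
by rewrite ltxx.
Qed.

(** One root is removed at a time. Dividing both sides by |z - r| loses the bound at r itself, which
    is why the exceptional list [B] grows. *)
Lemma dvd_of_le (rs : seq K) (V : {poly K}) (M d : K) (B : seq K) : 0 <= M ->
  (forall r, r \in rs -> `|r| < d) ->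
  (forall z, `|z| <= d -> z \notin B ->
     `|V.[z]| <= M * `|(\prod_(r <- rs) ('X - r%:P)).[z]|) ->
  \prod_(r <- rs) ('X - r%:P) %| V.
Proof.
move=> M0; elim: rs V B => [|r rs IH] V B rd h; first by rewrite big_nil dvd1p.
have rV : root V r.
  apply: root_of_le M0 (rd r (mem_head _ _)) _ h.
  by rewrite big_cons rootM root_XsubC eqxx.
have [V1 VE] := factor_theorem V r rV.
rewrite big_cons VE mulrC dvdp_mul // (IH V1 (r :: B)) // => [s srs|z zd].
  by apply: rd; rewrite inE srs orbT.
rewrite inE negb_or => /andP[zr zB]; have := h z zd zB.
rewrite VE big_cons !hornerM hornerXsubC !normrM mulrC mulrCA ler_pM2l //.
by rewrite normr_gt0 subr_eq0.
Qed.

(** In characteristic 0 the multiplicity of r in P' is one less than in P, so v must supply the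
    missing factor. *)
Lemma root_of_dvd_deriv (P v : {poly K}) r : P != 0 -> root P r ->
  P %| v * P^`() -> root v r.
Proof.
move=> P0 rP PvP'; have [k [B + PE]] := multiplicity_XsubC P r.
rewrite P0 /= => rB.
have k0 : (0 < k)%N.
  by case: k PE => // PE; move: rP; rewrite PE expr0 mulr1 (negPf rB).
rewrite -(prednK k0) in PE; set j := k.-1 in PE.
pose W := B^`() * ('X - r%:P) + B *+ j.+1.
have P'E : P^`() = W * ('X - r%:P) ^+ j.
  rewrite PE derivM deriv_exp derivXsubC mul1r /W mulrDl exprS mulrA.
  by rewrite mulrnAr mulrnAl.
have : 'X - r%:P %| v * W.
  have : ('X - r%:P) ^+ j.+1 %| v * P^`().
    by apply: dvdp_trans PvP'; rewrite PE dvdp_mull.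
  rewrite P'E mulrA exprS dvdp_mul2r //.
  by rewrite expf_neq0 // polyXsubC_eq0.
rewrite dvdp_XsubCl rootM => /orP[//|].
rewrite /W /root hornerD hornerM hornerXsubC subrr mulr0 add0r hornerMn.
rewrite mulrn_eq0 /= => rB'; by move: rB; rewrite /root rB'.
Qed.

Lemma dvd_pow_of_dvd_deriv (P v : {poly K}) m : P \is monic -> size P = m.+1 ->
  P %| v * P^`() -> P %| v ^+ m.
Proof.
move=> mP sP PvP'; have [rs PE] := root_factors mP.
have srs : size rs = m by move: sP; rewrite PE size_prod_XsubC => -[].
have rv r : r \in rs -> 'X - r%:P %| v.
  move=> rrs; rewrite dvdp_XsubCl; apply: root_of_dvd_deriv PvP'.
    exact: monic_neq0.
  by rewrite PE root_prod_XsubC.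
rewrite PE -srs; elim: (rs) rv => [|r s IH] rv; first by rewrite big_nil dvd1p.
rewrite big_cons /= exprS dvdp_mul //; first by apply: rv; rewrite mem_head.
by apply: IH => t ts; apply: rv; rewrite inE ts orbT.
Qed.

End PolyBounds.

Fact size_cofactor (m v g : nat) : m.+1 = (v + g).-1 -> (1 < g)%N -> (v <= m)%N.
Proof. lia. Qed.

(** * Generic separability of a reduced Weierstrass polynomial *)

Section Discriminant.
Variable R : realType.
Local Notation K := (C R).

Definition join12 (y : 'rV[K]_2) (z : K) : 'rV[K]_3 :=
  \row_(i < 3) (if i == ord_max then z else y ord0 (inord i)).

Lemma proj12_join12 y z : proj12 (join12 y z) = y.
Proof.
apply/rowP => j; rewrite !mxE.
have -> : (widen_ord (leqnSn 2) j == ord_max) = false.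
  by apply/eqP => /(congr1 val) /= e; have := ltn_ord j; rewrite e ltnn.
by congr (y _ _); apply/val_inj; rewrite /= inordK.
Qed.

Lemma join12_max y z : join12 y z ord0 ord_max = z.
Proof. by rewrite mxE eqxx. Qed.

Lemma join12_eta x : join12 (proj12 x) (x ord0 ord_max) = x.
Proof.
apply/rowP => j; rewrite mxE; case: eqP => [->//|nj].
have jlt : (j < 2)%N.
  have := ltn_ord j; rewrite ltnS leq_eqVlt => /orP[/eqP e|//].
  by case: nj; apply: val_inj.
by rewrite mxE; congr (x _ _); apply: val_inj; rewrite /= inordK.
Qed.

Lemma join12_le (y : 'rV[K]_2) (z e : K) : (forall i, `|y ord0 i| <= e) -> `|z| <= e ->
  forall i, `|join12 y z ord0 i| <= e.
Proof. by move=> ye ze i; rewrite mxE; case: ifP. Qed.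

Lemma proj12_mx : exists B : 'M[K]_(3, 2), forall x : 'rV[K]_3, proj12 x = x *m B.
Proof.
exists (colsub (widen_ord (leqnSn 2)) 1%:M) => x.
by rewrite mulmx_colsub mulmx1; apply/rowP => j; rewrite !mxE.
Qed.

Lemma mulmx_le n k (A : 'M[K]_(n, k)) (e : K) : 0 < e -> exists2 d : K, 0 < d &
  forall x : 'rV[K]_n, (forall i, `|x ord0 i| <= d) ->
    forall j, `|(x *m A) ord0 j| <= e.
Proof.
move=> e0; pose B := 1 + \sum_(j < k) \sum_(i < n) `|A i j|.
have B0 : 0 < B by rewrite ltr_pwDl // !sumr_ge0 // => i _; apply: sumr_ge0.
exists (e / B) => [|x hx j]; first by rewrite divr_gt0.
rewrite mxE (le_trans (ler_norm_sum _ _ _)) //.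
apply: (@le_trans _ _ (e / B * \sum_(i < n) `|A i j|)).
  rewrite big_distrr; apply: ler_sum => i _ /=.
  by rewrite normrM ler_wpM2r.
rewrite mulrAC ler_pdivrMr // ler_wpM2l ?(ltW e0) //.
rewrite /B (bigD1 j) //= addrCA lerDl addr_ge0 // sumr_ge0 // => i _.
exact: sumr_ge0.
Qed.

Lemma holoXn n (f : 'rV[K]_n -> K) k : holo f -> holo (fun x => f x ^+ k).
Proof.
move=> hf; elim: k => [|k IH].
  have -> : (fun x => f x ^+ 0) = (fun=> 1) by apply/funext => x; rewrite expr0.
  exact: holo_cst.
have -> : (fun x => f x ^+ k.+1) = (fun x => f x * f x ^+ k).
  by apply/funext => x; rewrite exprS.
exact: holoM.
Qed.

Lemma holo_poly_family (B : 'M[K]_3) (q : {poly ('rV[K]_2 -> K)}) :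
  q \is a polyOver hol ->
  holo (fun x : 'rV[K]_3 =>
    (map_poly (at_pt (proj12 (x *m B))) q).[(x *m B) ord0 ord_max]).
Proof.
move=> qh; have [Pr PrE] := proj12_mx.
suff : (fun x : 'rV[K]_3 =>
    (map_poly (at_pt (proj12 (x *m B))) q).[(x *m B) ord0 ord_max]) \in hol.
  by move/holP.
have -> : (fun x : 'rV[K]_3 =>
    (map_poly (at_pt (proj12 (x *m B))) q).[(x *m B) ord0 ord_max]) =
  \sum_(i < size q) (fun x : 'rV[K]_3 => q`_i (x *m (B *m Pr))) *
     (fun x : 'rV[K]_3 => (x *m B) ord0 ord_max) ^+ i.
  apply/funext => x; rewrite (@horner_coef_wide _ (size q)) ?size_poly //.
  rewrite fct_sumE; apply: eq_bigr => i _; rewrite coef_map.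
  by rewrite -[RHS]/(at_pt x (_ * _)) rmorphM rmorphXn /= PrE -mulmxA.
apply: rpred_sum => i _; apply: rpredM.
  by apply/holP; apply: holo_linear; apply/holP; apply/polyOverP.
apply: rpredX; apply/holP.
exact: (holo_linear B (holo_coord R (ord_max : 'I_3))).
Qed.

Section Family.
Variables (m : nat) (a : 'I_m -> 'rV[K]_2 -> K).
Hypothesis a_holo : forall i, holo (a i).

Let P : {poly ('rV[K]_2 -> K)} := wpoly a.

Lemma map_family y : map_poly (at_pt y) P = monic_at a y.
Proof. exact: map_wpoly. Qed.

Lemma family_over : P \is a polyOver hol.
Proof. by apply: wpoly_over => i; apply/holP. Qed.

Lemma monic_at_monic y : monic_at a y \is monic.
Proof. exact: wpoly_monic. Qed.

Lemma size_monic_at y : size (monic_at a y) = m.+1.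
Proof. exact: size_wpoly. Qed.

(** The matrix of multiplication by P' modulo P in the basis of powers of X. P is monic, so division
    with holomorphic coefficients is possible and commutes with evaluation at y. *)
Lemma deriv_mulmod_matrix : exists M : 'M['rV[K]_2 -> K]_m,
  (forall i j, M i j \in hol) /\
  forall (v : 'I_m -> K) y, (monic_at a y %| (\sum_j v j *: 'X^j) * (monic_at a y)^`()) <->
    (forall i, \sum_j M i j y * v j = 0).
Proof.
have mP : P \is monic by exact: wpoly_monic.
have /choice[QR hQR] : forall j : 'I_m, exists QR : {poly ('rV[K]_2 -> K)} * {poly ('rV[K]_2 -> K)},
    [/\ QR.2 \is a polyOver hol, 'X^j * P^`() = QR.1 * P + QR.2 &
        (size QR.2 <= m)%N].
  move=> j; have h : 'X^j * P^`() \is a polyOver hol.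
    by rewrite rpredM ?polyOverXn ?polyOver_deriv ?family_over.
  have [q [r [qh rh e sr]]] := monic_division mP family_over h.
  by exists (q, r); split=> //; rewrite -ltnS -(size_wpoly a).
exists (\matrix_(i, j) ((QR j).2)`_i); split.
  by move=> i j; rewrite mxE; have [/polyOverP] := hQR j.
move=> v y.
pose r := \sum_j v j *: map_poly (at_pt y) (QR j).2.
have e : (\sum_j v j *: 'X^j) * (monic_at a y)^`() =
    (\sum_j v j *: map_poly (at_pt y) (QR j).1) * monic_at a y + r.
  rewrite !big_distrl -big_split; apply: eq_bigr => j _ /=.
  rewrite -!scalerAl -scalerDr; congr (_ *: _); have [_ ej _] := hQR j.
  rewrite -map_family deriv_map -(map_polyXn (at_pt y)) -rmorphM /= ej.
  by rewrite rmorphD rmorphM.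
have ri (i : 'I_m) : r`_i = \sum_j (\matrix_(i, j) ((QR j).2)`_i) i j y * v j.
  rewrite coef_sum; apply: eq_bigr => j _.
  by rewrite coefZ coef_map mxE mulrC.
have sr : (size r <= m)%N.
  rewrite (leq_trans (size_sum _ _ _)) //; apply/bigmax_leqP => j _.
  rewrite (leq_trans (size_scale_leq _ _)) // (leq_trans (size_poly _ _)) //.
  by have [] := hQR j.
rewrite e dvdp_addr ?dvdp_mull //; split=> [Pr i|h].
  rewrite -ri; have [->|rn0] := eqVneq r 0; first by rewrite coef0.
  have := dvdp_leq rn0 Pr; rewrite size_monic_at => /leq_trans/(_ sr).
  by rewrite ltnn.
suff -> : r = 0 by exact: dvdp0.
apply/polyP => i; rewrite coef0; have [im|mi] := ltnP i m.
  by have := ri (Ordinal im) => /= ->.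
by rewrite nth_default // (leq_trans sr).
Qed.

Lemma coef_sumX (v : 'I_m -> K) (i : 'I_m) : (\sum_j v j *: 'X^j)`_i = v i.
Proof.
have := coef_wpoly v i; rewrite /wpoly coefD coefXn (ltn_eqF (ltn_ord i)).
by rewrite add0r.
Qed.

Variables (F : 'rV[K]_3 -> K) (pi : 'rV[K]_3 -> 'rV[K]_2) (A : 'M[K]_3).
Hypothesis F_reduced : reduced_equation F.
Hypothesis F_form : weierstrass_form F pi A a.

(* If P divides v P', then P divides v^m; so v is nilpotent modulo F, F being
   reduced divides v up to a unit, and P divides v, whose degree is too small. *)
Lemma no_kernel (w : 'I_m -> 'rV[K]_2 -> K) (j0 : 'I_m) :
  (forall j, w j \in hol) -> nzgerm (w j0) ->
  ~ exists2 e : K, 0 < e & forall y : 'rV[K]_2, (forall i, `|y ord0 i| <= e) ->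
      monic_at a y %| (\sum_j w j y *: 'X^j) * (monic_at a y)^`().
Proof.
move=> wh wnz [e e0 he].
have [Au piA a0 [u [/germ_holo uh u0 Fu]]] := F_form.
have [_ _ _ red] := F_reduced.
have mP : P \is monic by exact: wpoly_monic.
pose v : {poly ('rV[K]_2 -> K)} := \sum_j w j *: 'X^j.
have vh : v \is a polyOver hol.
  by apply: rpred_sum => j _; rewrite polyOverZ ?polyOverXn.
have vy y : map_poly (at_pt y) v = \sum_j w j y *: 'X^j.
  by rewrite rmorph_sum; apply: eq_bigr => j _; rewrite /= map_polyZ map_polyXn.
(* Division is done over the ring of functions, so that the quotient is holomorphic in y. The
   remainder vanishes in each fiber, where P divides v^m. *)
have [H [Rm [Hh Rh vE sR]]] := monic_division mP family_over (rpredX m vh).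
have vPH (y : 'rV[K]_2) : (forall i, `|y ord0 i| <= e) ->
    map_poly (at_pt y) v ^+ m = map_poly (at_pt y) H * monic_at a y.
  move=> ye; have := congr1 (map_poly (at_pt y)) vE.
  rewrite rmorphXn rmorphD rmorphM /= map_family => vyE; rewrite vyE.
  suff -> : map_poly (at_pt y) Rm = 0 by rewrite addr0.
  have : monic_at a y %| map_poly (at_pt y) Rm.
    rewrite -(dvdp_addr (m := map_poly (at_pt y) H * monic_at a y)) ?dvdp_mull // -vyE.
    apply: dvd_pow_of_dvd_deriv (size_monic_at y) _; first exact: monic_at_monic.
    by rewrite vy; exact: he.
  have [->//|Rn0] := eqVneq (map_poly (at_pt y) Rm) 0.
  move=> /(dvdp_leq Rn0); rewrite size_monic_at leqNgt.
  by rewrite (leq_ltn_trans (size_poly _ _)) // -(size_wpoly a).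
pose B := invmx A.
have BK (x : 'rV[K]_3) : x *m B *m A = x by rewrite mulmxKV.
pose U (x : 'rV[K]_3) := u (x *m B).
have Uh : holo U by exact: holo_linear.
pose V (x : 'rV[K]_3) := (map_poly (at_pt (proj12 (x *m B))) v).[(x *m B) ord0 ord_max].
have Vh : holo V by exact: holo_poly_family.
pose Hx (x : 'rV[K]_3) := (map_poly (at_pt (proj12 (x *m B))) H).[(x *m B) ord0 ord_max].
have Hxh : holo Hx by exact: holo_poly_family.
pose Px (x : 'rV[K]_3) := (monic_at a (proj12 (x *m B))).[(x *m B) ord0 ord_max].
move/nbhs_rV0: Fu => [e1 e10 hF].
have [e2 e20 hu] := holo_continuous0 uh (divr_gt0 (etrans (normr_gt0 _) u0) (ltr0Sn _ 1)).
have un0 (x : 'rV[K]_3) : (forall i, `|x ord0 i| <= e2) -> u x != 0.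
  move=> /hu h; apply/eqP => ux; move: h; rewrite ux sub0r normrN.
  by rewrite ler_pdivlMr ?ltr0n // mulr_natr gerDl normr_le0 (negPf u0).
have [e3 e30 [e31 e32]] := pos_min e10 e20.
have [e4 e40 [e43 e4e]] := pos_min e30 e0.
have [d d0 hd] := mulmx_le B e40.
have FE (x : 'rV[K]_3) : (forall i, `|x ord0 i| <= d) -> F x = U x * Px x.
  move=> /hd hx; rewrite -{1}(BK x) hF // => i.
  exact: le_trans (hx i) (le_trans e43 e31).
(* Degree 0 would make F a unit at the origin, where it vanishes. *)
have [mm0|mm0] := posnP m.
  have [_ F0 _ _] := F_reduced; have := hF 0; rewrite mul0mx F0.
  have h0 : forall i, `|(0 : 'rV[K]_3) ord0 i| <= e1.
    by move=> i; rewrite mxE normr0 ltW.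
  move=> /(_ h0) /esym/eqP; rewrite mulf_eq0 (negPf u0) /=.
  have s1 : size (monic_at a (proj12 (0 : 'rV[K]_3))) = 1%N.
    by rewrite size_monic_at mm0.
  have m1 := monic_at_monic (proj12 (0 : 'rV[K]_3)).
  move: m1; rewrite monicE lead_coefE s1 /= => /eqP c1.
  by rewrite [monic_at _ _]size1_polyC ?s1 // c1 hornerC oner_eq0.
(* From F = U P and v^m = H P follows (U v)^m = F U^(m-1) H; reducedness then gives U v = F q. *)
have [q qh /nbhs_rV0[e5 e50 hq]] : exists2 q, holomorphic_germ q &
    fgerm_eq (fun x => U x * V x) (fun x => F x * q x).
  apply: (red _ (fun x => U x ^+ m.-1 * Hx x) m).
  - by apply: holo_germ; exact: holoM.
  - apply: holo_germ; apply: holoM => //; exact: holoXn.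
  - apply/nbhs_rV0; exists d => // x xd; rewrite FE // exprMn -[in LHS](prednK mm0).
    rewrite exprS -/(Px x) (_ : V x ^+ m.-1.+1 = Hx x * Px x); first by ring.
    rewrite prednK // /V -horner_exp vPH ?hornerM // => i.
    have := hd x xd; have [Pr PrE] := proj12_mx.
    move=> h; rewrite mxE; exact: le_trans (h _) e4e.
have [e6 [Mq [e60 Mq0 hMq]]] := holo_bounded (germ_holo qh).
have [e7 e70 [e75 e7d]] := pos_min e50 d0.
have [e8 e80 [e87 e86]] := pos_min e70 e60.
have [d1 d10 hd1] := mulmx_le A e80.
(* Cancelling the unit leaves v = P q with q bounded. *)
have key (y : 'rV[K]_2) (z : K) : (forall i, `|y ord0 i| <= d1) -> `|z| <= d1 ->
    `|(map_poly (at_pt y) v).[z]| <= Mq * `|(monic_at a y).[z]|.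
  move=> yd zd; pose x := join12 y z *m A.
  have xB : x *m B = join12 y z by rewrite /x mulmxK.
  have xle i : `|x ord0 i| <= e8 by apply: hd1; exact: join12_le.
  have := hq x (fun i => le_trans (xle i) (le_trans e87 e75)).
  rewrite FE; last by move=> i; exact: le_trans (xle i) (le_trans e87 e7d).
  have xn0 : U x != 0.
    apply: un0 => i; have := hd x (fun i => le_trans (xle i) (le_trans e87 e7d)) i.
    by move=> h; exact: le_trans h (le_trans e43 e32).
  rewrite -mulrA => /(mulfI xn0); rewrite /V /Px xB proj12_join12 join12_max => ->.
  rewrite normrM mulrC ler_wpM2r //; apply: hMq => i.
  exact: le_trans (xle i) e86.
(* For y close to 0 all roots of the fiber polynomial lie in the disk on which the bound [key]
   holds; [dvd_of_le] then applies with an empty exceptional list. *)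
have [e9 e90 hroots] := wpoly_roots_small m d10.
have /choice[da hda] : forall i : 'I_m, exists da : K, 0 < da /\
    forall y : 'rV[K]_2, (forall k, `|y ord0 k| <= da) -> `|a i y| <= e9.
  move=> i; have [_ ai0] := a0 i.
  have [da da0 h] := holo_continuous0 (a_holo i) e90.
  by exists da; split=> // y /h; rewrite ai0 subr0.
have [d2 d20 hd2] : exists2 d2 : K, 0 < d2 & forall i, d2 <= da i.
  apply: pos_min_fin => [i b c b0 bc|i]; first exact: le_trans.
  by exists (da i) => //; case: (hda i).
have [d3 d30 [d32 d31]] := pos_min d20 d10.
have [y yd wy] := wnz d3 d30.
have [rs PE] := root_factors (monic_at_monic y).
have Pv : monic_at a y %| map_poly (at_pt y) v.
  rewrite PE; apply: (@dvd_of_le _ _ _ Mq d1 [::] Mq0) => [r rrs|z zd _].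
    apply: (hroots (fun i => a i y)) => [i|].
      by have [_] := hda i; apply => k; exact: le_trans (yd k) (le_trans d32 (hd2 i)).
    have : root (monic_at a y) r by rewrite PE root_prod_XsubC.
    by [].
  by rewrite -PE; apply: key => // i; exact: le_trans (yd i) d31.
have v0 : map_poly (at_pt y) v = 0.
  apply/eqP; apply: contraTT Pv => vn0; apply/negP => /(dvdp_leq vn0).
  rewrite size_monic_at leqNgt ltnS vy => /negP; apply.
  rewrite (leq_trans (size_sum _ _ _)) //; apply/bigmax_leqP => i _.
  by rewrite (leq_trans (size_scale_leq _ _)) // size_polyXn.
by move: wy; rewrite -(coef_sumX (fun j => w j y)) -vy v0 coef0 eqxx.
Qed.

(** The witness is the determinant of multiplication by P' modulo P, which is the resultant of P and
    P' in another guise. That it is nonzero as a germ is the content of [no_kernel]. *)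
Lemma separable_locus : exists E : 'rV[K]_2 -> K,
  [/\ holo E, nzgerm E & forall y, E y != 0 ->
      coprimep (monic_at a y) (monic_at a y)^`()].
Proof.
have [M [Mh hM]] := deriv_mulmod_matrix.
exists (\det M); split.
- by apply/holP; exact: det_hol.
- apply: contrapT => /(singular_kernel Mh)[w [wh [j0 wnz] [e e0 he]]].
  apply: (no_kernel wh wnz); exists e => // y ye.
  by apply/hM; exact: he.
- move=> y; apply: contraNT => ncop.
  rewrite -[\det M y]/(at_pt y (\det M)) -det_map_mx -det_tr.
  set p := monic_at a y in ncop *.
  have p0 : p != 0 by rewrite monic_neq0 // monic_at_monic.
  (* A common factor of P and P' yields the kernel vector P / gcd(P, P'), whose degree is less than
     [m]. *)
  pose g := gcdp p p^`(); pose v := p %/ g.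
  have pE : p = v * g by rewrite divpK // dvdp_gcdl.
  have g0 : g != 0 by rewrite gcdp_eq0 (negPf p0).
  have v0 : v != 0 by apply: contraNneq p0 => v0; rewrite pE v0 mul0r.
  have sv : (size v <= m)%N.
    have : (1 < size g)%N.
      rewrite ltn_neqAle size_poly_gt0 g0 andbT eq_sym.
      by move: ncop; rewrite /coprimep.
    have := congr1 (fun q : {poly K} => size q) pE.
    rewrite size_mul // size_monic_at; exact: size_cofactor.
  have pv : p %| v * p^`().
    have -> : p^`() = (p^`() %/ g) * g by rewrite divpK // dvdp_gcdr.
    by rewrite mulrCA -pE dvdp_mull.
  have vX : v = \sum_(j < m) v`_j *: 'X^j.
    rewrite -poly_def; apply/polyP => i; rewrite coef_poly; case: ltnP => // mi.
    by rewrite nth_default // (leq_trans sv).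
  apply/det0P; exists (\row_j v`_j).
    apply: contraNneq v0 => r0; rewrite vX big1 // => j _.
    by have := congr1 (fun r : 'rV[K]_m => r ord0 j) r0; rewrite !mxE => ->; rewrite scale0r.
  apply/rowP => i; rewrite !mxE -[RHS]((hM (fun j => v`_j) y).1 _ i).
    by apply: eq_bigr => j _; rewrite !mxE mulrC.
  by rewrite -vX.
Qed.

End Family.
End Discriminant.

(** * The roots over a tangential arc *)

(* Closure properties of [conv], restated over [C R]: unifying them with their
   generic versions over a [numFieldType] is expensive. *)
Section ConvC.
Variable R : realType.
Local Notation K := (C R).
Implicit Types x y : fps K.

Lemma convD x y : x \in conv -> y \in conv -> x + y \in conv.
Proof. exact: rpredD. Qed.
Lemma convN x : x \in conv -> - x \in conv.
Proof. by move=> cx; rewrite rpredN. Qed.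
Lemma convB x y : x \in conv -> y \in conv -> x - y \in conv.
Proof. by move=> cx cy; exact: convD cx (convN cy). Qed.
Lemma convM x y : x \in conv -> y \in conv -> x * y \in conv.
Proof. exact: rpredM. Qed.
Lemma convXn n : fpsX K ^+ n \in conv.
Proof. by elim: n => [|n IH]; [exact: convC 1|rewrite exprS; exact: convM (convX K) IH]. Qed.
Lemma conv_wpoly m (b : 'I_m -> fps K) : (forall i, b i \in conv) ->
  wpoly b \is a polyOver conv.
Proof. exact: wpoly_over. Qed.
Lemma conv_horner (p : {poly fps K}) x : p \is a polyOver conv -> x \in conv ->
  p.[x] \in conv.
Proof. exact: rpred_horner. Qed.
Lemma conv_deriv (p : {poly fps K}) : p \is a polyOver conv ->
  p^`() \is a polyOver conv.
Proof. exact: polyOver_deriv. Qed.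
Lemma conv_fsubm q x : x \in conv -> fsubm q x \in conv.
Proof. exact: fsubm_conv. Qed.
End ConvC.

(** * Identities valid for all small parameters *)

Section NearZero.
Variable R : realType.
Local Notation K := (C R).
Implicit Types (P Q : K -> Prop) (x y : fps K).

Definition near0 P := exists2 s : K, 0 < s & forall t, `|t| <= s -> P t.

Lemma near0I P Q : near0 P -> near0 Q -> near0 (fun t => P t /\ Q t).
Proof.
move=> [s s0 hs] [s' s'0 hs']; have [c c0 [cs cs']] := pos_min s0 s'0.
by exists c => // t tc; split; [apply: hs|apply: hs']; apply: le_trans tc _.
Qed.

Lemma near0_mono P Q : (forall t, P t -> Q t) -> near0 P -> near0 Q.
Proof. by move=> PQ [s s0 hs]; exists s => // t /hs /PQ. Qed.

Lemma near0_fin (I : finType) (P : I -> K -> Prop) :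
  (forall i, near0 (P i)) -> near0 (fun t => forall i, P i t).
Proof.
move=> h; have [s s0 hs] : exists2 s : K, 0 < s & forall i t, `|t| <= s -> P i t.
  apply: pos_min_fin => [i a b a0 ab hb t ta|i]; last exact: h.
  by apply: hb; apply: le_trans ab.
by exists s => // t ts i; apply: hs.
Qed.

Lemma near0_nz P : near0 P -> exists2 t, t != 0 & P t.
Proof.
move=> [s s0 hs]; exists s; first by rewrite gt_eqF.
by apply: hs; rewrite gtr0_norm.
Qed.

Lemma near0_pow P q : (0 < q)%N -> near0 P -> near0 (fun t => P (t ^+ q)).
Proof.
move=> q0 [s s0 hs]; have [c c0 [cs c1]] := pos_min s0 ltr01.
exists c => // t tc; have t1 := le_trans tc c1; apply: hs; rewrite normrX.
apply: le_trans cs; apply: le_trans tc; case: q q0 => // q _.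
by rewrite exprS ler_piMr // exprn_ile1.
Qed.

Lemma near0_evD x y : x \in conv -> y \in conv ->
  near0 (fun t => ev (x + y) t = ev x t + ev y t).
Proof.
move=> cx cy; have [s s0 [xs ys]] := conv_common cx cy.
by exists s => // t ts; rewrite (evD xs ys).
Qed.

Lemma near0_evM x y : x \in conv -> y \in conv ->
  near0 (fun t => ev (x * y) t = ev x t * ev y t).
Proof.
move=> cx cy; have [s s0 [xs ys]] := conv_common cx cy.
exists (s / 2) => [|t ts]; first by rewrite divr_gt0 ?ltr0n.
by rewrite (evM xs ys (ltW s0) ts).
Qed.

Lemma near0_evN x : x \in conv -> near0 (fun t => ev (- x) t = - ev x t).
Proof.
move=> cx; apply: near0_mono (near0_evM (convC (- 1 : K)) cx) => t.
by rewrite evC rmorphN rmorph1 !mulN1r.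
Qed.

Lemma near0_evB x y : x \in conv -> y \in conv ->
  near0 (fun t => ev (x - y) t = ev x t - ev y t).
Proof.
move=> cx cy; have cNy := convN cy.
by apply: near0_mono (near0I (near0_evD cx cNy) (near0_evN cy)) => t [-> ->].
Qed.

Lemma near0_evXn n : near0 (fun t => ev (fpsX K ^+ n) t = t ^+ n).
Proof.
exists (1 / 2) => [|t ts]; first by rewrite divr_gt0 ?ltr0n.
by rewrite (evXn _ (conv_atX ler01) ler01 ts) evX.
Qed.

Lemma near0_horner (p : {poly fps K}) x : p \is a polyOver conv -> x \in conv ->
  near0 (fun t => ev p.[x] t = (map_poly ((@ev R)^~ t) p).[ev x t]).
Proof.
move=> cp cx.
have [|s s0 hs] := @conv_poly_common R [:: p; x%:P].
  by rewrite /= cp polyOverC cx.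
have xs : conv_at s x.
  by have := hs x%:P 0%N; rewrite coefC; apply; rewrite !inE eqxx orbT.
exists (s / 2) => [|t ts]; first by rewrite divr_gt0 ?ltr0n.
by apply: ev_horner xs (ltW s0) ts => i; apply: hs; rewrite inE eqxx.
Qed.

Lemma near0_neq0 x : x \in conv -> x != 0 -> near0 (fun t => t != 0 -> ev x t != 0).
Proof. by move=> cx /(ev_neq0 cx)[s s0 hs]; exists s => // t ts t0; apply: hs. Qed.

(** The identity theorem: a nonzero convergent series has no zeros near 0, except possibly 0
    itself. *)
Lemma near0_inj x y : x \in conv -> y \in conv ->
  near0 (fun t => t != 0 -> ev x t = ev y t) -> x = y.
Proof.
move=> cx cy h; apply/eqP; rewrite -subr_eq0; apply/negPn/negP => n0.
have cxy : x - y \in conv by exact: convB.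
have [t t0 [h1 [h2 h3]]] :=
  near0_nz (near0I h (near0I (near0_evB cx cy) (near0_neq0 cxy n0))).
by move: (h3 t0); rewrite h2 h1 // subrr eqxx.
Qed.

Lemma near0_fsub q x : (0 < q)%N -> x \in conv ->
  near0 (fun t => ev (fsub q x) t = ev x (t ^+ q)).
Proof. by move=> q0 cx; apply: ev_fsub. Qed.

Lemma map_ev_wpoly m (b : 'I_m -> fps K) t :
  map_poly ((@ev R)^~ t) (wpoly b) = wpoly (fun i => ev (b i) t).
Proof.
have c0 : ev (0 : fps K) t = 0 by exact: ev0.
rewrite [RHS](wpolyE (T := K) (m := m)) ?wpoly_monic ?size_wpoly //.
apply/polyP => i; rewrite coef_map_id0 //.
have [im|mi] := ltnP i m.
  have := coef_wpoly b (Ordinal im); have := coef_wpoly (fun i => ev (b i) t) (Ordinal im).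
  have := coef_wpoly (fun i : 'I_m => (wpoly (fun i => ev (b i) t))`_i) (Ordinal im).
  by move=> /= -> -> ->.
move: mi; rewrite leq_eqVlt => /orP[/eqP <-|mi]; last first.
  by rewrite !nth_default ?size_wpoly // ev0.
have h (T : comNzRingType) (c : 'I_m -> T) : (wpoly c)`_m = 1.
  by have := wpoly_monic c; rewrite monicE lead_coefE size_wpoly => /eqP.
by rewrite !h; exact: (evC 1).
Qed.

End NearZero.

Section ArcRoots.
Variable R : realType.
Local Notation K := (C R).

(** The point will be the direction of a line, so it must be nonzero. If only the origin is offered,
    continuity gives a nonzero constant row nearby. *)
Lemma nzgerm_nonzero n (f : 'rV[K]_n.+1 -> K) (e : K) : holo f -> nzgerm f -> 0 < e ->
  exists x : 'rV[K]_n.+1, [/\ x != 0, forall i, `|x ord0 i| <= e & f x != 0].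
Proof.
move=> fh fnz e0; have [x xe fx] := fnz e e0.
have [x0|xn0] := eqVneq x 0; last by exists x.
rewrite x0 in fx.
have [d d0 hd] := holo_continuous0 fh (divr_gt0 (etrans (normr_gt0 _) fx) (ltr0Sn _ 1)).
have [c c0 [cd ce]] := pos_min d0 e0.
have cle i : `|(const_mx c : 'rV[K]_n.+1) ord0 i| <= c by rewrite mxE gtr0_norm.
exists (const_mx c); split=> [|i|].
- apply/eqP => /rowP /(_ ord0); rewrite !mxE => c00; by rewrite c00 ltxx in c0.
- exact: le_trans ce.
apply/eqP => fc; have := hd (const_mx c) (fun i => le_trans (cle i) cd).
rewrite fc sub0r normrN ler_pdivlMr ?ltr0n // mulr_natr gerDl normr_le0.
by rewrite (negPf fx).
Qed.

(** The rank factorization of a row of rank 1 exhibits it as a scalar times the first row of an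
    invertible matrix. *)
Lemma complete_row (y : 'rV[K]_2) : y != 0 -> exists2 Y : 'M[K]_2, Y \in unitmx &
  forall s, (\row_(j < 2) (if j == ord0 then s else 0)) *m Y = s *: y.
Proof.
move=> y0; have rk : \rank y = 1%N.
  apply/eqP; rewrite eqn_leq rank_leq_row lt0n mxrank_eq0 y0 //.
have := mulmx_ebase y; have := row_ebase_unit y; have := col_ebase_unit y.
rewrite rk [col_ebase y]mx11_scalar unitmxE det_scalar1 mul_scalar_mx.
move: (row_ebase y) (col_ebase y _ _) => U c cu Uu <- {y0 rk}.
exists (c *: U) => [|s]; first by rewrite unitmxZ.
rewrite -scalemxAl -scalemxAr scalerA mulrC -scalerA; congr (_ *: _).
rewrite scalemxAl; congr (_ *m _); apply/rowP => j; rewrite !mxE.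
by case: j => [[|[|j]] hj] //=; rewrite ?mulr1 ?mulr0.
Qed.

Section Roots.
Variables (m : nat) (a : 'I_m -> 'rV[K]_2 -> K).
Hypothesis a_holo : forall i, holo (a i).
Hypothesis a0 : forall i, a i 0 = 0.

Definition arc_pair (N M : nat) (t : K) : 'rV[K]_2 :=
  \row_(j < 2) (if j == ord0 then t ^+ N else t ^+ M).

(* The Puiseux roots over the line [t y0] become convergent in [t^N]; the arc
   [t^N y0 + t^(k N + 1) y1] is so tangent to that line that each root persists
   by Newton's lemma. *)
Lemma arc_roots (E : 'rV[K]_2 -> K) : holo E -> nzgerm E ->
  (forall y, E y != 0 -> coprimep (monic_at a y) (monic_at a y)^`()) ->
  exists (Y : 'M[K]_2) (N k : nat) (psi : 'I_m -> fps K),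
  [/\ Y \in unitmx, (0 < N)%N, forall i, psi i \in conv,
      near0 (fun t => monic_at a (arc_pair N (k * N).+1 t *m Y) =
                      \prod_i ('X - (ev (psi i) t)%:P)) &
      near0 (fun t => t != 0 -> injective (fun i => ev (psi i) t))].
Proof.
move=> Eh Enz Esep.
have [rE [PhiE [rE0 hE _]]] := holo_subst_at Eh.
(* With |y0| <= rE/2 the line has norm at most rE on radius 2, so the expansion of E along it is
   valid for |t| <= 1. At t = 1 its value is nonzero, hence the series is nonzero. *)
have [y0 [y0n y0le Ey0]] := nzgerm_nonzero Eh Enz (divr_gt0 rE0 (ltr0Sn _ 1)).
have [Y Yu hY] := complete_row y0n.
have cX n : fpsX K ^+ n \in conv by exact: convXn.
have X1 n : (0 < n)%N -> order_ge 1 (fpsX K ^+ n).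
  by move=> n0 j; rewrite ltnS leqn0 => /eqP ->; rewrite fcoefXn; case: n n0.
pose line (j : 'I_2) := fpsC (y0 ord0 j) * fpsX K.
have cline j : line j \in conv by exact: convM (convC _) (convX K).
have oline j : order_ge 1 (line j) by apply: order_geMl; exact: (X1 1%N).
have ev_line t j : ev (line j) t = (t *: y0) ord0 j.
  have cl : conv_at (`|t| * 2) (fpsX K) by apply: conv_atX; rewrite mulr_ge0.
  rewrite /line (evM (conv_atC _ _) cl) ?mulr_ge0 // ?mulfK ?pnatr_eq0 //.
  by rewrite evC evX mxE mulrC.
have [cE evE2] : conv_at 2 (PhiE line) /\ forall t, `|t| <= 2 / 2 ->
    ev (PhiE line) t = E (\row_j ev (line j) t).
  apply: hE => [||j N]; [exact: ltr0n|exact: oline|].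
  rewrite (le_trans (tnormM _ _ _ (ler0n _ 2))) //.
  apply: (@le_trans _ _ (rE / 2 * 2)); last by rewrite divfK ?pnatr_eq0.
  rewrite ler_pM ?tnorm_ge0 //; first exact: le_trans (tnormC _ _ _) (y0le j).
  have := ler_tnorm (fpsX K) (ler0n K 2) (lexx 2) (leqnSn N); move/le_trans; apply.
  rewrite -[fpsX K]mulr1 tnormXM -[leRHS]mulr1 ler_wpM2l //.
  by rewrite (le_trans (tnormC 2 N 1)) ?normr1.
have evE t : `|t| <= 1 -> ev (PhiE line) t = E (t *: y0).
  move=> t1; rewrite evE2 ?mulfV ?pnatr_eq0 //; congr E.
  by apply/rowP => j; rewrite mxE ev_line.
have cPE : PhiE line \in conv by apply/convP; exists 2 => //; exact: ltr0n.
have PEn : PhiE line != 0.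
  apply: contraNneq Ey0 => P0; have := evE 1; rewrite P0 ev0 scale1r normr1.
  by move=> <-.
have sep0 : near0 (fun t => t != 0 -> E (t *: y0) != 0).
  have [s s0 hs] := near0_neq0 cPE PEn; have [c c0 [cs c1]] := pos_min s0 ltr01.
  exists c => // t tc t0; rewrite -evE ?(le_trans tc) //.
  by apply: hs => //; apply: le_trans cs.
have /choice[rP hrP] : forall i, exists rP : K * (('I_2 -> fps K) -> fps K),
    [/\ 0 < rP.1,
      forall sg s, 0 < s -> (forall j, order_ge 1 (sg j)) ->
        (forall j N, tnorm s N (sg j) <= rP.1) ->
        conv_at s (rP.2 sg) /\
        forall t, `|t| <= s / 2 -> ev (rP.2 sg) t = a i (\row_j ev (sg j) t)
    & forall k sg sg', (forall j, order_ge k (sg j - sg' j)) ->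
        order_ge k (rP.2 sg - rP.2 sg')].
  by move=> i; have [r [P hP]] := holo_subst_at (a_holo i); exists (r, P).
pose Phi i := (rP i).2.
have subst i sg : (forall j, sg j \in conv) -> (forall j, order_ge 1 (sg j)) ->
    Phi i sg \in conv /\ near0 (fun t => ev (Phi i sg) t = a i (\row_j ev (sg j) t)).
  move=> csg osg; have [r0 h1 _] := hrP i.
  have [s s0 hs] := tnorm_small_fin csg osg r0.
  have [h2 h3] := h1 sg s s0 osg hs.
  split; first by apply/convP; exists s.
  by exists (s / 2) => //; rewrite divr_gt0 ?ltr0n.
have congr_Phi i k sg sg' : (forall j, order_ge k (sg j - sg' j)) ->
    order_ge k (Phi i sg - Phi i sg') by have [_ _ h] := hrP i; apply: h.
pose al i := Phi i line.
have cal i : al i \in conv by have [] := subst i line cline oline.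
have [q [rs [crs PrsE]]] : puiseux_split (wpoly al).
  by apply: puiseux; [exact: wpoly_monic|exact: conv_wpoly].
pose N := q.+1.
pose P0 := wpoly (fun i => fsubm q (al i)).
have {}PrsE : P0 = \prod_(r <- rs) ('X - r%:P) by rewrite -PrsE map_wpoly.
have srs : size rs = m.
  have := congr1 (fun p : {poly fps K} => size p) PrsE.
  by rewrite /= size_wpoly size_prod_XsubC => -[].
pose phi (i : 'I_m) := nth 0 rs i.
have cphi i : phi i \in conv by apply: crs; rewrite mem_nth // srs.
have P0E : P0 = \prod_i ('X - (phi i)%:P).
  by rewrite PrsE (big_nth 0) srs big_mkord.
have cP0 : P0 \is a polyOver conv.
  exact: (conv_wpoly (fun i => conv_fsubm q (cal i))).
have cP0' : P0^`() \is a polyOver conv by exact: conv_deriv.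
have evP0 : near0 (fun t => map_poly ((@ev R)^~ t) P0 = monic_at a (t ^+ N *: y0)).
  have h1 : near0 (fun t => forall i, ev (fsubm q (al i)) t = a i (t ^+ N *: y0)).
    apply: near0_fin => i; have [_ h2] := subst i line cline oline.
    apply: near0_mono (near0I (near0_fsub (ltn0Sn q) (cal i)) (near0_pow (ltn0Sn q) h2)).
    move=> t [e1 e2]; rewrite [LHS]e1 e2; congr (a i _).
    by apply/rowP => j; rewrite mxE ev_line.
  apply: near0_mono h1 => t h; rewrite map_ev_wpoly.
  by congr wpoly; apply/funext => i; rewrite h.
(* If this series were zero, P and P' would share a root over every small t, against separability
   where E(t^N y0) is nonzero. *)
have dP0 i : P0^`().[phi i] != 0.
  apply/eqP => d0.
  have rootS : P0.[phi i] = 0.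
    by rewrite P0E (bigD1 i) //= hornerM hornerXsubC subrr mul0r.
  have dmap : near0 (fun t => map_poly ((@ev R)^~ t) P0^`() = (map_poly ((@ev R)^~ t) P0)^`()).
    have [|s s0 hs] := @conv_poly_common R [:: P0]; first by rewrite /= cP0.
    exists s => // t ts; apply/polyP => j.
    rewrite coef_deriv coef_map_id0 ?ev0 // coef_map_id0 ?ev0 // coef_deriv.
    have cj : conv_at s P0`_j.+1 by apply: hs; rewrite inE.
    suff: forall n, ev (P0`_j.+1 *+ n) t = ev P0`_j.+1 t *+ n /\ conv_at s (P0`_j.+1 *+ n).
      by move/(_ j.+1) => [].
    elim=> [|n [IH1 IH2]]; first by rewrite !mulr0n ev0; split; [|exact: (conv_atC s 0)].
    rewrite !mulrS (evD cj IH2 ts) IH1; split; first by [].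
    exact: conv_atD (ltW s0) cj IH2.
  have /near0_nz[t t0 [h1 [h2 [h3 [h4 h5]]]]] := near0I evP0 (near0I dmap (near0I
    (near0_horner cP0 (cphi i)) (near0I (near0_horner cP0' (cphi i))
      (near0_pow (ltn0Sn q) sep0)))).
  have := coprimep_root (Esep _ (h5 (expf_neq0 _ t0))) (x := ev (phi i) t).
  rewrite -h1 /root -h3 rootS ev0 eqxx => /(_ isT).
  by rewrite -h2 -h4 d0 ev0 eqxx.
have /choice[e0 he0] : forall i, exists n,
    P0^`().[phi i] n != 0 /\ order_ge n P0^`().[phi i].
  by move=> i; have [n h1 h2] := fps_order (dP0 i); exists n.
(* A uniform bound: all moved roots must agree with the old ones to one common order for the
   distinctness argument. *)
pose e := \max_i e0 i.
have e0e i : (e0 i <= e)%N by exact: leq_bigmax.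
(* Newton's lemma needs order [(e0 i + e).+1], which is at most [k], and [k < M]. The form k N + 1
   is what makes t recoverable from t^N and t^M. *)
pose k := (e + e).+1; pose M := (k * N).+1.
have Mk : (k < M)%N by rewrite ltnS leq_pmulr.
pose tau (j : 'I_2) : fps K := if j == ord0 then fpsX K ^+ N else fpsX K ^+ M.
pose sg j := tau ord0 * fpsC (Y ord0 j) + tau ord_max * fpsC (Y ord_max j).
pose sg0 j := fpsC (y0 ord0 j) * fpsX K ^+ N.
have ctau l : tau l \in conv by rewrite /tau; case: ifP => _; exact: cX.
have csg j : sg j \in conv.
  exact: convD (convM (ctau _) (convC _)) (convM (ctau _) (convC _)).
have osg j : order_ge 1 (sg j).
  have otau l : order_ge 1 (tau l) by rewrite /tau; case: ifP => _; exact: X1.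
  exact: order_geD (order_geMr _ (otau _)) (order_geMr _ (otau _)).
have csg0 j : sg0 j \in conv by exact: convM (convC _) (cX N).
have osg0 j : order_ge 1 (sg0 j) by apply: order_geMl; apply: X1.
have Y0 j : Y ord0 j = y0 ord0 j.
  have := congr1 (fun r : 'rV[K]_2 => r ord0 j) (hY 1).
  by rewrite mxE big_ord_recl big_ord1 !mxE /= !mul1r mul0r addr0.
have sg_sg0 j : order_ge M (sg j - sg0 j).
  rewrite /sg /tau /= Y0 /sg0 [X in X + _ - _]mulrC addrAC subrr add0r.
  exact: order_geXnM.
have ev_sg : near0 (fun t => \row_j ev (sg j) t = arc_pair N M t *m Y).
  have h j : near0 (fun t => ev (sg j) t = (arc_pair N M t *m Y) ord0 j).
    have h1 := near0_evD (convM (ctau ord0) (convC (Y ord0 j)))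
       (convM (ctau ord_max) (convC (Y ord_max j))).
    have h2 := near0_evM (ctau ord0) (convC (Y ord0 j)).
    have h3 := near0_evM (ctau ord_max) (convC (Y ord_max j)).
    apply: near0_mono (near0I h1 (near0I h2 (near0I h3 (near0I
      (near0_evXn R N) (near0_evXn R M))))) => t [e1 [e2 [e3 [e4 e5]]]].
    rewrite /sg e1 e2 e3 /tau /= e4 e5 !evC mxE big_ord_recl big_ord1 !mxE /=.
    by congr (_ + _ * Y _ _); apply: val_inj.
  apply: near0_mono (near0_fin h) => t ht; apply/rowP => j; by rewrite mxE ht.
pose al' i := Phi i sg.
have cal' i : al' i \in conv by have [] := subst i sg csg osg.
(* Substituting t^N y0 directly, or first the line and then t^N, gives the same sums and so the same
   series; [congr_Phi] compares this with the arc. *)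
have al'_al i : order_ge M (al' i - fsubm q (al i)).
  suff <- : Phi i sg0 = fsubm q (al i) by apply: congr_Phi.
  have [c1 h1] := subst i sg0 csg0 osg0; have [_ h2] := subst i line cline oline.
  apply: (near0_inj c1 (conv_fsubm q (cal i))).
  have h3 j : near0 (fun t => ev (sg0 j) t = (t ^+ N *: y0) ord0 j).
    apply: near0_mono (near0I (near0_evM (convC (y0 ord0 j)) (cX N)) (near0_evXn R N)).
    by move=> t [e1 e2]; rewrite /sg0 e1 e2 evC mxE mulrC.
  apply: near0_mono (near0I (near0_fin h3) (near0I h1 (near0I
    (near0_fsub (ltn0Sn q) (cal i)) (near0_pow (ltn0Sn q) h2)))).
  move=> t [e1 [e2 [e3 e4]]] _; rewrite e2 [RHS]e3 e4; congr (a i _).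
  by apply/rowP => j; rewrite !mxE e1 ev_line.
pose f := wpoly al'.
have cf : f \is a polyOver conv by exact: conv_wpoly.
have fP0 (x : fps K) : order_ge M (f.[x] - P0.[x]) /\ order_ge M (f^`().[x] - P0^`().[x]).
  have -> : f = P0 + \sum_(i < m) (al' i - fsubm q (al i)) *: 'X^i.
    rewrite /f /P0 /wpoly -addrA -big_split; congr (_ + _); apply: eq_bigr => i _.
    by rewrite /= -scalerDl addrC subrK.
  split.
    rewrite hornerD addrAC subrr add0r horner_sum; apply: order_ge_sum => i _.
    by rewrite hornerZ; apply: order_geMr.
  rewrite derivD hornerD addrAC subrr add0r.
  have -> : (\sum_(i < m) (al' i - fsubm q (al i)) *: 'X^i)^`() =
      \sum_(i < m) (al' i - fsubm q (al i)) *: ('X^i)^`() :> {poly fps K}.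
    rewrite (big_morph (@deriv (fps K)) (id1 := 0) (op1 := +%R)); last first.
    - exact: derivC.
    - exact: derivD.
    by apply: eq_bigr => i _; rewrite derivZ.
  rewrite horner_sum; apply: order_ge_sum => i _.
  by rewrite hornerZ; apply: order_geMr.
have rootP0 i : P0.[phi i] = 0.
  by rewrite P0E (bigD1 i) //= hornerM hornerXsubC subrr mul0r.
have /choice[psi hpsi] : forall i, exists psi : fps K,
    psi \in conv /\ (f.[psi] = 0 /\ order_ge e.+1 (psi - phi i)).
  move=> i; have [h1 h2] := fP0 (phi i); rewrite rootP0 subr0 in h1.
  have [en eo] := he0 i.
  have cfb := conv_horner cf (cphi i).
  have cfb' := conv_horner (conv_deriv cf) (cphi i).
  have o1 : order_ge (e0 i + e).+1 f.[phi i].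
    apply: order_geW h1; apply: ltnW; apply: leq_ltn_trans Mk.
    by rewrite ltnS leq_add2r.
  have [h ch fbE] := conv_order_geP cfb o1.
  have e0M : (e0 i < M)%N.
    apply: leq_ltn_trans Mk; apply: (leq_trans (e0e i)).
    by rewrite /k -addSn leq_addl.
  have o2 : order_ge (e0 i) f^`().[phi i].
    rewrite -[f^`().[_]](subrK P0^`().[phi i]); apply: order_geD eo.
    exact: order_geW (ltnW e0M) h2.
  have [u cu fb'E] := conv_order_geP cfb' o2.
  have un : u 0%N != 0.
    have : f^`().[phi i] (e0 i) = u 0%N by rewrite fb'E fcoefXnM ltnn subnn.
    move=> <-; have := h2 _ e0M; rewrite fcoefD fcoefN => /eqP.
    by rewrite subr_eq0 => /eqP ->.
  have [psi cpsi hh] := newton_root cf (cphi i) ch cu (e0e i) un fbE fb'E.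
  by exists psi.
have cpsi i : psi i \in conv by case: (hpsi i).
(* If two moved roots coincided, phi_i - phi_j would have order at least e+1. As a factor of
   P0'(phi_i) it would push the order of that value above e. *)
have psi_neq i j : i != j -> psi i - psi j != 0.
  move=> ij; apply/eqP => pij; have [en eo] := he0 i.
  have [_ [_ hi]] := hpsi i; have [_ [_ hj]] := hpsi j.
  have o1 : order_ge e.+1 (phi i - phi j).
    have -> : phi i - phi j = (psi j - phi j) - (psi i - phi i) + (psi i - psi j) by ring.
    by rewrite pij addr0; apply: order_geB.
  have : order_ge e.+1 P0^`().[phi i].
    rewrite P0E (bigD1 i) //= (bigD1 j) ?[j == i]eq_sym //=.
    rewrite derivM derivXsubC hornerD !hornerM !hornerXsubC subrr mul0r addr0.
    rewrite hornerC mul1r; exact: order_geMr.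
  move=> /(_ (e0 i)); rewrite ltnS e0e => /(_ isT) h.
  by rewrite h eqxx in en.
have hinj (ij : 'I_m * 'I_m) : near0 (fun t => t != 0 ->
    ev (psi ij.1) t = ev (psi ij.2) t -> ij.1 = ij.2).
  have [e12|n12] := eqVneq ij.1 ij.2; first by exists 1.
  have cd := convB (cpsi ij.1) (cpsi ij.2).
  apply: near0_mono (near0I (near0_neq0 cd (psi_neq _ _ n12))
    (near0_evB (cpsi ij.1) (cpsi ij.2))) => t [h1 h2] t0 e12.
  by move: (h1 t0); rewrite h2 e12 subrr eqxx.
exists Y, N, k, psi; rewrite -/M; split; [exact: Yu|by []|exact: cpsi| |]; last first.
  apply: near0_mono (near0_fin hinj) => t ht t0 i j; exact: (ht (i, j) t0).
have evf : near0 (fun t => map_poly ((@ev R)^~ t) f = monic_at a (arc_pair N M t *m Y)).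
  have h1 i : near0 (fun t => ev (al' i) t = a i (arc_pair N M t *m Y)).
    have [_ h2] := subst i sg csg osg.
    by apply: near0_mono (near0I h2 ev_sg) => t [-> ->].
  apply: near0_mono (near0_fin h1) => t h; rewrite map_ev_wpoly.
  by congr wpoly; apply/funext => i; rewrite h.
have hroot i : near0 (fun t => root (monic_at a (arc_pair N M t *m Y)) (ev (psi i) t)).
  apply: near0_mono (near0I evf (near0_horner cf (cpsi i))) => t [<- h].
  by have [_ [fz _]] := hpsi i; rewrite /root -h fz ev0.
apply: near0_mono (near0I (near0_fin hroot) (near0_fin hinj)) => t [hr hi].
(* At t = 0 the roots coincide, and the factorization is that of X^m. *)
have [t0|t0] := eqVneq t 0.
  have g0 : arc_pair N M t *m Y = 0.
    rewrite t0 /arc_pair (_ : \row__ _ = 0) ?mul0mx //.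
    by apply/rowP => j; rewrite !mxE; case: ifP; rewrite expr0n.
  rewrite g0 in hr *.
  have mX : monic_at a 0 = 'X^m.
    rewrite /monic_at big1 ?addr0 // => i _; by rewrite a0 scale0r.
  rewrite mX in hr *; rewrite (eq_bigr (fun=> 'X)) => [|i _].
    by rewrite prodr_const card_ord.
  have := hr i; rewrite /root hornerXn expf_eq0 => /andP[_ /eqP ->].
  by rewrite subr0.
set p := monic_at a _ in hr *.
have sp : size p = m.+1 by exact: size_wpoly.
have mp : lead_coef p = 1 by apply/eqP; rewrite -monicE; exact: wpoly_monic.
pose zs := [seq ev (psi i) t | i : 'I_m].
have szs : size zs = m by rewrite size_map size_enum_ord.
have uzs : uniq_roots zs.
  rewrite uniq_rootsE map_inj_uniq ?enum_uniq // => i j; exact: (hi (i, j)).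
have rzs : all (root p) zs by apply/allP => _ /mapP[i _ ->].
have sps : size p = (size zs).+1 by rewrite sp szs.
rewrite [LHS](all_roots_prod_XsubC sps rzs uzs).
by rewrite mp scale1r big_map big_enum.
Qed.

End Roots.
End ArcRoots.

(** * Zeros of F, fibers and the degree of the cover *)

Section Weierstrass.
Variable R : realType.
Local Notation K := (C R).

Lemma unit_det_sep (p : {poly K}) : p \is monic -> coprimep p p^`() ->
  resultant p p^`() != 0 /\
  exists rs : seq K, [/\ uniq rs, size p = (size rs).+1 & forall z, root p z = (z \in rs)].
Proof.
move=> mp cop; split.
  by rewrite resultant_eq0; move: cop; rewrite /coprimep => /eqP ->.
have [rs pE] := root_factors mp.
exists rs; split=> [||z]; rewrite ?pE ?size_prod_XsubC ?root_prod_XsubC //.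
rewrite -uniq_rootsE; have h := separable_prod_XsubC rs.
by rewrite uniq_rootsE -h separable_poly.unlock -pE.
Qed.

Lemma weierstrass_zeros m (a : 'I_m -> 'rV[K]_2 -> K) (F : 'rV[K]_3 -> K)
    (pi : 'rV[K]_3 -> 'rV[K]_2) (A : 'M[K]_3) : weierstrass_form F pi A a ->
  exists2 d : K, 0 < d & forall x : 'rV[K]_3, (forall i, `|x ord0 i| <= d) ->
    F x = 0 <-> root (monic_at a (proj12 (x *m invmx A))) ((x *m invmx A) ord0 ord_max).
Proof.
move=> [Au piA a0 [u [/germ_holo uh u0 /nbhs_rV0[e1 e10 hF]]]].
have [e2 e20 hu] := holo_continuous0 uh (divr_gt0 (etrans (normr_gt0 _) u0) (ltr0Sn _ 1)).
have un0 (x : 'rV[K]_3) : (forall i, `|x ord0 i| <= e2) -> u x != 0.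
  move=> /hu h; apply/eqP => ux; move: h; rewrite ux sub0r normrN.
  by rewrite ler_pdivlMr ?ltr0n // mulr_natr gerDl normr_le0 (negPf u0).
have [e3 e30 [e31 e32]] := pos_min e10 e20.
have [d d0 hd] := mulmx_le (invmx A) e30.
exists d => // x /hd hx.
have := hF (x *m invmx A) (fun i => le_trans (hx i) e31).
rewrite mulmxKV // => ->; rewrite /root; split=> [/eqP|/eqP ->]; last by rewrite mulr0.
by rewrite mulf_eq0 (negPf (un0 _ (fun i => le_trans (hx i) e32))).
Qed.

(** The fiber is counted over one point y near 0 with E(y) nonzero: it consists of one point for
    each of the m simple roots. *)
Lemma cover_degreeE m (a : 'I_m -> 'rV[K]_2 -> K) (F : 'rV[K]_3 -> K)
    (pi : 'rV[K]_3 -> 'rV[K]_2) (A : 'M[K]_3) (d : nat) (U0 : set 'rV[K]_3)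
    (E : 'rV[K]_2 -> K) :
  weierstrass_form F pi A a -> nzgerm E ->
  (forall y, E y != 0 -> coprimep (monic_at a y) (monic_at a y)^`()) ->
  nbhs (0 : 'rV[K]_3) U0 ->
  (forall U : set 'rV[K]_3, nbhs (0 : 'rV[K]_3) U -> U `<=` U0 ->
     \forall y \near (0 : 'rV[K]_2),
       ~ zeros (fun y => resultant (monic_at a y) (monic_at a y)^`()) y ->
          (zeros F `&` U `&` pi @^-1` [set y] #= `I_d)%card) ->
  d = m.
Proof.
move=> Fw Enz Esep /nbhs_rV0[e0 e00 hU0] hU.
have [dF dF0 hF] := weierstrass_zeros Fw.
have [Au piA a0 _] := Fw.
have [c c0 [ce cd]] := pos_min e00 dF0.
(* A polydisk inside [U0] on which the Weierstrass form is valid; y is then taken so small that all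
   points of its fiber lie in it. *)
pose U := [set x : 'rV[K]_3 | forall i, `|x ord0 i| <= c].
have nU : nbhs (0 : 'rV[K]_3) U by apply/nbhs_rV0; exists c.
have UU0 : U `<=` U0 by move=> x Ux; apply: hU0 => i; apply: le_trans ce.
have /nbhs_rV0[e1 e10 he1] := hU U nU UU0.
have [c1 c10 hc1] := mulmx_le A c0.
have [e2 e20 hroots] := wpoly_roots_small m c10.
have /choice[da hda] : forall i : 'I_m, exists da : K, 0 < da /\
    forall y : 'rV[K]_2, (forall k, `|y ord0 k| <= da) -> `|a i y| <= e2.
  move=> i; have [ah ai0] := a0 i.
  have [da da0 h] := holo_continuous0 (germ_holo ah) e20.
  by exists da; split=> // y /h; rewrite ai0 subr0.
have [e3 e30 he3] : exists2 e3 : K, 0 < e3 & forall i, e3 <= da i.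
  apply: pos_min_fin => [i b b' b0 bb|i]; first exact: le_trans.
  by exists (da i) => //; case: (hda i).
have [e4 e40 [e43 e4c]] := pos_min e30 c10.
have [e5 e50 [e54 e51]] := pos_min e40 e10.
have [y yle Ey] := Enz e5 e50.
have [res [rs [urs srs hrs]]] := unit_det_sep (wpoly_monic (fun i => a i y)) (Esep y Ey).
rewrite size_wpoly in srs; have {}srs : size rs = m by case: srs.
have hcard := he1 y (fun i => le_trans (yle i) e51) (elimN eqP res).
have yc1 i : `|y ord0 i| <= c1 := le_trans (yle i) (le_trans e54 e4c).
pose f (k : nat) := join12 y (nth 0 rs k) *m A.
have piB x : pi x = proj12 (x *m invmx A) by rewrite -piA mulmxKV.
have rs_small z : z \in rs -> `|z| < c1.
  rewrite -hrs; apply: hroots => i.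
  by have [_] := hda i; apply => k; exact: le_trans (yle k) (le_trans e54 (le_trans e43 (he3 i))).
have fE : zeros F `&` U `&` pi @^-1` [set y] = f @` `I_m.
  apply/seteqP; split=> [x [[Fx Ux] /= piy]|_ [k km <-]].
    have /hF[/(_ Fx)] := fun i => le_trans (Ux i) cd.
    rewrite -piB piy hrs => zrs _.
    exists (index ((x *m invmx A) ord0 ord_max) rs).
      by rewrite /= -srs index_mem.
    by rewrite /f nth_index // -piy piB join12_eta mulmxKV.
  have zrs : nth 0 rs k \in rs by rewrite mem_nth // srs.
  have Uf : U (f k).
    move=> i; apply: hc1; apply: join12_le => //; exact: ltW (rs_small _ zrs).
  split; [split=> //|]; last by rewrite /= piB /f mulmxK // proj12_join12.
  have [_ h] := hF (f k) (fun i => le_trans (Uf i) cd); apply: h.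
  by rewrite /f mulmxK // proj12_join12 join12_max hrs.
have finj : {in `I_m &, injective f}.
  move=> k l; rewrite !inE /= => km lm /(congr1 (fun x => (x *m invmx A) ord0 ord_max)).
  rewrite /f !mulmxK // !join12_max => /eqP.
  by rewrite nth_uniq ?srs // => /eqP.
move: hcard; rewrite fE => hcard.
apply/card_eq_II; rewrite card_eq_sym in hcard.
exact: card_eq_trans hcard (inj_card_eq finj).
Qed.

End Weierstrass.

(** * Branches *)

(** Multiplying t^b by t^(k N^2) makes it a monomial in t^N and t^(k N + 1): every power k (N - b)
    is nonnegative. *)
Fact branch_exponent (k N b : nat) : (b <= N)%N ->
  (N * (k * N) + b = (k * N).+1 * b + N * (k * (N - b)))%N.
Proof.
move=> /subnKC; move: (N - b)%N => c <-; by rewrite mulSn; ring.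
Qed.

Section Branch.
Variable R : realType.
Local Notation K := (C R).
Variables (F : 'rV[K]_3 -> K) (pi : 'rV[K]_3 -> 'rV[K]_2) (A : 'M[K]_3).
Variables (m : nat) (a : 'I_m -> 'rV[K]_2 -> K).
Hypothesis F_form : weierstrass_form F pi A a.
Hypothesis F_holo : holomorphic_germ F.
Hypothesis pi_finite : finite_on (zeros F) pi.
Variables (Y : 'M[K]_2) (N k : nat).
Hypothesis Y_unit : Y \in unitmx.
Hypothesis N_gt0 : (0 < N)%N.

Local Notation M := (k * N).+1.
Local Notation B := (invmx A).
Local Notation A12 := (rowsub (widen_ord (leqnSn 2)) A).

Definition arc (t : K) : 'rV[K]_2 := arc_pair N M t *m Y.
Definition arc_coord (x : 'rV[K]_3) : 'rV[K]_2 := proj12 (x *m B) *m invmx Y.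
Definition branch_pt (p : fps K) (t : K) : 'rV[K]_3 := join12 (arc t) (ev p t) *m A.
Definition branch (rho : K) (p : fps K) : set 'rV[K]_3 :=
  [set x | exists2 t : K, `|t| <= rho & x = branch_pt p t].

Let A_unit : A \in unitmx. Proof. by have [] := F_form. Qed.

Lemma pi_arc x : pi x = proj12 (x *m B).
Proof. by have [_ piA _ _] := F_form; rewrite -piA mulmxKV. Qed.

Lemma branch_ptK p t : branch_pt p t *m B = join12 (arc t) (ev p t).
Proof. by rewrite mulmxK. Qed.

Lemma pi_branch_pt p t : pi (branch_pt p t) = arc t.
Proof. by rewrite pi_arc branch_ptK proj12_join12. Qed.

Lemma arc_coord_branch p t : arc_coord (branch_pt p t) = arc_pair N M t.
Proof. by rewrite /arc_coord -pi_arc pi_branch_pt mulmxK. Qed.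

Lemma arc_pair0 (t : K) : arc_pair N M t ord0 ord0 = t ^+ N.
Proof. by rewrite mxE. Qed.

Lemma arc_pair1 (t : K) : arc_pair N M t ord0 ord_max = t ^+ M.
Proof. by rewrite mxE. Qed.

(** Off 0 the parameter is t^M / (t^N)^k. *)
Lemma arc_inj : injective arc.
Proof.
move=> s t /(can_inj (mulmxK Y_unit)) e.
have := congr1 (fun y : 'rV[K]_2 => y ord0 ord0) e.
have := congr1 (fun y : 'rV[K]_2 => y ord0 ord_max) e.
rewrite !arc_pair0 !arc_pair1 !exprS mulnC !exprM => eM eN.
have [t0|tn0] := eqVneq t 0.
  rewrite t0 expr0n (gtn_eqF N_gt0) in eN.
  by move/eqP: eN; rewrite t0 expf_eq0 N_gt0 => /eqP.
have cn : (t ^+ N) ^+ k != 0 by rewrite !expf_neq0.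
by move: eM; rewrite eN => /(mulIf cn).
Qed.

Lemma arc_0 : arc 0 = 0.
Proof.
rewrite /arc (_ : arc_pair _ _ _ = 0) ?mul0mx //.
by apply/rowP => j; rewrite !mxE !expr0n (gtn_eqF N_gt0); case: ifP.
Qed.

(* The parameter is controlled by the point, since t^N is one of the linear
   coordinates of the arc. *)
Lemma parameter_small (e : K) : 0 < e -> exists2 d : K, 0 < d &
  forall x : 'rV[K]_3, (forall i, `|x ord0 i| <= d) ->
    (forall i, `|arc_coord x ord0 i| <= e ^+ N) /\
    forall p t, x = branch_pt p t -> `|t| <= e.
Proof.
move=> e0; have [Pr PrE] := proj12_mx R.
have [d d0 hd] := mulmx_le (B *m Pr *m invmx Y) (exprn_gt0 N e0).
exists d => // x xd; have h i : `|arc_coord x ord0 i| <= e ^+ N.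
  have := hd x xd i.
  by rewrite /arc_coord PrE !mulmxA.
split=> // p t xE; have := h ord0; rewrite xE arc_coord_branch arc_pair0 normrX.
by rewrite ler_pXn2r ?nnegrE ?(ltW e0).
Qed.

Definition branch_fps (p : fps K) (j : 'I_3) : fps K :=
  (fpsX K ^+ N * fpsC ((Y *m A12) ord0 j) +
   fpsX K ^+ M * fpsC ((Y *m A12) ord_max j)) + p * fpsC (A ord_max j).

Lemma branch_pt_coord p t j : branch_pt p t ord0 j =
  t ^+ N * (Y *m A12) ord0 j + t ^+ M * (Y *m A12) ord_max j +
  ev p t * A ord_max j.
Proof.
have -> : branch_pt p t = arc t *m A12 + ev p t *: row ord_max A.
  apply/rowP => l; rewrite [LHS]mxE big_ord_recr [RHS]mxE; congr (_ + _).
    rewrite [RHS]mxE; apply: eq_bigr => i _; congr (_ * _); last by rewrite [RHS]mxE.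
    by rewrite -[arc t in RHS](proj12_join12 _ (ev p t)) [RHS]mxE.
  by rewrite join12_max !mxE.
rewrite [LHS]mxE /arc -mulmxA; congr (_ + _); last by rewrite !mxE.
rewrite [LHS]mxE big_ord_recl big_ord1; congr (_ + _).
  by rewrite arc_pair0.
by rewrite [lift _ _](_ : _ = ord_max) ?arc_pair1 //; apply: val_inj.
Qed.

Section Regular.
Variable p : fps K.
Hypothesis p_conv : p \in conv.
Hypothesis p_0 : p 0%N = 0.

Lemma branch_fps_conv j : branch_fps p j \in conv.
Proof.
exact: convD (convD (convM (convXn R N) (convC _)) (convM (convXn R M) (convC _)))
  (convM p_conv (convC _)).
Qed.

Lemma branch_fps_order j : order_ge 1 (branch_fps p j).
Proof.
have oX n : (0 < n)%N -> order_ge 1 (fpsX K ^+ n).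
  by move=> n0 i; rewrite ltnS leqn0 => /eqP ->; rewrite fcoefXn; case: n n0.
have op : order_ge 1 p by move=> i; rewrite ltnS leqn0 => /eqP ->.
apply: order_geD (order_geMr _ op).
exact: order_geD (order_geMr _ (oX _ N_gt0)) (order_geMr _ (oX _ (ltn0Sn _))).
Qed.

Lemma ev_branch_fps : near0 (fun t => \row_j ev (branch_fps p j) t = branch_pt p t).
Proof.
suff h j : near0 (fun t => ev (branch_fps p j) t = branch_pt p t ord0 j).
  by apply: near0_mono (near0_fin h) => t ht; apply/rowP => j; rewrite mxE ht.
have c1 := convM (convXn R N) (convC ((Y *m A12) ord0 j)).
have c2 := convM (convXn R M) (convC ((Y *m A12) ord_max j)).
have c3 := convM p_conv (convC (A ord_max j)).
apply: near0_mono (near0I (near0_evD (convD c1 c2) c3) (near0I (near0_evD c1 c2)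
  (near0I (near0_evM (convXn R N) (convC ((Y *m A12) ord0 j)))
  (near0I (near0_evM (convXn R M) (convC ((Y *m A12) ord_max j)))
  (near0I (near0_evM p_conv (convC (A ord_max j)))
  (near0I (near0_evXn R N) (near0_evXn R M))))))) => t [e1 [e2 [e3 [e4 [e5 [e6 e7]]]]]].
by rewrite branch_pt_coord /branch_fps e1 e2 e3 e4 e5 e6 e7 !evC.
Qed.

Lemma branch_pt_small (e : K) : 0 < e ->
  near0 (fun t => forall i, `|branch_pt p t ord0 i| <= e).
Proof.
move=> e0; suff h i : near0 (fun t => `|ev (branch_fps p i) t| <= e).
  apply: near0_mono (near0I (near0_fin h) ev_branch_fps) => t [ht <-] i.
  by rewrite mxE.
have [s [L [s0 L0 hs]]] := ev_lipschitz (branch_fps_conv i).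
have L10 : 0 < L + 1 by rewrite ltr_wpDl.
have [c c0 [cs ce]] := pos_min s0 (divr_gt0 e0 L10).
exists c => // t tc; have := hs t (le_trans tc cs).
rewrite (branch_fps_order i) // subr0 => h; apply: (le_trans h).
apply: (@le_trans _ _ ((L + 1) * `|t|)); first by rewrite ler_wpM2r // lerDl.
by rewrite mulrC -ler_pdivlMr // (le_trans tc).
Qed.

Lemma branch_pt_0 : branch_pt p 0 = 0.
Proof.
apply/rowP => j; rewrite branch_pt_coord ev_at0 p_0 !expr0n (gtn_eqF N_gt0).
by rewrite !mul0r !addr0 mxE.
Qed.

Lemma branch_subst f : holo f ->
  exists2 c : fps K, c \in conv & near0 (fun t => ev c t = f (branch_pt p t)).
Proof.
move=> fh; have [c cc hc] := holo_subst fh branch_fps_conv branch_fps_order.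
exists c => //; apply: near0_mono (near0I hc ev_branch_fps) => t [-> ->] //.
Qed.

(* By the identity theorem an analytic germ either contains the branch or meets
   it only at the origin. *)
Lemma branch_dichotomy (Z : set 'rV[K]_3) : analytic_germ Z ->
  near0 (fun t => Z (branch_pt p t)) \/ near0 (fun t => t != 0 -> ~ Z (branch_pt p t)).
Proof.
move=> [n [f [fh /nbhs_rV0[e e0 he]]]].
have small := branch_pt_small e0.
have /choice[c hc] : forall i : 'I_n, exists c : fps K,
    c \in conv /\ near0 (fun t => ev c t = f i (branch_pt p t)).
  by move=> i; have [c cc ec] := branch_subst (germ_holo (fh i)); exists c.
have [[i ci]|h] := pselect (exists i, c i != 0).
  right; have [cc ec] := hc i.
  apply: near0_mono (near0I small (near0I ec (near0_neq0 cc ci))) => t [h1 [h2 h3]] t0.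
  by move=> /(he _ h1)/(_ i) fz; move: (h3 t0); rewrite h2 fz eqxx.
left; have ec i : near0 (fun t => f i (branch_pt p t) = 0).
  have [cc ec] := hc i; apply: near0_mono ec => t <-.
  have -> : c i = 0 by apply: contrapT => /eqP ci; apply: h; exists i.
  exact: ev0.
by apply: near0_mono (near0I small (near0_fin ec)) => t [h1 h2]; apply/(he _ h1).
Qed.

Variable rho : K.
Hypothesis rho_gt0 : 0 < rho.

Lemma branch_near (P : 'rV[K]_3 -> Prop) : near0 (fun t => P (branch_pt p t)) ->
  \forall x \near (0 : 'rV[K]_3), branch rho p x -> P x.
Proof.
move=> [s s0 hs]; have [d d0 hd] := parameter_small s0.
apply/nbhs_rV0; exists d => // x xd [t _ xE].
by have [_ /(_ p t xE) ts] := hd x xd; rewrite xE; apply: hs.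
Qed.

Lemma near_branch (P : 'rV[K]_3 -> Prop) : (\forall x \near (0 : 'rV[K]_3), P x) ->
  near0 (fun t => branch rho p (branch_pt p t) /\ P (branch_pt p t)).
Proof.
move=> /nbhs_rV0[e e0 he]; apply: near0I.
  by exists rho => // t tr; exists t.
by apply: near0_mono (branch_pt_small e0) => t; exact: he.
Qed.

Hypothesis roots_p : near0 (fun t => root (monic_at a (arc t)) (ev p t)).

Lemma branch_zeros : near0 (fun t => F (branch_pt p t) = 0).
Proof.
have [d d0 hd] := weierstrass_zeros F_form.
apply: near0_mono (near0I (branch_pt_small d0) roots_p) => t [h1 h2].
by apply/(hd _ h1); rewrite branch_ptK proj12_join12 join12_max.
Qed.

(* The residue classes of the exponents modulo N express t^(k N^2) p(t) as a
   power series in the two coordinates t^N and t^(k N + 1). *)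
Lemma branch_equation : near0 (fun t =>
  (t ^+ N) ^+ (k * N) * ev p t =
  \sum_(b < N) ev (fsection N b p) (t ^+ N) * (t ^+ M) ^+ b * (t ^+ N) ^+ (k * (N - b))).
Proof.
have cs b : fsection N b p \in conv by exact: conv_fsection.
have csub b := conv_fsub N_gt0 (cs b).
have h b : near0 (fun t => ev (fpsX K ^+ b * fsub N (fsection N b p)) t =
    t ^+ b * ev (fsection N b p) (t ^+ N)).
  apply: near0_mono (near0I (near0_evM (convXn R b) (csub b))
    (near0I (near0_evXn R b) (near0_fsub N_gt0 (cs b)))) => t [e1 [e2 e3]].
  by rewrite e1 e2 e3.
have [s s0 hs] : exists2 s : K, 0 < s & forall b : 'I_N,
    conv_at s (fpsX K ^+ b * fsub N (fsection N b p)).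
  apply: pos_min_fin => [b c c' c0 cc'|b]; first exact: conv_at_le (ltW c0) cc'.
  by apply/convP; exact: convM (convXn R b) (csub b).
have hsum : near0 (fun t => ev p t =
    \sum_(b < N) ev (fpsX K ^+ b * fsub N (fsection N b p)) t).
  exists s => // t ts; rewrite {1}(fsection_decomp p N_gt0).
  exact: (ev_sum _ (ltW s0) ts hs).
apply: near0_mono (near0I hsum (near0_fin (fun b : 'I_N => h b))) => t [-> e].
rewrite big_distrr; apply: eq_bigr => b _ /=; rewrite e.
rewrite mulrA -exprM -!exprD mulrC -mulrA -!exprM -exprD; congr (_ * t ^+ _).
exact: branch_exponent (ltnW (ltn_ord b)).
Qed.

(** Let l0, l1 be the coordinates of the projection in the basis [Y]. The equations say that (l0,
    l1) lies on the curve l0^M = l1^N, that the third coordinate is the root [p] multiplied by l0^(k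
    N), and that F vanishes. The second is vacuous in that coordinate where l0 = 0, which is why F
    is included. *)
Definition branch_defining (i : 'I_3) (x : 'rV[K]_3) : K :=
  if i == 0%N :> nat then
    arc_coord x ord0 ord0 ^+ M - arc_coord x ord0 ord_max ^+ N
  else if i == 1%N :> nat then
    arc_coord x ord0 ord0 ^+ (k * N) * (x *m B) ord0 ord_max -
    \sum_(b < N) ev (fsection N b p) (arc_coord x ord0 ord0) *
       arc_coord x ord0 ord_max ^+ b * arc_coord x ord0 ord0 ^+ (k * (N - b))
  else F x.

Lemma arc_coord_holo j : holo (fun x => arc_coord x ord0 j).
Proof.
have [Pr PrE] := proj12_mx R.
have -> : (fun x => arc_coord x ord0 j) =
    (fun x => (x *m (B *m Pr *m invmx Y)) ord0 j).
  by apply/funext => x; rewrite /arc_coord PrE !mulmxA.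
exact: holo_linear (holo_coord R j).
Qed.

Lemma ev_arc_coord_holo (x : fps K) : x \in conv ->
  holo (fun y => ev x (arc_coord y ord0 ord0)).
Proof.
move=> cx; have [Pr PrE] := proj12_mx R.
have -> : (fun y => ev x (arc_coord y ord0 ord0)) = (fun y =>
    (fun z : 'rV[K]_1 => ev x (z ord0 ord0))
      (y *m (B *m Pr *m invmx Y *m delta_mx ord0 ord0))).
  apply/funext => y; congr (ev x _); rewrite /arc_coord PrE !mulmxA.
  by rewrite [RHS]mxE big_ord_recl big_ord1 ![delta_mx _ _ _ _]mxE /= mulr1 mulr0 addr0.
exact: holo_linear (holo_ev cx).
Qed.

Lemma holo_sum n (I : Type) (r : seq I) (f : I -> 'rV[K]_n -> K) :
  (forall i, holo (f i)) -> holo (fun x => \sum_(i <- r) f i x).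
Proof.
move=> hf; elim: r => [|i r IH].
  have -> : (fun x => \sum_(i <- [::]) f i x) = (fun=> 0).
    by apply/funext => x; rewrite big_nil.
  exact: holo_cst.
have -> : (fun x => \sum_(j <- i :: r) f j x) = (fun x => f i x + \sum_(j <- r) f j x).
  by apply/funext => x; rewrite big_cons.
exact: holoD.
Qed.

Lemma branch_defining_holo i : holo (branch_defining i).
Proof.
have h0 := arc_coord_holo ord0; have h1 := arc_coord_holo ord_max.
case: i => [[|[|[|//]]] i3]; rewrite /branch_defining /=.
- exact: holoD (holoXn M h0) (holoN (holoXn N h1)).
- have hz : holo (fun x : 'rV[K]_3 => (x *m B) ord0 ord_max).
    exact: holo_linear (holo_coord R (ord_max : 'I_3)).
  apply: holoD (holoM (holoXn (k * N) h0) hz) (holoN _).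
  apply: holo_sum => b; apply: holoM (holoXn _ h0); apply: holoM (holoXn _ h1).
  by apply: ev_arc_coord_holo; exact: conv_fsection.
- exact: germ_holo.
Qed.

Lemma branch_analytic : analytic_germ (branch rho p).
Proof.
exists 3%N, branch_defining; split=> [i|]; first exact: holo_germ (branch_defining_holo i).
have [s s0 hs] := branch_equation.
have [c c0 [cs cr]] := pos_min s0 rho_gt0.
have [d d0 hd] := parameter_small c0.
have fwd := branch_near (P := fun x => F x = 0) branch_zeros.
rewrite /germ_eq; near=> x; split=> [Yx|fx].
  have [t tr xE] := Yx.
  have /(_ Yx) Fx : branch rho p x -> F x = 0 by near: x.
  have ts : `|t| <= s.
    apply: le_trans cs; have [_ h] : (forall i, `|arc_coord x ord0 i| <= c ^+ N) /\
      (forall p t, x = branch_pt p t -> `|t| <= c) by near: x; apply/nbhs_rV0; exists d.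
    exact: h xE.
  case=> [[|[|[|//]]] i3]; rewrite /branch_defining //=.
    by rewrite xE !arc_coord_branch arc_pair0 arc_pair1 -!exprM mulnC subrr.
  rewrite xE !arc_coord_branch arc_pair0 arc_pair1 branch_ptK join12_max hs //.
  by rewrite subrr.
have f0 := fx (@Ordinal 3 0 isT); have f1 := fx (@Ordinal 3 1 isT).
have f2 := fx (@Ordinal 3 2 isT); rewrite /branch_defining /= in f0 f1 f2.
have [hc _] : (forall i, `|arc_coord x ord0 i| <= c ^+ N) /\
  (forall p t, x = branch_pt p t -> `|t| <= c) by near: x; apply/nbhs_rV0; exists d.
set l0 := arc_coord x ord0 ord0 in f0 f1.
set l1 := arc_coord x ord0 ord_max in f0 f1.
have arcE t : t ^+ N = l0 -> t ^+ M = l1 -> arc_coord x = arc_pair N M t.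
  move=> e0 e1; apply/rowP => j; rewrite [RHS]mxE; case: eqP => [->|jn]; first by rewrite e0.
  rewrite e1 /l1; congr (arc_coord x _ _); apply: val_inj.
  by case: j jn => [[|[|]]] //= i /(_ (val_inj _)); case.
have piE t : arc_coord x = arc_pair N M t -> proj12 (x *m B) = arc t.
  by move=> e; rewrite /arc -e mulmxKV.
have l01 : l0 ^+ M = l1 ^+ N by apply/eqP; rewrite -subr_eq0; apply/eqP.
(* Then l1 = 0 as well, so x lies in the zeros of F over the origin, and finiteness leaves only x =
   0. *)
have [l00|l0n] := eqVneq l0 0.
  have l10 : l1 = 0.
    by move/eqP: l01; rewrite l00 expr0n eq_sym expf_eq0 N_gt0 => /eqP.
  have pix : pi x = 0.
    rewrite pi_arc (piE 0) ?arc_0 //; apply: arcE.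
      by rewrite expr0n (gtn_eqF N_gt0) l00.
    by rewrite expr0n l10.
  have x0 : x = 0.
    have : (zeros F `&` pi @^-1` [set 0]) x <-> [set 0] x by near: x.
    by case=> h _; apply: h.
  by exists 0; rewrite ?normr0 ?ltW // x0 branch_pt_0.
(* From l0^M = l1^N follows t^N = l0, and then t^M = l0^k t = l1. *)
pose t := l1 / l0 ^+ k.
have lk : l0 ^+ k != 0 by rewrite expf_neq0.
have tN : t ^+ N = l0.
  rewrite /t expr_div_n -l01 -exprM exprS mulfK // expf_neq0 //.
have tM : t ^+ M = l1.
  by rewrite exprS mulnC exprM tN /t divfK.
have tc : `|t| <= c.
  by rewrite -(ler_pXn2r N_gt0) ?nnegrE ?(ltW c0) // -normrX tN; exact: hc.
exists t; first exact: le_trans cr.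
have zE : (x *m B) ord0 ord_max = ev p t.
  have l0kN : l0 ^+ (k * N) != 0 by rewrite expf_neq0.
  apply: (mulfI l0kN); move/eqP: f1; rewrite subr_eq0 => /eqP ->.
  by have := hs t (le_trans tc cs); rewrite tN tM => ->.
by rewrite /branch_pt -zE -(piE t (arcE t tN tM)) join12_eta mulmxKV.
Unshelve. all: by end_near.
Qed.

(** If neither part of a decomposition contained the branch, both would avoid it for all small
    nonzero t, although together they cover it. *)
Lemma branch_irreducible : irreducible_germ (branch rho p).
Proof.
split; first exact: branch_analytic.
  by exists 0; rewrite ?normr0 ?ltW // branch_pt_0.
move=> Z1 Z2 an1 an2 YZ.
have contained Z : germ_sub Z (branch rho p) -> near0 (fun t => Z (branch_pt p t)) ->
    germ_eq (branch rho p) Z.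
  move=> ZY /branch_near YsubZ; rewrite /germ_eq; near=> x; split; first by near: x.
  by near: x; exact: ZY.
have sub1 : germ_sub Z1 (branch rho p).
  rewrite /germ_sub; near=> x => Zx.
  have YZx : branch rho p x <-> (Z1 `|` Z2) x by near: x.
  by apply/YZx; left.
have sub2 : germ_sub Z2 (branch rho p).
  rewrite /germ_sub; near=> x => Zx.
  have YZx : branch rho p x <-> (Z1 `|` Z2) x by near: x.
  by apply/YZx; right.
have [n1|n1] := branch_dichotomy an1; first by left; exact: contained.
have [n2|n2] := branch_dichotomy an2; first by right; exact: contained.
have [t t0 [[Yt YZt] [h1 h2]]] := near0_nz (near0I (near_branch YZ) (near0I n1 n2)).
by case: (YZt.1 Yt) => [/(h1 t0)|/(h2 t0)].
Unshelve. all: by end_near.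
Qed.

End Regular.
End Branch.

(** * The branches as the irreducible components over the arc *)

Section Sheets.
Variable R : realType.
Local Notation K := (C R).
Variables (F : 'rV[K]_3 -> K) (pi : 'rV[K]_3 -> 'rV[K]_2) (A : 'M[K]_3).
Variables (m : nat) (a : 'I_m -> 'rV[K]_2 -> K).
Hypothesis F_form : weierstrass_form F pi A a.
Hypothesis F_holo : holomorphic_germ F.
Hypothesis pi_finite : finite_on (zeros F) pi.
Variables (Y : 'M[K]_2) (N k : nat) (psi : 'I_m -> fps K).
Hypothesis Y_unit : Y \in unitmx.
Hypothesis N_gt0 : (0 < N)%N.
Hypothesis psi_conv : forall i, psi i \in conv.
Hypothesis psi_factors : near0 (fun t =>
  monic_at a (arc Y N k t) = \prod_i ('X - (ev (psi i) t)%:P)).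
Hypothesis psi_distinct : near0 (fun t => t != 0 -> injective (fun i => ev (psi i) t)).

Local Notation arc := (arc Y N k).
Local Notation branch_pt := (branch_pt A Y N k).
Local Notation branch := (branch A Y N k).

Lemma root_arc : near0 (fun t => forall z,
  root (monic_at a (arc t)) z <-> exists i, z = ev (psi i) t).
Proof.
apply: near0_mono psi_factors => t -> z.
rewrite -(big_map (fun i => ev (psi i) t) xpredT (fun w => 'X - w%:P)) root_prod_XsubC.
by split=> [/mapP[i _ ->]|[i ->]]; [exists i|apply/mapP; exists i; rewrite ?mem_index_enum].
Qed.

(** At t = 0 the Weierstrass polynomial is X^m; hence every branch passes through the origin. *)
Lemma psi_0 i : psi i 0%N = 0.
Proof.
have [_ _ a0 _] := F_form.
have [s s0 /(_ 0)] := root_arc; rewrite normr0 (ltW s0) arc_0 // => /(_ isT (psi i 0%N)).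
rewrite /monic_at big1 ?addr0 => [|j _]; last by have [_ ->] := a0 j; rewrite scale0r.
case=> _ h; have : root 'X^m (psi i 0%N) by apply: h; exists i; rewrite ev_at0.
by rewrite /root hornerXn expf_eq0 => /andP[_ /eqP].
Qed.

Lemma arc_components (rho : K) : 0 < rho ->
  num_irreducible_components (zeros F `&` pi @^-1` (arc @` disk rho)) m.
Proof.
move=> rho0.
have roots_psi i : near0 (fun t => root (monic_at a (arc t)) (ev (psi i) t)).
  by apply: near0_mono root_arc => t h; apply/h; exists i.
exists (fun i => branch rho (psi i)); split=> [i|i j ij|].
- exact: (branch_irreducible F_form F_holo pi_finite Y_unit N_gt0 (psi_conv i) (psi_0 i)
    rho0 (roots_psi i)).
(* A common point at a nonzero parameter has the same parameter on both branches, since the arc is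
   injective; distinctness of the roots there forces i = j. *)
- have [t t0 [[Yi Yij] inj]] := near0_nz (near0I
    (near_branch A Y k N_gt0 (psi_conv i) (psi_0 i) rho0 ij) psi_distinct).
  have [t' _ e] := Yij Yi.
  have tt' : t = t'.
    apply: (arc_inj Y_unit N_gt0 (k := k)).
    rewrite -(pi_branch_pt F_form Y N k (psi i) t) e.
    exact: (pi_branch_pt F_form Y N k (psi j) t').
  have evE l (u : K) : ev (psi l) u = (branch_pt (psi l) u *m invmx A) ord0 ord_max.
    by rewrite (branch_ptK F_form Y N k (psi l) u) join12_max.
  have e' : ev (psi i) t = ev (psi j) t.
    by rewrite (evE i t) e -(evE j t') -tt'.
  exact: (inj t0 i j e').
have [s s0 hs] := root_arc.
have [c c0 [cs cr]] := pos_min s0 rho0.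
have [d1 d10 hd1] := parameter_small F_form k Y_unit N_gt0 c0.
have [d2 d20 hd2] := weierstrass_zeros F_form.
have [d d0 [dd1 dd2]] := pos_min d10 d20.
apply/nbhs_rV0; exists d => // x xd.
have [_ hx] := hd1 x (fun i => le_trans (xd i) dd1).
have Fx := hd2 x (fun i => le_trans (xd i) dd2).
split=> [[/Fx rx [t tr piE]]|[i [t tr xE]]].
  have e : proj12 (x *m invmx A) = arc t by rewrite -(pi_arc F_form).
  have pt p : (x *m invmx A) ord0 ord_max = ev p t -> x = branch_pt p t.
    by move=> z; rewrite /branch_pt -z -e join12_eta mulmxKV //; have [] := F_form.
  (* Before the branch through x is known, x is viewed as a point of the constant series equal to
     its third coordinate, just to bound t. *)
  have ts := le_trans (hx _ t (pt _ (esym (evC _ t)))) cs.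
  rewrite e in rx; have [/(_ rx)[i zE] _] := hs t ts ((x *m invmx A) ord0 ord_max).
  by exists i, t => //; exact: pt.
have ts := le_trans (hx _ _ xE) cs.
split; last by exists t => //; rewrite xE (pi_branch_pt F_form).
by apply/Fx; rewrite xE (branch_ptK F_form) proj12_join12 join12_max; apply/hs => //; exists i.
Qed.

Lemma arc_injective : exists2 r : K, 0 < r & injective_arc r arc.
Proof.
have hc (i : 'I_2) : holo (fun t : 'rV[K]_1 => arc (t ord0 ord0) ord0 i).
  have hX n : holo (fun t : 'rV[K]_1 => t ord0 ord0 ^+ n).
    exact: holoXn n (holo_coord R (ord0 : 'I_1)).
  have -> : (fun t : 'rV[K]_1 => arc (t ord0 ord0) ord0 i) = (fun t =>
      t ord0 ord0 ^+ N * Y ord0 i + t ord0 ord0 ^+ (k * N).+1 * Y ord_max i).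
    apply/funext => t; rewrite [LHS]mxE big_ord_recl big_ord1 arc_pair0.
    by rewrite [lift _ _](_ : _ = ord_max) ?arc_pair1 //; apply: val_inj.
  exact: holoD (holoM (hX N) (holo_cst _ _)) (holoM (hX _) (holo_cst _ _)).
have /choice[r hr] : forall i, exists r : K, 0 < r /\ forall s, 0 < s -> s <= r ->
    pseries_on s (fun t : 'rV[K]_1 => arc (t ord0 ord0) ord0 i).
  by move=> i; have [r r0 h] := pseries_on_small (hc i); exists r.
have [r0 r01] := hr ord0; have [r1 r11] := hr ord_max.
have [c c0 [cr0 cr1]] := pos_min r0 r1.
exists c => //; split; first exact: arc_0.
  move=> j; have [->|jn] := eqVneq j ord0; first exact: r01.
  have -> : j = ord_max by apply: val_inj; case: j jn => [[|[|]]].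
  exact: r11.
by move=> s t _ _ /(arc_inj Y_unit N_gt0).
Qed.

End Sheets.

Theorem theorem5p2 (R : realType) (F : 'rV[C R]_3 -> C R)
    (pi : {linear 'rV[C R]_3 -> 'rV[C R]_2}) (d : nat)
    (F_reduced : reduced_equation F)
    (pi_surj : range pi = [set: 'rV[C R]_2])
    (pi_finite : finite_on (zeros F) pi)
    (d_degree : cover_degree F pi d) :
  exists (gamma : C R -> 'rV[C R]_2) (r0 : C R),
    [/\ 0 < r0, injective_arc r0 gamma &
        forall r : C R, 0 < r -> r <= r0 ->
          num_irreducible_components
            (zeros F `&` pi @^-1` (gamma @` disk r)) d].
Proof.
have [Delta [A [m [a [F_form ->]]]] [U0 U0n U0d]] := d_degree.
have [_ _ a_germ _] := F_form.
have a_holo i : holo (a i) by apply: germ_holo; case: (a_germ i).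
have a0 i : a i 0 = 0 by case: (a_germ i).
have F_holo : holomorphic_germ F by case: F_reduced.
have [E [Eh Enz Esep]] := separable_locus a_holo F_reduced F_form.
have [Y [N [k [psi [Yu N0 psi_conv fac dist]]]]] := arc_roots a_holo a0 Eh Enz Esep.
(* The degree given by point counts is replaced by the degree of the Weierstrass polynomial, which
   is the number of branches constructed. *)
have -> := cover_degreeE F_form Enz Esep U0n U0d.
have [r0 r00 r0i] := arc_injective k Yu N0.
exists (arc Y N k), r0; split=> // r r_gt0 _.
exact: (arc_components F_form F_holo pi_finite Yu N0 psi_conv fac dist r_gt0).
Qed.
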